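(* Let $(\mu_n)_{n\ge 1}$ be probability measures on $\{0,1\}$ with $0<\mu_n(0)<1$ for all $n$. Put $\mu_n:=\mu_1$ for $n\le 0$, let $\widetilde X=\{0,1\}^{\mathbb Z}$, $\widetilde\mu=\bigotimes_{n\in\mathbb Z}\mu_n$, and let $\widetilde T$ be the two-sided shift on $\widetilde X$. Assume that $\widetilde T$ is $\widetilde\mu$-nonsingular. (i) If $\sum_{n=1}^\infty(\mu_n(0)-\mu_1(0))^2<\infty$, then $\widetilde\mu$ is equivalent to $\bigotimes_{n=-\infty}^{\infty}\mu_1$, and hence $\widetilde T$ is of type $II_1$. (ii) If $\sum_{n=1}^\infty(\mu_n(0)-\mu_1(0))^2=\infty$ and $\widetilde T$ is conservative, then $\widetilde T$ is ergodic of type $III_1$ and the Maharam extension of $\widetilde T$ is a weakly mixing $K$-automorphism.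
   Context: The shift is $(\widetilde Tx)_n=x_{n+1}$. An invertible Borel transformation $R$ of a $\sigma$-finite standard measure space $(Y,\mathfrak C,\nu)$ is $\nu$-nonsingular if $\nu\circ R^{-1}\sim\nu$. It is conservative if for each $A$ with $\nu(A)>0$ there is $n>0$ with $\nu(R^{-n}A\cap A)>0$. The Radon-Nikodym derivative of $R$ is $\omega_{R,\nu}=d(\nu\circ R)/d\nu$. The Maharam extension of $R$ is the transformation $(y,t)\mapsto (Ry,\omega_{R,\nu}(y)t)$ of $(Y\times\mathbb R_+^*,\nu\times\kappa)$, where $\kappa$ is a measure on $\mathbb R^*_+$ equivalent to Lebesgue measure with $\kappa(aB)=a^{-1}\kappa(B)$ for all $a>0$ and Borel $B$; it preserves $\nu\times\kappa$. For ergodic $R$ on a non-atomic space: $R$ is of type $II_1$ if there is a finite $R$-invariant measure equivalent to $\nu$; $R$ is of type $III_1$ if its Maharam extension is ergodic. $R$ is a $K$-automorphism if there is a sub-$\sigma$-algebra $\mathfrak F\subset\mathfrak C$ on which $\nu$ is $\sigma$-finite such that $R^{-1}\mathfrak F\subset\mathfrak F$, $\omega_{R,\nu}$ is $\mathfrak F$-measurable, $\bigvee_{n>0}R^n\mathfrak F=\mathfrak C$ (mod $\nu$), and $\bigcap_{n>0}R^{-n}\mathfrak F=\{\emptyset,Y\}$ (mod $\nu$). $R$ is weakly mixing if $R\times S$ is ergodic for every ergodic probability preserving transformation $S$. *)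

(* Defs.v *)
From HB Require Import structures.
From mathcomp Require Import all_boot all_order all_algebra.
From mathcomp Require Import all_classical all_reals all_analysis.
From mathcomp Require Import measurable_realfun.
From mathcomp Require Import ring lra.

Set Implicit Arguments.
Unset Strict Implicit.
Unset Printing Implicit Defensive.
Import Order.TTheory GRing.Theory Num.Theory.
Import numFieldNormedType.Exports.
Local Open Scope classical_set_scope.
Local Open Scope ring_scope.

(* The space {0,1}^I with its product sigma-algebra, generated by the sets
   {x | x_i = b}; the point 0 of {0,1} is [false] and the point 1 is [true]. *)
Definition bits (I : Type) := I -> bool.

Definition bits_cylinder (I : Type) : set (set (bits I)) :=
  [set C | exists i b, C = [set x | x i = b]].

HB.instance Definition _ (I : Type) := Pointed.on (bits I).
HB.instance Definition _ (I : Type) :=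
  Measurable.copy (bits I) (g_sigma_algebraType (@bits_cylinder I)).

Definition is_product_measure (R : realType) (I : countType)
    (mu : I -> probability bool R) (P : set (bits I) -> \bar R) :=
  forall (s : seq I) (a : I -> bool), uniq s ->
    P [set x | forall i, i \in s -> x i = a i] =
    (\prod_(i <- s) fine (mu i [set a i]))%:E.

Definition posreal (R : realType) := {posnum R}.

HB.instance Definition _ (R : realType) := Choice.on (posreal R).
HB.instance Definition _ (R : realType) := isPointed.Build (posreal R) 1%:pos.
HB.instance Definition _ (R : realType) := Measurable.copy (posreal R)
  (g_sigma_algebra_preimageType
     ((fun t => t%:num) : posreal R -> measurableTypeR R)).

(* Infinite products of measures are not in the library. The product of the
   mu_i is obtained as the law, under a uniform variable u on [0,1[, of the
   digits produced by the map that splits [0,1[ at p_n = mu_n(0) and rescales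
   the piece containing u to [0,1[. *)
Section product_measure_existence.
Context (R : realType).
Local Notation leb := (@lebesgue_measure R).

Lemma lebesgue_affine (q r : R) (D : set R) : 0 < r -> measurable D ->
  leb ((fun u => (u - q) / r) @^-1` D) = (r%:E * leb D)%E.
Proof.
move=> r0 mD.
pose f u : R := (u - q) / r.
have mf : measurable_fun [set: R] f.
  by apply: measurable_funM => //; exact: measurable_funB.
have rV0 : 0 <= r^-1 by rewrite invr_ge0 ltW.
pose m : {measure set (measurableTypeR R) -> \bar R} :=
  pushforward leb (f : measurableTypeR R -> measurableTypeR R).
have H : leb D = mscale (NngNum rV0) (m mf) D.
  apply: lebesgue_measure_unique => // _ [[a b]] _ <-.
  change (leb `]a, b]%classic = ((r^-1)%:E * leb (f @^-1` `]a, b]%classic))%E).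
  have -> : f @^-1` `]a, b]%classic = `](r * a + q), (r * b + q)]%classic.
    apply/seteqP; split => u /=; rewrite !in_itv/= /f.
      by rewrite ltr_pdivlMr// ler_pdivrMr// => /andP[? ?]; apply/andP; lra.
    by rewrite ltr_pdivlMr// ler_pdivrMr// => /andP[? ?]; apply/andP; lra.
  rewrite !lebesgue_measure_itv/= !lte_fin ltrD2r ltr_pM2l//.
  case: ifPn => _; last by rewrite mule0.
  by rewrite -!EFinB -EFinM; congr EFin; field; rewrite gt_eqF.
rewrite H /mscale/= muleA -EFinM divff ?gt_eqF// mul1e.
by [].
Qed.

Let mI : measurable (`[0, 1[%classic : set (measurableTypeR R)).
Proof. exact: measurable_itv. Qed.

Let U := mrestr leb mI.
HB.instance Definition _ := Measure.on U.
Let U1 : U setT = 1%E.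
Proof. by rewrite /U /mrestr setTI lebesgue_measure_itv/= lte01 oppr0 adde0. Qed.
HB.instance Definition _ := @Measure_isProbability.Build _ _ R U U1.

Lemma unif_affine (q r : R) (D : set R) : 0 <= r -> measurable D ->
  leb (`[q, q + r[ `&` (fun u => (u - q) / r) @^-1` D) = (r%:E * U D)%E.
Proof.
rewrite le_eqVlt => /predU1P[<- mD|r0 mD].
  rewrite addr0 mul0e (_ : _ `&` _ = set0) ?measure0//.
  by apply/seteqP; split => // u /= []; rewrite in_itv/= => /andP[? ?]; lra.
rewrite /U /mrestr -(lebesgue_affine q)//; last exact: measurableI.
congr (leb _); apply/seteqP; split => u /=; rewrite !in_itv/=.
  move=> [/andP[? ?] ?]; split => //; rewrite ler_pdivlMr// ltr_pdivrMr//.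
  by apply/andP; lra.
rewrite ler_pdivlMr// ltr_pdivrMr// => -[? /andP[? ?]]; split => //.
by apply/andP; lra.
Qed.

Variable p : nat -> R.
Hypothesis p01 : forall n, 0 <= p n <= 1.

Let bit n (u : R) : bool := p n <= u.
Let next n (u : R) : R := if bit n u then (u - p n) / (1 - p n) else u / p n.
Fixpoint digit m u k : bool :=
  if k is k'.+1 then digit m.+1 (next m u) k' else bit m u.

Let weight (n : nat) (b : bool) : R := if b then 1 - p n else p n.

Let mbit n : measurable_fun [set: R] (bit n).
Proof. by apply: measurable_fun_ler. Qed.

Let mnext n : measurable_fun [set: R] (next n).
Proof.
apply: measurable_fun_ifT => //; apply: measurable_funM => //.
exact: measurable_funB.
Qed.

Let mdigit m k : measurable_fun [set: R] (fun u => digit m u k).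
Proof.
elim: k m => [|k IH] m /=; first exact: mbit.
by apply: (measurableT_comp (IH m.+1)); exact: mnext.
Qed.

Fixpoint digits_in (B : nat -> pred bool) m n : set R :=
  if n is n'.+1 then
    [set u | B m (bit m u) /\ digits_in B m.+1 n' (next m u)]
  else setT.

Let mdigits_in B m n : measurable (digits_in B m n).
Proof.
elim: n m => [|n IH] m /=; first exact: measurableT.
apply: measurableI.
  by rewrite -[X in measurable X]setTI; exact: (mbit _ _ (Y := [set b | B m b])).
by rewrite -[X in measurable X]setTI; exact: mnext.
Qed.

Let digits_inE B m n u :
  digits_in B m n u <-> forall k, (k < n)%N -> B (m + k)%N (digit m u k).
Proof.
elim: n m u => [|n IH] m u /=; first by split.
rewrite IH; split => [[B0 Bk] [|k]|Bk].
- by rewrite addn0.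
- by rewrite ltnS => /Bk; rewrite addSnnS.
- split; first by have := Bk 0 (ltn0Sn _); rewrite addn0.
  by move=> k kn; have := Bk k.+1; rewrite ltnS -addSnnS; exact.
Qed.

Lemma unif_digits_in B m n : U (digits_in B m n) =
  (\prod_(m <= k < m + n) \sum_(b : bool | B k b) weight k b)%:E.
Proof.
elim: n m => [|n IH] m /=; first by rewrite addn0 big_geq// U1.
have /andP[p0 p1] := p01 m.
rewrite addnS big_ltn ?ltnS ?leq_addr// -addSn.
rewrite EFinM -IH.
set D := digits_in B m.+1 n.
have mD : measurable D by exact: mdigits_in.
have step (b : bool) : leb ([set u | B m (bit m u) /\ D (next m u)] `&` `[0, 1[ `&`
   [set u | bit m u = b]) = ((if B m b then weight m b else 0)%:E * U D)%E.
  case: ifPn => Bb; last first.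
    rewrite mul0e (_ : _ `&` _ = set0) ?measure0//.
    by apply/seteqP; split => // u /= [[[Bu _] _] bu]; move: Bb; rewrite -bu Bu.
  have w0 : 0 <= weight m b by rewrite /weight; case: ifP => // _; rewrite subr_ge0.
  rewrite -(unif_affine (if b then p m else 0))//.
  case: b Bb w0 => Bb _; congr (leb _);
    apply/seteqP; split => u; rewrite /= !in_itv/= /next /bit.
  - move=> [[[_ +] /andP[? ?]] pu]; rewrite pu => ?; split => //.
    by apply/andP; split => //; lra.
  - move=> [/andP[pu ?]]; rewrite pu => ?; do ! split => //.
    by apply/andP; split; lra.
  - move=> [[[_ +] /andP[? ?]] pu]; rewrite pu => ?.
    rewrite subr0 add0r; split => //.
    by apply/andP; split => //; rewrite ltNge pu.
  - rewrite subr0 add0r => -[/andP[? up]].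
    by rewrite leNgt up/= => ?; do ! split => //; apply/andP; split; lra.
rewrite {1}/U /mrestr.
have mE : measurable ([set u | B m (bit m u) /\ D (next m u)] `&` `[0, 1[).
  by apply: measurableI => //; exact: (mdigits_in B m n.+1).
have mb b : measurable [set u | bit m u = b].
  by rewrite -[X in measurable X]setTI; exact: (mbit _ _ (Y := [set b])).
rewrite -(setIT (_ `&` `[0, 1[)).
have -> : [set: R] = [set u | bit m u = true] `|` [set u | bit m u = false].
  by apply/seteqP; split => // u _ /=; case: (bit m u); [left|right].
rewrite setIUr measureU//=; last 3 first.
- exact: (measurableI _ _ mE (mb true)).
- exact: (measurableI _ _ mE (mb false)).
- by apply/seteqP; split => // u /= [[_ ->] []].
rewrite !step -ge0_muleDl ?lee_fin; last 2 first.
- by case: ifP => //= _; rewrite subr_ge0.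
- by case: ifP.
by rewrite -EFinD [in RHS]big_mkcond big_bool.
Qed.

Lemma measurable_digits (I : countType) :
  measurable_fun [set: measurableTypeR R]
    ((fun u i => digit 0 u (pickle i)) : measurableTypeR R -> bits I).
Proof.
apply: (@measurability _ _ _ _ _ _ (@bits_cylinder I)) => //.
move=> _ [_ [i [b ->]] <-].
exact: (mdigit 0 (pickle i) measurableT (Y := [set b])).
Qed.

Lemma unif_digits (I : countType) (s : seq I) (a : I -> bool) : uniq s ->
  U [set u | forall i, i \in s -> digit 0 u (pickle i) = a i] =
  (\prod_(i <- s) weight (pickle i) (a i))%:E.
Proof.
move=> us.
pose B k b := if @pickle_inv I k is Some i then (i \in s) ==> (b == a i) else true.
have [N sN] : exists N, forall i, i \in s -> (pickle i < N)%N.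
  by exists (\max_(i <- s) pickle i).+1 => i si; rewrite ltnS; exact: leq_bigmax_seq.
have -> : [set u | forall i, i \in s -> digit 0 u (pickle i) = a i] =
    digits_in B 0 N.
  apply/seteqP; split => u /=; rewrite digits_inE => H.
    move=> k _; rewrite add0n /B.
    have := @pickle_invK I k; case: pickle_inv => //= i <-.
    by apply/implyP => si; apply/eqP/H.
  move=> i si; have := H _ (sN _ si); rewrite add0n /B pickleK_inv si.
  exact: eqP.
rewrite unif_digits_in; congr EFin; rewrite add0n.
pose w k := \sum_(b | B k b) weight k b.
rewrite -/w.
have wN k : k \notin map pickle s -> w k = 1.
  move=> ks; rewrite /w big_mkcond big_bool /B.
  have := @pickle_invK I k; case: pickle_inv => /= [i ik|_].
    have -> : i \in s = false by apply: contraNF ks => si; rewrite -ik map_f.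
    by rewrite /weight/=; ring.
  by rewrite /weight/=; ring.
have ws i : i \in s -> w (pickle i) = weight (pickle i) (a i).
  move=> si; rewrite /w (eq_bigl (pred1 (a i))) ?big_pred1_eq// => b.
  by rewrite /B pickleK_inv si.
rewrite (bigID (mem (map pickle s)))/= [X in _ * X]big1 ?mulr1; last first.
  by move=> k /wN.
rewrite -big_filter (perm_big (map pickle s)); last first.
  apply: uniq_perm; [by rewrite filter_uniq ?iota_uniq| |].
    by rewrite map_inj_uniq//; exact: (pcan_inj pickleK).
  move=> k; rewrite mem_filter andb_idr// => /mapP[i si ->].
  by rewrite mem_index_iota sN.
by rewrite big_map [LHS]big_seq [RHS]big_seq; apply: eq_bigr => i /ws.
Qed.

Lemma product_measure_exists0 (I : countType) :
  exists P : probability (bits I) R,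
  forall (s : seq I) (a : I -> bool), uniq s ->
    P [set x | forall i, i \in s -> x i = a i] =
    (\prod_(i <- s) (if a i then 1 - p (pickle i) else p (pickle i)))%:E.
Proof.
pose X := mfun_Sub (mem_set (@measurable_digits I)).
exists (distribution (U : probability (measurableTypeR R) R) X) => s a us.
rewrite -(unif_digits a us).
by [].
Qed.

End product_measure_existence.

Lemma product_measure_exists (R : realType) (I : countType)
    (mu : I -> probability bool R) :
  exists P : probability (bits I) R, is_product_measure mu P.
Proof.
pose p k := if @pickle_inv I k is Some i then fine (mu i [set false]) else 0.
have p01 k : 0 <= p k <= 1.
  rewrite /p; case: pickle_inv => [i|]; last by rewrite lexx ler01.
  rewrite fine_ge0//= -lee_fin fineK ?fin_num_measure//.
  exact: probability_le1.
have [P HP] := product_measure_exists0 p01 I.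
exists P => s a us; rewrite HP//; congr EFin; apply: eq_bigr => i _.
rewrite /p pickleK_inv; case: (a i) => //.
have -> : [set true] = ~` [set false] by apply/seteqP; split => -[] //= /(_ erefl).
by rewrite probability_setC// fineB ?fin_num_measure.
Qed.

Definition infinite_product (R : realType) (I : countType)
    (mu : I -> probability bool R) : probability (bits I) R :=
  sval (cid (product_measure_exists mu)).

Lemma infinite_productP (R : realType) (I : countType)
    (mu : I -> probability bool R) : is_product_measure mu (infinite_product mu).
Proof. exact: svalP (cid (product_measure_exists mu)). Qed.

Definition equivalent_measure d (Y : measurableType d) (R : realType)
    (m1 m2 : set Y -> \bar R) := m1 `<< m2 /\ m2 `<< m1.

Section dynamics.
Context d (Y : measurableType d) (R : realType).
Implicit Types (nu : {measure set Y -> \bar R}) (S : Y -> Y).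
Implicit Types (F : set (set Y)) (w : Y -> posreal R).

Definition invertible_borel S := measurable_fun setT S /\
  exists2 S' : Y -> Y, measurable_fun setT S' & cancel S S' /\ cancel S' S.

Definition nonsingular nu S :=
  invertible_borel S /\ equivalent_measure (pushforward nu S) nu.

Definition measure_preserving (m : set Y -> \bar R) S :=
  forall A, measurable A -> m (S @^-1` A) = m A.

Definition conservative nu S := forall A, measurable A -> (0 < nu A)%E ->
  exists2 n, (0 < n)%N & (0 < nu ((iter n S @^-1` A) `&` A))%E.

Definition ergodic nu S := forall A, measurable A -> S @^-1` A = A ->
  nu A = 0%E \/ nu (~` A) = 0%E.

Definition nonatomic nu := forall A, measurable A -> (0 < nu A)%E ->
  exists B, [/\ measurable B, B `<=` A, (0 < nu B)%E & (0 < nu (A `\` B))%E].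

Definition is_rn_derivative nu S w := measurable_fun setT w /\
  forall A, measurable A -> nu (S @` A) = (\int[nu]_(y in A) (w y)%:num%:E)%E.

(* The derivative of nu o S with respect to nu is only defined up to a null
   set; a strictly positive version is chosen, which exists as soon as S is
   nonsingular. The value 1 outside that case is a dummy. *)
Definition rn_derivative nu S : Y -> posreal R :=
  xget (fun=> 1%:pos : posreal R) [set w | is_rn_derivative nu S w].

Definition maharam nu S (p : Y * posreal R) : Y * posreal R :=
  (S p.1, ((rn_derivative nu S p.1)%:num * p.2%:num)%:pos).

Definition type_II1 nu S :=
  [/\ nonsingular nu S, ergodic nu S, nonatomic nu &
  exists m : {finite_measure set Y -> \bar R},
    measure_preserving m S /\ equivalent_measure m nu].

Definition sigma_finite_on nu F :=
  exists2 E : (set Y)^nat, \bigcup_n E n = setT &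
    forall n, F (E n) /\ (nu (E n) < +oo)%E.

(* S^n F generate, up to nu-null sets, the whole sigma-algebra. *)
Definition exhaustive nu S F := forall A, measurable A ->
  exists2 B, <<s \bigcup_(n in [set n | (0 < n)%N]) [set iter n S @` C | C in F] >> B
           & nu (A `+` B) = 0%E.

(* The intersection of the S^-n F is trivial up to nu-null sets. *)
Definition trivial_tail nu S F := forall A,
  (forall n, (0 < n)%N -> exists2 B, F B & A = iter n S @^-1` B) ->
  nu A = 0%E \/ nu (~` A) = 0%E.

(* As the derivative is defined up to a null set, its F-measurability means
   that it has an F-measurable version. *)
Definition rn_derivative_measurable_on nu S F := exists2 w : Y -> posreal R,
  (forall B, measurable B -> F (w @^-1` B)) &
  {ae nu, forall y, rn_derivative nu S y = w y}.

Definition K_automorphism nu S := nonsingular nu S /\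
  exists F, [/\ sigma_algebra setT F, F `<=` measurable & sigma_finite_on nu F] /\
    [/\ (forall A, F A -> F (S @^-1` A)), rn_derivative_measurable_on nu S F,
        exhaustive nu S F & trivial_tail nu S F].

(* Borel isomorphic to a Borel subset of the real line. *)
Definition standard_borel := exists f : Y -> R,
  [/\ measurable_fun setT f, injective f &
      forall A, measurable A -> measurable (f @` A)].

End dynamics.
Arguments standard_borel {d} Y R.

Section rn_derivative_existence.
Context d (Y : measurableType d) (R : realType).

Lemma rn_derivativeP (nu : {measure set Y -> \bar R}) (S : Y -> Y) :
  (exists w, is_rn_derivative nu S w) -> is_rn_derivative nu S (rn_derivative nu S).
Proof. exact: (@xgetPex _ (fun=> 1%:pos : posreal R) [set w | is_rn_derivative nu S w]). Qed.

Let image_can (S S' : Y -> Y) A : cancel S S' -> cancel S' S ->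
  S @` A = S' @^-1` A.
Proof.
move=> SK S'K; apply/seteqP; split => y /=; first by move=> [x Ax <-]; rewrite SK.
by exists (S' y).
Qed.

Lemma rn_derivative_preserving (nu : {measure set Y -> \bar R}) (S : Y -> Y) :
  invertible_borel S -> measure_preserving nu S ->
  is_rn_derivative nu S (rn_derivative nu S).
Proof.
move=> [mS [S' mS' [SK S'K]]] nuS; apply: rn_derivativeP; exists (fun=> 1%:pos).
split; first exact: measurable_cst.
move=> A mA; rewrite integral_cst// mul1e (image_can _ SK S'K) -nuS.
  by rewrite -comp_preimage (_ : S' \o S = id)//; apply/funext => x /=; rewrite SK.
by rewrite -[X in measurable X]setTI; exact: mS'.
Qed.

Lemma rn_derivative_finite (nu : {finite_measure set Y -> \bar R}) (S : Y -> Y) :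
  nonsingular nu S -> is_rn_derivative nu S (rn_derivative nu S).
Proof.
move=> [[mS [S' mS' [SK S'K]]] [nuS1 nuS2]].
have mpre A : measurable A -> measurable (S' @^-1` A).
  by move=> mA; rewrite -[X in measurable X]setTI; exact: mS'.
pose m : {measure set Y -> \bar R} := pushforward nu S'.
have mfin : fin_num_fun (m mS').
  by move=> A mA; exact/fin_num_measure/mpre.
pose FI := Measure_isFinite.Build _ _ _ (m mS') mfin.
pose nu' : {finite_measure set Y -> \bar R} :=
  HB.pack (Measure.sort (m mS')) FI (Measure.class (m mS')).
have nu'S A : nu' A = nu (S @` A) by rewrite (image_can _ SK S'K).
have preS A : S @^-1` (S @` A) = A.
  by rewrite (image_can _ SK S'K) -comp_preimage (_ : S' \o S = id)//;
     apply/funext => x /=; rewrite SK.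
have mimg A : measurable A -> measurable (S @` A).
  by move=> mA; rewrite (image_can _ SK S'K); exact: mpre.
have mpreS A : measurable A -> measurable (S @^-1` A).
  by move=> mA; rewrite -[X in measurable X]setTI; exact: mS.
have nu'nu : nu' `<< nu.
  apply/null_content_dominatesP => A mA nuA0.
  rewrite nu'S; apply: (nuS2 (S @` A)) (mimg _ mA) _ => // B mB BA.
  apply: (subset_measure0 _ mA _ nuA0); first exact: mpreS.
  by rewrite -(preS A); exact: preimage_subset.
have nu0 A : measurable A -> nu (S @` A) = 0%E -> nu A = 0%E.
  move=> mA SA0; rewrite -(preS A).
  apply: (nuS1 (S @` A)) (mimg _ mA) _ => // B mB BA.
  by apply: (subset_measure0 mB _ BA SA0); exact: mimg.
have [f [f0 ffin intf fE]] := radon_nikodym_sigma_finite nu'nu.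
have mf : measurable_fun setT (fine \o f).
  exact: measurableT_comp (measurable_int _ intf).
apply: rn_derivativeP.
have fpos : exists2 w : Y -> posreal R, measurable_fun setT w &
    forall y, f y != 0%E -> ((w y)%:num)%:E = f y.
  have mg : measurable_fun setT
      (fun y => if 0 < fine (f y) then fine (f y) else 1).
    apply: measurable_fun_ifT => //.
    exact: measurable_fun_ltr.
  have g0 y : 0 < (if 0 < fine (f y) then fine (f y) else 1) by case: ifP.
  exists (fun y => PosNum (g0 y)).
    move=> _ _ [B mB <-]; rewrite setTI.
    by have := mg measurableT B mB; rewrite !setTI.
  move=> y fy0 /=; rewrite fine_gt0 ?fineK//.
  by rewrite lt0e fy0 f0/= ltey_eq ffin.
have [w mw wf] := fpos; exists w; split => // A mA.
have mfe : measurable_fun setT f := measurable_int _ intf.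
have mN : measurable (f @^-1` [set 0%E]).
  by rewrite -[X in measurable X]setTI; exact: mfe.
transitivity (nu' A); first by rewrite nu'S.
rewrite fE//; apply: ae_eq_integral => //.
- exact: measurable_funTS.
- apply: measurable_funTS; apply/measurable_EFinP => _ B mB.
  have mB' : measurable ((fun t : posreal R => t%:num) @^-1` B).
    by exists B => //; rewrite setTI.
  exact: (mw measurableT _ mB').
exists (f @^-1` [set 0%E]); split => //.
- apply: nu0 => //; rewrite -nu'S fE//.
  by apply: integral0_eq => y.
- move=> y /= H; apply: contrapT => fy0; apply: H => _; rewrite wf//.
  exact/eqP.
Qed.

End rn_derivative_existence.

(* The second factor ranges over the invertible ergodic probability preserving
   transformations of standard Borel spaces. *)
Definition weakly_mixing d (Y : measurableType d) (R : realType)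
    (nu : {measure set Y -> \bar R}) (S : Y -> Y) :=
  forall dZ (Z : measurableType dZ) (P : probability Z R) (Q : Z -> Z),
    standard_borel Z R -> invertible_borel Q -> measure_preserving P Q ->
    ergodic P Q -> ergodic (nu \x P)%E (fun p => (S p.1, Q p.2)).

Definition maharam_kappa (R : realType) (kappa : set (posreal R) -> \bar R) :=
  equivalent_measure kappa
    (fun B => lebesgue_measure ((fun t : posreal R => t%:num) @` B)) /\
  forall (a : posreal R) (B : set (posreal R)), measurable B ->
    kappa ((fun t : posreal R => (a%:num * t%:num)%:pos) @` B) =
    ((a%:num^-1)%:E * kappa B)%E.

Definition type_III1 d (Y : measurableType d) (R : realType)
    (kappa : {sigma_finite_measure set (posreal R) -> \bar R})
    (nu : {measure set Y -> \bar R}) (S : Y -> Y) :=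
  [/\ nonsingular nu S, ergodic nu S, nonatomic nu &
      ergodic (nu \x kappa)%E (maharam nu S)].

Definition bits_shift (x : bits int) : bits int := fun n => x (n + 1).

(* The value mu 0 is not used. *)
Definition two_sided (R : realType) (mu : nat -> probability bool R) (n : int) :
    probability bool R :=
  if n is Posz k.+1 then mu k.+1 else mu 1%N.

(* Main.v *)
Require Import Defs.
From HB Require Import structures.
From mathcomp Require Import all_boot all_order all_algebra.
From mathcomp Require Import all_classical all_reals all_analysis.
From mathcomp Require Import measurable_realfun.
From mathcomp Require Import ring lra zify.
Set Implicit Arguments.
Unset Strict Implicit.
Unset Printing Implicit Defensive.
Import Order.TTheory GRing.Theory Num.Theory.
Import numFieldNormedType.Exports.
Local Open Scope classical_set_scope.
Local Open Scope ring_scope.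

(** Part (i). Square summability forces mu_n(0) to converge to mu_1(0), so the weights of all
    coordinates stay away from 0 and 1. The second moment of the likelihood ratio of two product
    measures is a product of factors 1 + (p - p')^2 / (p' q'), hence at most the exponential of a
    convergent sum. This gives P(A)^2 <= M Q(A) in both directions ([chi2_bound],
    [kakutani_dominates]). The Bernoulli measure is invariant and ergodic ([iid_ergodic]), so the
    shift is of type II_1.

    Part (ii). Write T for the shift, w for its derivative and S(x, t) = (T x, w(x) t). As the
    coordinates up to 1 are identically distributed, w has a version that depends on positive
    coordinates only. The core is [tail_trivial]: an event A that for every n is S^-n of an event of
    the positive coordinates and t is null or conull. The n-th derivative is h_n(x) divided by the
    product over k <= n of mu_k(x_k) / mu_1(x_k), where h_n sees only coordinates after n
    ([cocycle_factor]). Averaging A over the coordinates after n therefore yields bounded functions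
    F_n that are space-time harmonic for the random walk on the positive reals with steps mu_k(b) /
    mu_1(b). Such functions are constant when the variances of the small jumps have a divergent sum
    ([harmonic_prim_linear]): after smoothing, F_n is a bounded martingale along the walk whose
    increment is about the jump size times a derivative; the derivative is a martingale too, and the
    total variance is bounded, so the derivative vanishes. Constancy means that A is independent of
    all rectangles, hence trivial.

    The divergence comes from d_n = mu_n(0) - mu_1(0). The squares of d_n have infinite sum by
    assumption, nonsingularity gives d_(n+1) - d_n -> 0, and conservativity gives liminf |d_n| = 0,
    both through Hellinger affinities. Hence the squares of those d_n that lie below any fixed level
    still have infinite sum ([small_jumps_diverge]).

    For weak mixing, conservativity makes the cocycle of w at least 1 infinitely often
    ([cocycle_ge1_infinitely_often]), so S x Q is recurrent for every Q. A martingale argument then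
    shows that its invariant sets are events of the future ([invariant_future]); their sections over
    Z are tail events of S, hence trivial, and ergodicity of Q concludes. Ergodicity of the Maharam
    extension, and so type III_1, is the case of a one-point Q. For the K-property the
    sub-sigma-algebra consists of the future events, and its tail is trivial by [tail_trivial]
    again. All measures with the scaling law of kappa have the same null sets, so the work is done
    for the concrete measure [kappa0]. *)

Notation pushforward_measure :=
  measure_function_pushforward__canonical__measure_function_Measure.
Notation mrestr_measure := measure_function_mrestr__canonical__measure_function_Measure.
Notation mscale_measure := measure_function_mscale__canonical__measure_function_Measure.

(** * Cylinders and measurability in {0,1}^I *)

Section bits_measurability.
Context (I : countType).

Definition agree_on (J : pred I) (x y : bits I) := forall i, J i -> x i = y i.

Definition depends_on (Y : Type) (J : pred I) (f : bits I -> Y) :=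
  forall x y, agree_on J x y -> f x = f y.

Definition merge (J : pred I) (y x : bits I) : bits I :=
  fun i => if J i then y i else x i.

Definition cylinder (s : seq I) (a : bits I) : set (bits I) :=
  [set x | forall i, i \in s -> x i = a i].

Lemma measurable_bitsP d (T : measurableType d) (D : set T) (f : T -> bits I) :
  measurable D -> (forall i, measurable_fun D (fun t => f t i)) ->
  measurable_fun D f.
Proof.
move=> mD mf; apply: (@measurability _ _ _ _ _ _ (@bits_cylinder I)) => //.
move=> _ [_ [i [b ->]] <-].
exact: (mf i mD [set b]).
Qed.

Lemma measurable_coord (i : I) : measurable_fun setT (fun x : bits I => x i).
Proof.
have m1 b : measurable [set x : bits I | x i = b].
  by apply: sub_sigma_algebra; exists i, b.
apply: (@measurable_fun_bool _ _ _ _ true); rewrite setTI.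
exact: m1.
Qed.

Lemma measurable_coord_eq (i : I) b : measurable [set x : bits I | x i = b].
Proof. by apply: sub_sigma_algebra; exists i, b. Qed.

Lemma cylinder_nil a : cylinder [::] a = setT.
Proof. by apply/seteqP; split. Qed.

Lemma cylinder_cons i s a :
  cylinder (i :: s) a = [set x | x i = a i] `&` cylinder s a.
Proof.
apply/seteqP; split => x /= => [H|[H1 H2] j].
  by split => [|j js]; apply: H; rewrite inE ?eqxx// js orbT.
by rewrite inE => /orP[/eqP ->//|]; exact: H2.
Qed.

Lemma measurable_cylinder s a : measurable (cylinder s a).
Proof.
elim: s => [|i s IH]; first by rewrite cylinder_nil.
by rewrite cylinder_cons; apply: measurableI => //; exact: measurable_coord_eq.
Qed.

Lemma measurable_merge (J : pred I) :
  measurable_fun setT (fun p : bits I * bits I => merge J p.1 p.2).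
Proof.
apply: measurable_bitsP => // i; rewrite /merge; case: (J i).
  by apply: (measurableT_comp (@measurable_coord i)); exact: measurable_fst.
by apply: (measurableT_comp (@measurable_coord i)); exact: measurable_snd.
Qed.

Lemma mergeE J x y : agree_on J (merge J y x) y.
Proof. by move=> i Ji; rewrite /merge Ji. Qed.

Lemma mergeEC J x y : agree_on (predC J) (merge J y x) x.
Proof. by move=> i /= /negbTE Ji; rewrite /merge Ji. Qed.

Lemma depends_onS Y (J K : pred I) (f : bits I -> Y) :
  {subset J <= K} -> depends_on J f -> depends_on K f.
Proof. by move=> JK df x y xy; apply: df => i Ji; exact/xy/JK. Qed.

Lemma depends_on_cylinder (J : pred I) s a :
  {subset s <= J} -> depends_on J (cylinder s a).
Proof.
move=> sJ x y xy; apply/propext; split=> H i /[dup] si /H <-.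
  by apply/esym/xy/sJ.
exact/xy/sJ.
Qed.

Lemma eq_cylinder s t a : s =i t -> cylinder s a = cylinder t a.
Proof. by move=> st; apply/seteqP; split => x H i is_; apply: H; rewrite ?st// -st. Qed.

Lemma cylinderI s t a b x : cylinder s a x -> cylinder t b x ->
  cylinder s a `&` cylinder t b = cylinder (undup (s ++ t)) x.
Proof.
move=> sx tx; apply/seteqP; split => y /= => [[sy ty] i|H].
  by rewrite mem_undup mem_cat => /orP[is_|it]; [rewrite sy// sx|rewrite ty// tx].
split=> i ii; first by rewrite -sx// H// mem_undup mem_cat ii.
by rewrite -tx// H// mem_undup mem_cat ii orbT.
Qed.

(** Two cylinders with a common point x intersect in a cylinder around x, so cylinders and the empty
    set form a generating pi-system. *)
Lemma bits_measure_unique (R : realType)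
    (m1 m2 : {measure set (bits I) -> \bar R}) : (m1 setT < +oo)%E ->
  (forall s a, uniq s -> m1 (cylinder s a) = m2 (cylinder s a)) ->
  forall A, measurable A -> m1 A = m2 A.
Proof.
move=> m1oo m12.
pose G : set (set (bits I)) :=
  [set C | C = set0 \/ exists s a, uniq s /\ C = cylinder s a].
have GT : G setT by right; exists [::], point; rewrite cylinder_nil.
apply: (measure_unique G (fun=> setT)) => //.
- apply/seteqP; split.
    apply: smallest_sub; first exact: smallest_sigma_algebra.
    move=> _ [i [b ->]]; apply: sub_sigma_algebra; right.
    exists [:: i], (fun=> b); split => //.
    by rewrite cylinder_cons cylinder_nil setIT.
  apply: smallest_sub; first exact: (@sigma_algebra_measurable _ (bits I)).
  move=> _ [->|[s [a [_ ->]]]]; first exact: measurable0.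
  exact: measurable_cylinder.
- move=> X Y [->|[s [a [us ->]]]]; first by rewrite set0I; left.
  move=> [->|[t [b [ut ->]]]]; first by rewrite setI0; left.
  have [[x [sx tx]]|nx] := pselect (exists x, cylinder s a x /\ cylinder t b x).
    right; exists (undup (s ++ t)), x; split; first exact: undup_uniq.
    exact: cylinderI.
  left; apply/seteqP; split => // x [sx tx]; apply: nx; exists x; split => //.
- by rewrite bigcup_const//; exists 0.
- move=> _ [->|[s [a [us ->]]]]; first by rewrite !measure0.
  exact: m12.
Qed.

End bits_measurability.

(** * Independence in product measures, by merging independent points *)

Section product_measures.
Context (R : realType) (I : countType).
Implicit Types (mu nu : I -> probability bool R).
Local Notation PM := infinite_product.

Definition wt mu i b : R := fine (mu i [set b]).

Lemma wt_ge0 mu i b : 0 <= wt mu i b.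
Proof. by rewrite fine_ge0. Qed.

Lemma wtD mu i : wt mu i false + wt mu i true = 1.
Proof.
have -> : wt mu i true = 1 - wt mu i false.
  rewrite /wt (_ : [set true] = ~` [set false]).
    by rewrite probability_setC// fineB ?fin_num_measure.
  by apply/seteqP; split => -[] //= /(_ erefl).
by rewrite addrC subrK.
Qed.

Lemma cylinderE mu s a : uniq s ->
  PM mu (cylinder s a) = (\prod_(i <- s) wt mu i (a i))%:E.
Proof. exact: infinite_productP. Qed.

Lemma product_measure_eq mu nu A :
  (forall i b, wt mu i b = wt nu i b) -> measurable A -> PM mu A = PM nu A.
Proof.
move=> munu; apply: bits_measure_unique.
  by rewrite (le_lt_trans (probability_le1 _ _))// ltry.
move=> s a us; rewrite [LHS]cylinderE// [RHS]cylinderE//; congr EFin.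
by apply: eq_bigr => i _; exact: munu.
Qed.

(** Both sides agree on cylinders, which split into the coordinates in J and the others.
    Independence and conditioning are read off this identity through Fubini. *)
Lemma product_merge mu nu (J : pred I) A : measurable A ->
  (PM mu \x PM nu)%E [set p | A (merge J p.1 p.2)] =
  PM (fun i => if J i then mu i else nu i) A.
Proof.
move=> mA.
pose f := mfun_Sub (mem_set (@measurable_merge I J)).
pose Q : probability _ _ := distribution
  ((PM mu \x PM nu)%E : probability (bits I * bits I)%type R) f.
change (Q A = PM (fun i => if J i then mu i else nu i) A).
apply: bits_measure_unique mA; first by rewrite [X in (X < _)%E]probability_setT ltry.
move=> s a us.
transitivity ((PM mu \x PM nu)%E
    (cylinder [seq i <- s | J i] a `*` cylinder [seq i <- s | ~~ J i] a)).
  change ((PM mu \x PM nu)%E [set p | cylinder s a (merge J p.1 p.2)] =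
    (PM mu \x PM nu)%E
    (cylinder [seq i <- s | J i] a `*` cylinder [seq i <- s | ~~ J i] a)).
  congr ((_ \x _)%E _); apply/seteqP; split => -[y x] /=.
    move=> H; split=> i; rewrite mem_filter => /andP[Ji is_];
    by have := H i is_; rewrite /merge/= ?Ji// (negbTE Ji).
  move=> [/= H1 H2] i is_; rewrite /merge/=.
  have [Ji|/negbTE Ji] := boolP (J i); first by apply: H1; rewrite mem_filter Ji.
  by apply: H2; rewrite mem_filter/= Ji.
rewrite [LHS]product_measure1E; [|exact: measurable_cylinder|exact: measurable_cylinder].
rewrite [RHS]cylinderE//.
apply: (etrans (congr2 mule (cylinderE mu a (filter_uniq _ us))
                            (cylinderE nu a (filter_uniq _ us)))).
rewrite -EFinM; congr EFin; rewrite [RHS](bigID J)/= !big_filter; congr *%R; apply: eq_bigr => i Ji.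
  by rewrite /wt Ji.
by rewrite /wt (negbTE Ji).
Qed.

Lemma product_merge_self mu (J : pred I) A : measurable A ->
  (PM mu \x PM mu)%E [set p | A (merge J p.1 p.2)] = PM mu A.
Proof.
move=> mA; rewrite product_merge//; apply: product_measure_eq => // i b.
by rewrite /wt; case: ifP.
Qed.

(** Replacing the coordinates outside J by an independent sample of nu does not change membership in
    A, and the law of the result is that of nu. *)
Lemma product_local mu nu (J : pred I) A : measurable A -> depends_on J A ->
  (forall i b, J i -> wt mu i b = wt nu i b) -> PM mu A = PM nu A.
Proof.
move=> mA dA munu.
transitivity ((PM mu \x PM nu)%E [set p | A (merge J p.1 p.2)]).
  rewrite (_ : [set _ | _] = A `*` setT).
    rewrite [RHS]product_measure1E//.
    by rewrite [X in (_ * X)%E](probability_setT (PM nu)) mule1.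
  apply/seteqP; split => -[y x] /=; first by rewrite (dA _ _ (@mergeE _ J x y)).
  by rewrite (dA _ _ (@mergeE _ J x y)) => -[].
rewrite product_merge//; apply: product_measure_eq => // i b.
by rewrite {1}/wt; case: ifPn => [Ji|_ //]; exact: munu.
Qed.

(** Seen through [merge], the intersection is the rectangle with sides A and B. *)
Lemma product_indep mu (J : pred I) A B : measurable A -> measurable B ->
  depends_on J A -> depends_on (predC J) B ->
  PM mu (A `&` B) = (PM mu A * PM mu B)%E.
Proof.
move=> mA mB dA dB; rewrite -(product_merge_self _ J); last exact: measurableI.
rewrite (_ : [set _ | _] = A `*` B); first by rewrite [LHS]product_measure1E.
by apply/seteqP; split => -[y x] /=;
  rewrite /= (dA _ _ (@mergeE _ J x y)) (dB _ _ (@mergeEC _ J x y)).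
Qed.

End product_measures.

(** * Bounded space-time harmonic functions of a multiplicative random walk *)

Section harmonic_functions.
Context (R : realType).
Implicit Types (F G : R -> R) (e eta : R).

(** The inequalities that hold when F is the first and G the second primitive, from 0, of a function
    with values in [0, 1]. *)
Definition cesaro_pair F G :=
  [/\ forall y, 0 < y -> 0 <= F y <= y, forall y, 0 < y -> 0 <= G y <= y ^+ 2,
      forall y z, 0 < y -> y <= z -> 0 <= F z - F y <= z - y &
      forall y z, 0 < y -> y <= z ->
        (z - y) * F y <= G z - G y <= (z - y) * F z].

Definition mean2 G y : R := G y / y ^+ 2.

(** The derivative of [mean2 G] with respect to log y when F = G'. *)
Definition mean2_deriv F G y : R := F y / y - 2 * mean2 G y.

(** A first-order expansion of [mean2 G] under multiplication of y by 1 + e: after rescaling by y, D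
    (1 + e)^2 = e (f - 2 g) + t - e^2 g with f and g in [0, 1] and a remainder t in [0, e^2]. *)
Lemma mean2_deriv_bounds F G y e : cesaro_pair F G -> 0 < y -> 0 < e <= 1 ->
  let D := mean2 G ((1 + e) * y) - mean2 G y in
  [/\ `|mean2_deriv F G y| * e <= 4 * `|D| + e ^+ 2,
      `|mean2_deriv F G ((1 + e) * y) - mean2_deriv F G y| <= 7 * e &
      `|D| <= `|mean2_deriv F G y| * e + e ^+ 2].
Proof.
move=> [F0 G0 dF dG] y0 /andP[e0 e1] D.
pose f := F y / y; pose g := G y / y ^+ 2.
pose t := (G ((1 + e) * y) - G y - e * y * F y) / y ^+ 2.
pose h := (F ((1 + e) * y) - F y) / y.
have yn0 : y != 0 by rewrite gt_eqF.
have e1n0 : 1 + e != 0 by rewrite gt_eqF// addr_gt0.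
have yle : y <= (1 + e) * y by nra.
have f01 : 0 <= f <= 1.
  have /andP[? ?] := F0 y y0.
  by rewrite /f divr_ge0 ?(ltW y0)//= ler_pdivrMr// mul1r.
have g01 : 0 <= g <= 1.
  have /andP[? ?] := G0 y y0.
  by rewrite /g divr_ge0 ?exprn_ge0 ?(ltW y0)//= ler_pdivrMr ?exprn_gt0// mul1r.
have h0e : 0 <= h <= e.
  have /andP[H1 H2] := dF y _ y0 yle.
  rewrite /h divr_ge0 ?(ltW y0)//= ler_pdivrMr//.
  by rewrite (le_trans H2)//; nra.
have t0e : 0 <= t <= e ^+ 2.
  have /andP[H1 H2] := dG y _ y0 yle.
  have /andP[H3 H4] := dF y _ y0 yle.
  have ye : (1 + e) * y - y = e * y by ring.
  rewrite ye in H1 H2 H4.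
  rewrite /t divr_ge0 ?exprn_ge0 ?(ltW y0)//=; last by rewrite subr_ge0.
  rewrite ler_pdivrMr ?exprn_gt0// lerBlDr (le_trans H2)//.
  rewrite (_ : F ((1 + e) * y) = F y + (F ((1 + e) * y) - F y)); last by ring.
  have : 0 <= e * y by apply: mulr_ge0; rewrite ltW.
  nra.
have FE : F ((1 + e) * y) / ((1 + e) * y) = (f + h) / (1 + e).
  by rewrite /f /h; field; rewrite ?yn0 ?e1n0.
have GE : mean2 G ((1 + e) * y) = (g + e * f + t) / (1 + e) ^+ 2.
  by rewrite /mean2 /g /f /t; field; rewrite ?yn0 ?e1n0.
have DE : D * (1 + e) ^+ 2 = e * (f - 2 * g) + t - e ^+ 2 * g.
  by rewrite /D GE /mean2 -/g; field; rewrite ?e1n0.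
have we : mean2_deriv F G y = f - 2 * g by [].
have key : `|f - 2 * g| * e <= 4 * `|D| + e ^+ 2.
  rewrite -[X in _ * X](gtr0_norm e0) -normrM.
  rewrite (_ : (f - 2 * g) * e = D * (1 + e) ^+ 2 + (e ^+ 2 * g - t)); last first.
    by rewrite DE; ring.
  apply: le_trans (ler_normD _ _) _; apply: lerD.
    rewrite normrM mulrC ler_wpM2r// ger0_norm ?sqr_ge0//.
    by nra.
  by rewrite ler_norml; case/andP: g01 => *; case/andP: t0e => *; apply/andP; nra.
have H0 : `|D| <= `|f - 2 * g| * e + e ^+ 2.
  have : `|D| <= `|D * (1 + e) ^+ 2|.
    rewrite normrM ler_peMr// ger0_norm ?sqr_ge0//.
    nra.
  move=> /le_trans; apply; rewrite DE -addrA (le_trans (ler_normD _ _))//.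
  rewrite normrM (gtr0_norm e0) mulrC lerD2l ler_norml.
  by case/andP: g01 => *; case/andP: t0e => *; apply/andP; nra.
split; [by rewrite we| |by rewrite we].
have BE : (f + h) / (1 + e) - f = (h - e * f) / (1 + e) by field; rewrite ?e1n0.
have H1 : `|(f + h) / (1 + e) - f| <= e.
  rewrite BE normrM [X in _ * X]gtr0_norm ?invr_gt0 ?addr_gt0//.
  rewrite ler_pdivrMr ?addr_gt0// ler_norml.
  by case/andP: f01 => *; case/andP: h0e => *; apply/andP; nra.
have H2 : `|D| <= 3 * e.
  apply: (le_trans H0).
  have : `|f - 2 * g| <= 2.
    by rewrite ler_norml; case/andP: f01 => *; case/andP: g01 => *; apply/andP; lra.
  by move=> /(ler_wpM2r (ltW e0)); nra.
rewrite /mean2_deriv FE -/g -/f.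
rewrite (_ : _ - _ = ((f + h) / (1 + e) - f) + - (2 * D)); last first.
  by rewrite /D; ring.
rewrite (le_trans (ler_normD _ _))// normrN normrM (@ger0_norm _ 2)//.
lra.
Qed.

(** A convex function of x. Its dead zone absorbs the error of order e made when the derivative W is
    replaced by a difference quotient of U across a jump of size e. *)
Definition excess eta (x : R) : R := Num.max (`|x| - eta) 0.

Lemma excess_ge0 eta x : 0 <= excess eta x.
Proof. by rewrite /excess le_max lexx orbT. Qed.

(** The square of a nonnegative convex function is convex. It serves as Jensen's inequality for one
    step of the walk. *)
Lemma excess_convex eta p q x y : 0 <= p -> 0 <= q -> p + q = 1 ->
  excess eta (p * x + q * y) ^+ 2 <=
  p * excess eta x ^+ 2 + q * excess eta y ^+ 2.
Proof.
move=> p0 q0 pq.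
have X0 := excess_ge0 eta x; have Y0 := excess_ge0 eta y.
have : excess eta (p * x + q * y) <= p * excess eta x + q * excess eta y.
  rewrite {1}/excess ge_max addr_ge0 ?mulr_ge0// andbT.
  have : `|x| - eta <= excess eta x by rewrite /excess le_max lexx.
  have : `|y| - eta <= excess eta y by rewrite /excess le_max lexx.
  have := ler_normD (p * x) (q * y); rewrite !normrM (ger0_norm p0) (ger0_norm q0).
  nra.
have := excess_ge0 eta (p * x + q * y).
set A := excess eta x in X0 *; set B := excess eta y in Y0 *; set C := excess _ _.
move=> C0 CAB.
apply: (@le_trans _ _ ((p * A + q * B) ^+ 2)).
  by rewrite ler_sqr ?nnegrE// (le_trans C0).
have -> : q = 1 - p by lra.
rewrite -subr_ge0.
have -> : p * A ^+ 2 + (1 - p) * B ^+ 2 - (p * A + (1 - p) * B) ^+ 2 =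
  p * (1 - p) * (A - B) ^+ 2 by ring.
by rewrite mulr_ge0 ?sqr_ge0// mulr_ge0//; lra.
Qed.

(* The sequences stand for a random walk on the multiplicative group of positive
   numbers whose n-th step is [a n false] with probability [p n] and [a n true]
   with probability [1 - p n], and [F n, G n] for space-time harmonic functions. *)
Variables (p : nat -> R) (a : nat -> bool -> R) (e : nat -> R) (F G : nat -> R -> R).
Hypothesis p01 : forall n, 0 <= p n <= 1.
Hypothesis a_gt0 : forall n b, 0 < a n b.
Hypothesis e_ge0 : forall n, 0 <= e n.
Hypothesis aE : forall n, a n false = (1 + e n) * a n true \/
                          a n true = (1 + e n) * a n false.
Hypothesis FG : forall n, cesaro_pair (F n) (G n).
Hypothesis F_harmonic : forall n v, 0 < v -> F n v =
  p n * (F n.+1 (a n false * v) / a n false) +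
  (1 - p n) * (F n.+1 (a n true * v) / a n true).
Hypothesis G_harmonic : forall n v, 0 < v -> G n v =
  p n * (G n.+1 (a n false * v) / a n false ^+ 2) +
  (1 - p n) * (G n.+1 (a n true * v) / a n true ^+ 2).

Let U n v := mean2 (G n) v.
Let W n v := mean2_deriv (F n) (G n) v.

(** Division by v^2 cancels the factors a^2 of [G_harmonic], so U is a martingale along the walk; it
    takes values in [0, 1]. *)
Lemma mean2_harmonic n v : 0 < v ->
  U n v = p n * U n.+1 (a n false * v) + (1 - p n) * U n.+1 (a n true * v).
Proof.
move=> v0; rewrite /U /mean2 G_harmonic//; field.
by rewrite !gt_eqF.
Qed.

Lemma mean_harmonic n v : 0 < v -> F n v / v =
  p n * (F n.+1 (a n false * v) / (a n false * v)) +
  (1 - p n) * (F n.+1 (a n true * v) / (a n true * v)).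
Proof. by move=> v0; rewrite F_harmonic//; field; rewrite !gt_eqF. Qed.

Lemma mean2_deriv_harmonic n v : 0 < v ->
  W n v = p n * W n.+1 (a n false * v) + (1 - p n) * W n.+1 (a n true * v).
Proof.
move=> v0; rewrite /W /mean2_deriv mean_harmonic//.
by have := mean2_harmonic n v0; rewrite /U => ->; ring.
Qed.

(** Large jumps are discarded, as the expansion says nothing about them; 8 is the constant of the
    error term and 16 the square of the constant 4 in [gap_step]. *)
Let gap eta n := if e n <= eta / 8 then p n * (1 - p n) * e n ^+ 2 / 16 else 0.

Lemma mean2_01 n v : 0 < v -> 0 <= U n v <= 1.
Proof.
move=> v0; have [_ /(_ v v0) /andP[G0 G1] _ _] := FG n.
by rewrite /U /mean2 divr_ge0 ?exprn_ge0 ?(ltW v0)//= ler_pdivrMr ?exprn_gt0// mul1r.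
Qed.

(* At a step with a small jump e, the increment of the bounded martingale U is
   at least of order e times the derivative W. *)
Lemma gap_step eta n v : 0 < v -> 0 < eta <= 1 ->
  gap eta n * excess eta (W n v) ^+ 2 <=
  p n * (1 - p n) * (U n.+1 (a n false * v) - U n.+1 (a n true * v)) ^+ 2.
Proof.
move=> v0 /andP[eta0 eta1]; have /andP[p0 p1] := p01 n.
have pq0 : 0 <= p n * (1 - p n) by rewrite mulr_ge0// subr_ge0.
rewrite /gap; case: ifPn => [en|_]; last by rewrite mul0r mulr_ge0 ?sqr_ge0.
set D := U _ _ - U _ _.
have := e_ge0 n; rewrite le_eqVlt => /predU1P[<-|e0].
  by rewrite expr0n/= mulr0 !mul0r mulr_ge0 ?sqr_ge0.
have e01 : 0 < e n <= 1 by rewrite e0/=; lra.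
(* One e^2 comes from the expansion, and seven from the variation of W between the two possible
   positions, of which W n v is the average. *)
have key : `|W n v| * e n <= 4 * `|D| + 8 * e n ^+ 2.
  rewrite mean2_deriv_harmonic//.
  have av b : 0 < a n b * v by rewrite mulr_gt0.
  case: (aE n) => aa.
    have [] := mean2_deriv_bounds (FG n.+1) (av true) e01.
    rewrite mulrA -aa -/(U _ _) -/(U _ _) -/(W _ _) -/(W _ _) -/D.
    set w1 := W _ (a n false * v); set w2 := W _ _ => H1 H2 _.
    have : `|p n * w1 + (1 - p n) * w2| <= `|w2| + 7 * e n.
      rewrite (_ : _ + _ = w2 + p n * (w1 - w2)); last by ring.
      rewrite (le_trans (ler_normD _ _))// lerD2l normrM (ger0_norm p0).
      by rewrite (le_trans _ H2)// ler_piMl.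
    by move=> /(ler_wpM2r (ltW e0)); nra.
  have [] := mean2_deriv_bounds (FG n.+1) (av false) e01.
  rewrite mulrA -aa -/(U _ _) -/(U _ _) -/(W _ _) -/(W _ _) (distrC (U _ _)) -/D.
  set w1 := W _ (a n true * v); set w2 := W _ _ => H1 H2 _.
  have : `|p n * w2 + (1 - p n) * w1| <= `|w2| + 7 * e n.
    rewrite (_ : _ + _ = w2 + (1 - p n) * (w1 - w2)); last by ring.
    rewrite (le_trans (ler_normD _ _))// lerD2l normrM (@ger0_norm _ (1 - p n)); last lra.
    rewrite (le_trans _ H2)// ler_piMl//; lra.
  by move=> /(ler_wpM2r (ltW e0)); nra.
have ex : excess eta (W n v) * e n <= 4 * `|D|.
  rewrite /excess maxEle; case: ifP => _; last by nra.
  by rewrite mul0r mulr_ge0.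
have : (excess eta (W n v) * e n) ^+ 2 <= (4 * `|D|) ^+ 2.
  by rewrite ler_sqr// nnegrE mulr_ge0 ?excess_ge0// ltW.
rewrite !exprMn real_normK ?num_real// => H.
rewrite (_ : _ / 16 * _ = p n * (1 - p n) *
  (excess eta (W n v) ^+ 2 * e n ^+ 2 / 16)); last by field.
by apply: ler_wpM2l => //; rewrite ler_pdivrMr//; nra.
Qed.

(** Bounded total variance of a bounded martingale: one step lowers the mean of 1 - U^2 by p (1 - p)
    (U0 - U1)^2, which [gap_step] bounds from below. As W is a martingale too, Jensen's inequality
    lets the excess at the start stand for the excess at all later times. *)
Lemma gap_sum eta k n v : 0 < v -> 0 < eta <= 1 ->
  (\sum_(j < k) gap eta (n + j)) * excess eta (W n v) ^+ 2 <= 1 - U n v ^+ 2.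
Proof.
move=> v0 eta01; elim: k n v v0 => [|k IH] n v v0.
  rewrite big_ord0 mul0r subr_ge0; have /andP[u0 u1] := mean2_01 n v0.
  by rewrite exprn_ile1.
have /andP[p0 p1] := p01 n.
have q0 : 0 <= 1 - p n by lra.
rewrite big_ord_recl addn0 mulrDl.
under eq_bigr do rewrite /= -addSnnS.
set S := \sum_(j < k) _.
have S0 : 0 <= S.
  apply: sumr_ge0 => j _; rewrite /gap; case: ifP => // _.
  have /andP[? ?] := p01 (n.+1 + j).
  by rewrite divr_ge0// !mulr_ge0 ?sqr_ge0// subr_ge0.
have av b : 0 < a n b * v by rewrite mulr_gt0.
have H0 := IH n.+1 _ (av false); have H1 := IH n.+1 _ (av true).
rewrite -/S in H0 H1.
have Hs := gap_step n v0 eta01.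
have pq1 : p n + (1 - p n) = 1 by ring.
have Hc := excess_convex eta (W n.+1 (a n false * v)) (W n.+1 (a n true * v)) p0 q0 pq1.
rewrite -mean2_deriv_harmonic// in Hc.
have := ler_wpM2l S0 Hc.
rewrite (mean2_harmonic n v0); move: H0 H1 Hs.
move: (excess _ _ ^+ 2) (excess _ _ ^+ 2) (excess _ _ ^+ 2) => x0 x1 x2.
set u0 := U _ _; set u1 := U _ _ => H0 H1 Hs H2.
have := ler_wpM2l p0 H0; have := ler_wpM2l q0 H1.
lra.
Qed.

Hypothesis diverge : forall eta n M, 0 < eta -> exists k,
  M <= \sum_(j < k) (if e (n + j) <= eta then p (n + j) * (1 - p (n + j)) * e (n + j) ^+ 2 else 0).

Lemma mean2_deriv0 n v : 0 < v -> W n v = 0.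
Proof.
move=> v0; apply/eqP/negPn/negP => Wn0.
(* This level leaves a positive excess; divergence then makes the sum of the gaps times the squared
   excess at least 32 / 16 = 2, against the bound 1 of [gap_sum]. *)
pose eta := Num.min 1 (`|W n v| / 2).
have W0 : 0 < `|W n v| by rewrite normr_gt0.
have eta01 : 0 < eta <= 1.
  by rewrite /eta lt_min ltr01 divr_gt0//= ge_min lexx.
have ex : 0 < excess eta (W n v).
  rewrite /excess lt_max; apply/orP; left; rewrite subr_gt0.
  rewrite (@le_lt_trans _ _ (`|W n v| / 2))//; last by lra.
  by rewrite /eta ge_min lexx orbT.
have eta8 : 0 < eta / 8 by case/andP: eta01 => *; rewrite divr_gt0.
have [k Hk] := diverge n (32 / excess eta (W n v) ^+ 2) eta8.
have := gap_sum k n v0 eta01.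
rewrite (_ : \sum_(j < k) gap eta (n + j) = (\sum_(j < k) (if e (n + j) <= eta / 8 then p (n + j) * (1 - p (n + j)) * e (n + j) ^+ 2 else 0)) / 16); last first.
  rewrite mulr_suml; apply: eq_bigr => j _; rewrite /gap.
  by case: ifP => //; rewrite mul0r.
rewrite leNgt => /negP; apply.
apply: (@lt_le_trans _ _ 2).
  by have := sqr_ge0 (U n v); lra.
rewrite ler_pdivrMr ?exprn_gt0// in Hk.
lra.
Qed.

(** As W vanishes, U changes by at most e^2 when its argument is multiplied by 1 + e. Cutting [v, z]
    into N equal pieces leaves a total change of order 1 / N. *)
Lemma mean2_cst n v z : 0 < v -> v <= z -> U n z = U n v.
Proof.
move=> v0 vz; apply/eqP; rewrite -subr_eq0 -normr_eq0; apply/negPn/negP => d0.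
set d := `|_| in d0; have {}d0 : 0 < d by rewrite lt_neqAle eq_sym d0 normr_ge0.
have zv : 0 <= z - v by rewrite subr_ge0.
have step N : (0 < N)%N -> (z - v) / v <= N%:R -> forall j,
    `|U n (v + j%:R * ((z - v) / N%:R)) - U n v| <= j%:R * ((z - v) / N%:R / v) ^+ 2.
  move=> N0 vN; set t := (z - v) / N%:R.
  have NR : 0 < N%:R :> R by rewrite ltr0n.
  have t0 : 0 <= t by rewrite divr_ge0// ltW.
  have tv : t <= v by rewrite ler_pdivrMr// mulrC -ler_pdivrMr.
  elim=> [|j IH]; first by rewrite !mul0r addr0 subrr normr0.
  have vj : v <= v + j%:R * t by rewrite lerDl mulr_ge0.
  set y := v + j%:R * t in IH vj.
  have y0 : 0 < y by apply: lt_le_trans vj.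
  have -> : v + j.+1%:R * t = (1 + t / y) * y.
    by rewrite /y -natr1; field; rewrite gt_eqF.
  rewrite -natr1 [leRHS]mulrDl mul1r.
  have : `|U n ((1 + t / y) * y) - U n y| <= (t / v) ^+ 2.
    move: t0; rewrite le_eqVlt => /predU1P[<-|t0].
      by rewrite !mul0r addr0 mul1r subrr normr0 expr0n.
    have ty : 0 < t / y <= 1.
      by rewrite divr_gt0//= ler_pdivrMr// mul1r (le_trans tv).
    have [_ _] := mean2_deriv_bounds (FG n) y0 ty.
    rewrite -/(W n y) mean2_deriv0// normr0 mul0r add0r -/(U _ _) -/(U _ _).
    move=> /le_trans; apply; rewrite ler_sqr ?nnegrE ?divr_ge0 ?(ltW t0) ?(ltW y0) ?(ltW v0)//.
    by rewrite ler_pM2l// lef_pV2.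
  move=> H; rewrite [leRHS]addrC (le_trans _ (lerD H IH))//.
  by rewrite (le_trans _ (ler_normD _ _))// (_ : _ - _ + (_ - _) = U n ((1 + t / y) * y) - U n v)//; ring.
(* The first summand keeps each relative step at most 1, the second makes the total error smaller
   than d. *)
pose M := (z - v) / v + ((z - v) / v) ^+ 2 / d + 1.
have zv0 : 0 <= (z - v) / v by rewrite divr_ge0// ltW.
have zvd : 0 <= ((z - v) / v) ^+ 2 / d by rewrite divr_ge0 ?sqr_ge0// ltW.
have M0 : 0 < M by rewrite /M; lra.
pose N := (Num.truncn M).+1.
have MN : M < N%:R by have := truncnS_gt M.
have NR : 0 < N%:R :> R by rewrite ltr0n.
have := step N isT _ N; rewrite (_ : v + N%:R * ((z - v) / N%:R) = z); last first.
  by field; rewrite gt_eqF.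
rewrite -/d => /(_ _)/wrap[]; first by rewrite (le_trans _ (ltW MN))// /M; lra.
rewrite leNgt => /negP; apply.
rewrite (_ : _ * _ ^+ 2 = ((z - v) / v) ^+ 2 / N%:R); last first.
  by field; rewrite !gt_eqF.
rewrite ltr_pdivrMr// -ltr_pdivrMl// [ltLHS]mulrC (le_lt_trans _ MN)// /M; lra.
Qed.

(** W = 0 says F n v / v = 2 U n v; U is constant in v, and then constant in n by harmonicity. *)
Lemma F_linear : exists c, forall n v, 0 < v -> F n v = c * v.
Proof.
have U1 n v : 0 < v -> U n v = U n 1.
  by move=> v0; have [v1|/ltW v1] := leP v 1; [rewrite (@mean2_cst n v 1)|rewrite (@mean2_cst n 1 v)].
have Un n : U n 1 = U 0 1.
  elim: n => // n <-.
  by rewrite (@mean2_harmonic n 1)// !mulr1 !(U1 n.+1)//; ring.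
exists (2 * U 0 1) => n v v0.
have /eqP := mean2_deriv0 n v0; rewrite subr_eq0 => /eqP /(congr1 ( *%R^~ v)).
by rewrite divfK ?gt_eqF// -/(U n v) U1// Un.
Qed.

End harmonic_functions.

(** * Primitives: passing from almost everywhere identities to smooth functions *)

Section primitives.
Context (R : realType).
Implicit Types (F : R -> R).
Local Notation leb := (@lebesgue_measure R).

Definition prim F v : R := \int[leb]_(t in `]0, v]) F t.

Definition locally_bounded F := measurable_fun setT F /\
  forall z, exists M, forall t, 0 < t <= z -> 0 <= F t <= M.

Lemma leb_itvoc (x z : R) : x <= z -> leb `]x, z] = (z - x)%:E.
Proof.
rewrite lebesgue_measure_itv/= lte_fin le_eqVlt => /predU1P[->|->].
  by rewrite ltxx subrr.
by rewrite EFinB.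
Qed.

Lemma leb_itvoc_fin (x z : R) : (leb `]x, z] < +oo)%E.
Proof. by rewrite lebesgue_measure_itv/=; case: ifP => _; rewrite ?ltry. Qed.

Lemma locally_bounded_integrable F x z : locally_bounded F -> 0 <= x ->
  leb.-integrable `]x, z] (EFin \o F).
Proof.
move=> [mF bF] x0; apply: measurable_bounded_integrable => //.
- exact: leb_itvoc_fin.
- exact: measurable_funTS.
- have [M HM] := bF z; exists M; split; first exact: num_real.
  move=> y My t /=; rewrite in_itv/= => /andP[xt tz].
  have /HM/andP[F0 FM] : 0 < t <= z by rewrite tz (le_lt_trans x0).
  by rewrite ger0_norm// (le_trans FM)// ltW.
Qed.

Lemma prim_increment F y z m M : locally_bounded F -> 0 <= y -> y <= z ->
  (forall t, y < t <= z -> m <= F t <= M) ->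
  (z - y) * m <= prim F z - prim F y <= (z - y) * M.
Proof.
move=> bF y0; rewrite le_eqVlt => /predU1P[<- _|yz mFM].
  by rewrite !subrr !mul0r lexx.
rewrite /prim Rintegral_itvB//; last 2 first.
- exact: locally_bounded_integrable.
- by rewrite bnd_simp ltW.
have C c : \int[leb]_(t in `]y, z]) (cst c t) = (z - y) * c.
  rewrite Rintegral_cst// mulrC; congr (_ * _).
  exact: (congr1 fine (leb_itvoc (ltW yz))).
have ic c : leb.-integrable `]y, z] (EFin \o cst c).
  apply: measurable_bounded_integrable => //.
    exact: leb_itvoc_fin.
  exists `|c|; split; first exact: num_real.
  by move=> r cr t _ /=; exact: ltW.
apply/andP; split; rewrite -C; apply: le_Rintegral => //.
- exact: locally_bounded_integrable.
- by move=> t /=; rewrite in_itv/= => /mFM/andP[].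
- exact: locally_bounded_integrable.
- by move=> t /=; rewrite in_itv/= => /mFM/andP[].
Qed.

Lemma prim0 F : prim F 0 = 0.
Proof. by rewrite /prim set_itvoc0 Rintegral_set0. Qed.

Lemma prim_neg F v : v <= 0 -> prim F v = 0.
Proof. by move=> v0; rewrite /prim set_itv_ge ?Rintegral_set0// bnd_simp -leNgt. Qed.

Lemma prim_homo F : locally_bounded F -> {homo prim F : x y / x <= y}.
Proof.
move=> bF x y xy; have [y0|y0] := leP y 0.
  by rewrite !prim_neg// (le_trans xy).
have main z : 0 <= z -> z <= y -> prim F z <= prim F y.
  move=> z0 zy; have [M HM] := bF.2 y.
  have : forall t, z < t <= y -> 0 <= F t <= M.
    by move=> t /andP[zt ty]; apply: HM; rewrite ty (le_lt_trans z0).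
  by move=> /(prim_increment bF z0 zy)/andP[]; rewrite mulr0 subr_ge0.
have [x0|x0] := leP x 0; last by apply: main => //; rewrite ltW.
by rewrite prim_neg// -(prim0 F) main// ltW.
Qed.

Lemma prim_locally_bounded F : locally_bounded F -> locally_bounded (prim F).
Proof.
move=> bF; split; first by apply: nondecreasing_measurable => //; exact: prim_homo.
move=> z; exists (prim F z) => t /andP[t0 tz].
by rewrite -{1}(prim0 F) !prim_homo// ltW.
Qed.

Lemma prim_cesaro_pair F : measurable_fun setT F ->
  (forall t, 0 < t -> 0 <= F t <= 1) -> cesaro_pair (prim F) (prim (prim F)).
Proof.
move=> mF F01.
have bF : locally_bounded F.
  by split => // z; exists 1 => t /andP[t0 _]; exact: F01.
have bG := prim_locally_bounded bF.
have dF y z : 0 <= y -> y <= z -> 0 <= prim F z - prim F y <= z - y.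
  move=> y0 yz; have := @prim_increment F y z 0 1 bF y0 yz.
  rewrite mulr0 mulr1; apply=> t /andP[yt _].
  by apply: F01; rewrite (le_lt_trans y0).
have dG y z : 0 <= y -> y <= z ->
    (z - y) * prim F y <= prim (prim F) z - prim (prim F) y <= (z - y) * prim F z.
  move=> y0 yz; apply: prim_increment => // t /andP[yt tz].
  by rewrite !prim_homo// ltW.
split.
- by move=> y y0; have := dF 0 y (lexx _) (ltW y0); rewrite prim0 !subr0.
- move=> y y0; have := dG 0 y (lexx _) (ltW y0).
  rewrite !prim0 !subr0 mulr0 => /andP[-> /le_trans]; apply.
  by have := dF 0 y (lexx _) (ltW y0); rewrite prim0 !subr0 expr2 ler_pM2l// => /andP[].
- by move=> y z y0; apply: dF; rewrite ltW.
- by move=> y z y0; apply: dG; rewrite ltW.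
Qed.

Lemma measurable_scale (a : R) : measurable_fun setT ( *%R a).
Proof. exact: measurable_funM. Qed.

Lemma prim_scale F a v : measurable_fun setT F -> (forall t, 0 < t -> 0 <= F t) ->
  0 < a -> prim (fun t => F (a * t)) v = prim F (a * v) / a.
Proof.
move=> mF F0 a0.
have aV0 : 0 < a^-1 by rewrite invr_gt0.
pose f (u : R) := (u - 0) / a^-1.
have mf : measurable_fun [set: R] f.
  by apply: measurable_funM => //; exact: measurable_funB.
pose D : set R := `]0, a * v]%classic.
have fD : f @^-1` D = `]0, v]%classic.
  apply/seteqP; split => u;
    by rewrite /f /D /= !in_itv/= subr0 invrK (mulrC u) pmulr_rgt0// ler_pM2l.
have F0D x : D x -> 0%R <= F x by rewrite /D /= in_itv/= => /andP[/F0].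
pose k : {nonneg R} := NngNum (ltW aV0).
rewrite [X in _ = fine X / _](_ : _ =
    (a%:E * \int[mscale k leb]_(y in D) (EFin \o F) y)%E); last first.
  rewrite ge0_integral_mscale//.
  - by rewrite muleA -EFinM divff ?gt_eqF// mul1e.
  - exact: measurable_itv.
  - exact/measurable_EFinP/measurable_funTS.
have -> : (\int[mscale k leb]_(y in D) (EFin \o F) y =
    \int[pushforward leb (f : measurableTypeR R -> measurableTypeR R)]_(y in D) (EFin \o F) y)%E.
  apply: (@eq_measure_integral _ _ _ _ (pushforward leb (f : measurableTypeR R -> measurableTypeR R))) => A mA _.
  exact/esym/(lebesgue_affine 0 aV0 mA).
rewrite (@ge0_integral_pushforward _ _ (measurableTypeR R) (measurableTypeR R)); last 3 first.
- exact: measurable_itv.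
- exact/measurable_EFinP/measurable_funTS.
- by move=> x /set_mem/F0D; rewrite lee_fin.
rewrite fD /prim /Rintegral.
rewrite (@eq_integral _ _ _ leb _ (EFin \o F \o f) (fun x => (F (a * x))%:E)); last first.
  by move=> x _; rewrite /f/= subr0 invrK mulrC.
(* Integrability is not assumed: if the integral is infinite, both sides are 0 because [fine] sends
   infinity to 0. *)
case: (\int[_]_(_ in _) _)%E => [r||] /=.
- by rewrite mulrC mulKf ?gt_eqF.
- by rewrite gt0_muley ?lte_fin//= mul0r.
- by rewrite gt0_muleNy ?lte_fin//= mul0r.
Unshelve. all: exact: mf.
Qed.

(** Integration turns an almost everywhere identity into one that holds everywhere; the change of
    variables contributes the factors 1 / a and 1 / b. *)
Lemma prim_mix F1 F2 F p a b v : measurable_fun setT F ->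
  locally_bounded F1 -> locally_bounded F2 -> (forall t, 0 < t -> 0 <= F t) ->
  0 <= p <= 1 -> 0 < a -> 0 < b ->
  (\forall t \ae leb, 0 < t -> F t = p * F1 (a * t) + (1 - p) * F2 (b * t)) ->
  prim F v = p * (prim F1 (a * v) / a) + (1 - p) * (prim F2 (b * v) / b).
Proof.
move=> mF bF1 bF2 F0 /andP[p0 p1] a0 b0 FE.
have nng G : locally_bounded G -> forall t, 0 < t -> 0 <= G t.
  move=> [_ bG] t t0; have [M /(_ t)] := bG t.
  by rewrite t0 lexx => /(_ isT)/andP[].
have bs G c : 0 < c -> locally_bounded G -> locally_bounded (fun t => G (c * t)).
  move=> c0 [mG bG]; split; first by apply: measurableT_comp.
  move=> z; have [M HM] := bG (c * z); exists M => t /andP[t0 tz].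
  by apply: HM; rewrite mulr_gt0// ler_pM2l.
have cs G c : 0 <= c -> locally_bounded G -> locally_bounded (fun t => c * G t).
  move=> c0 [mG bG]; split; first exact: measurable_funM.
  move=> z; have [M HM] := bG z; exists (c * M) => t /HM/andP[G0 GM].
  by rewrite mulr_ge0//= ler_wpM2l.
have q0 : 0 <= 1 - p by rewrite subr_ge0.
rewrite -(prim_scale v bF1.1 (nng _ bF1) a0) -(prim_scale v bF2.1 (nng _ bF2) b0).
have ib G : locally_bounded G -> leb.-integrable `]0, v] (EFin \o G).
  by move=> bG; exact: locally_bounded_integrable.
rewrite /prim -!RintegralZl//; [|exact: ib (bs _ _ b0 bF2)|exact: ib (bs _ _ a0 bF1)].
rewrite -RintegralD//; last 2 first.
- exact: ib (cs _ _ p0 (bs _ _ a0 bF1)).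
- exact: ib (cs _ _ q0 (bs _ _ b0 bF2)).
congr fine; apply: ge0_ae_eq_integral => //.
- exact/measurable_EFinP/measurable_funTS.
- apply/measurable_EFinP/measurable_funTS; apply: measurable_funD;
    apply: measurable_funM => //; [exact: (bs _ _ a0 bF1).1|exact: (bs _ _ b0 bF2).1].
- by move=> t /=; rewrite in_itv/= lee_fin => /andP[/F0].
- move=> t /=; rewrite in_itv/= lee_fin => /andP[t0 _].
  by rewrite addr_ge0// mulr_ge0// nng// mulr_gt0.
- case: FE => N [mN N0 sN]; exists N; split => // t /= Ht; apply: sN => /= H.
  by apply: Ht; rewrite in_itv/= => /andP[/H ->].
Qed.

(* Iterated primitives turn an almost everywhere defined space-time harmonic
   function into a pair of smooth ones. *)
Lemma harmonic_prim_linear (p e : nat -> R) (a : nat -> bool -> R) (F : nat -> R -> R) :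
  (forall n, 0 <= p n <= 1) -> (forall n b, 0 < a n b) -> (forall n, 0 <= e n) ->
  (forall n, a n false = (1 + e n) * a n true \/ a n true = (1 + e n) * a n false) ->
  (forall n, measurable_fun setT (F n)) -> (forall n t, 0 <= F n t <= 1) ->
  (forall n, \forall t \ae leb, 0 < t -> F n t =
    p n * F n.+1 (a n false * t) + (1 - p n) * F n.+1 (a n true * t)) ->
  (forall (eta : R) (n : nat) (M : R), 0 < eta -> exists k : nat, M <= \sum_(j < k)
    (if e (n + j) <= eta then p (n + j) * (1 - p (n + j)) * e (n + j) ^+ 2 else 0)) ->
  exists c, forall n v, 0 < v -> prim (F n) v = c * v.
Proof.
move=> p01 a0 e0 ae mF F01 FE div.
have bF n : locally_bounded (F n).
  by split => // z; exists 1 => t _; exact: F01.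
have F0 n t : 0 <= F n t by case/andP: (F01 n t).
have PE n v : prim (F n) v = p n * (prim (F n.+1) (a n false * v) / a n false) +
    (1 - p n) * (prim (F n.+1) (a n true * v) / a n true).
  exact: prim_mix.
apply: (@F_linear R p a e (fun n => prim (F n)) (fun n => prim (prim (F n)))) => //.
- by move=> n; apply: prim_cesaro_pair.
- move=> n v v0.
  have bP m := prim_locally_bounded (bF m).
  have bPs m b : locally_bounded (fun t => prim (F m) t / a n b).
    split; first by apply: measurable_funM => //; exact: (bP m).1.
    move=> z; have [M HM] := (bP m).2 z; exists (M / a n b) => t /HM/andP[P0 PM].
    by rewrite divr_ge0 ?(ltW (a0 n b))//= ler_pM2r ?invr_gt0.
  rewrite (@prim_mix (fun t => prim (F n.+1) t / a n false)
    (fun t => prim (F n.+1) t / a n true) _ (p n) (a n false) (a n true))//.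
  + have PZ b w : 0 < w -> prim (fun t => prim (F n.+1) t / a n b) w = prim (prim (F n.+1)) w / a n b.
      move=> w0; rewrite /prim -RintegralZr//.
      exact: locally_bounded_integrable (bP n.+1) _.
    by rewrite !PZ ?mulr_gt0//; field; rewrite !gt_eqF.
  + exact: (bP n).1.
  + move=> t t0; have [M /(_ t)] := (bP n).2 t.
    by rewrite t0 lexx => /(_ isT)/andP[].
  + exact: aeW.
Qed.

End primitives.

(** * The positive reals and the measures that scale under multiplication *)

Section positive_reals.
Context (R : realType).
Local Notation leb := (@lebesgue_measure R).

Definition pmul (a t : posreal R) : posreal R := (a%:num * t%:num)%:pos.

Lemma measurable_inv : measurable_fun setT (@GRing.inv R).
Proof.
have -> : @GRing.inv R = fun x => if x == 0 then 0 else x^-1.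
  by apply/funext => x; case: eqP => // ->; rewrite invr0.
apply: measurable_fun_if => //.
- have -> : (fun x : R => x == 0) = (fun x => (x <= 0) && (0 <= x)).
    by apply/funext => x; rewrite eq_le.
  by apply: measurable_and; apply: measurable_fun_ler.
- rewrite setTI; apply: open_continuous_measurable_fun.
    rewrite (_ : _ @^-1` _ = [set x | x != 0]); first exact: open_neq.
    by apply/seteqP; split => x /=; [move=> ->|move/negbTE].
  move=> x /set_mem /= /negbT x0; exact: inv_continuous.
Qed.

Lemma measurable_num : measurable_fun setT (fun t : posreal R => t%:num).
Proof. by move=> _ B mB; rewrite setTI; exists B => //; rewrite setTI. Qed.

Lemma measurable_posreal d (T : measurableType d) (D : set T) (f : T -> posreal R) :
  measurable_fun D (fun x => (f x)%:num) -> measurable_fun D f.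
Proof. by move=> mf mD _ [B mB <-]; rewrite setTI; exact: mf. Qed.

Lemma measurable_num_comp d (T : measurableType d) (D : set T) (f : T -> posreal R) :
  measurable_fun D f -> measurable_fun D (fun x => (f x)%:num).
Proof. exact: measurableT_comp measurable_num. Qed.

Lemma measurable_pmul d (T : measurableType d) (D : set T) (f g : T -> posreal R) :
  measurable_fun D f -> measurable_fun D g ->
  measurable_fun D (fun x => pmul (f x) (g x)).
Proof.
move=> mf mg; apply: measurable_posreal.
by apply: measurable_funM; exact: measurable_num_comp.
Qed.

Lemma measurable_pmull (a : posreal R) : measurable_fun setT (pmul a).
Proof. by apply: measurable_pmul => //; exact: measurable_cst. Qed.

Lemma pmulA : associative pmul.
Proof. by move=> a b c; apply/val_inj; rewrite /= mulrA. Qed.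

Lemma pmulC : commutative pmul.
Proof. by move=> a b; apply/val_inj; rewrite /= mulrC. Qed.

Lemma pmul1 : left_id (1%:pos : posreal R) pmul.
Proof. by move=> a; apply/val_inj; rewrite /= mul1r. Qed.

Definition pinv (a : posreal R) : posreal R := (a%:num^-1)%:pos.

Lemma pmulK a : cancel (pmul a) (pmul (pinv a)).
Proof. by move=> t; apply/val_inj; rewrite /= mulKf. Qed.

Lemma pmulVK a : cancel (pmul (pinv a)) (pmul a).
Proof. by move=> t; apply/val_inj; rewrite /= mulVKf. Qed.

Lemma measurable_pinv d (T : measurableType d) (D : set T) (f : T -> posreal R) :
  measurable_fun D f -> measurable_fun D (fun x => pinv (f x)).
Proof.
move=> mf; apply: measurable_posreal => /=.
by apply: measurableT_comp; [exact: measurable_inv|exact: measurable_num_comp].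
Qed.

Let inv_gt0 (s : R) : 0 < (if 0 < s then s^-1 else 1).
Proof. by case: ifPn => [s0|_]; rewrite ?invr_gt0. Qed.

(** The value 1 at s <= 0 is a dummy. *)
Definition invpos (s : R) : posreal R := PosNum (inv_gt0 s).

Lemma invposE (s : R) : 0 < s -> (invpos s)%:num = s^-1.
Proof. by move=> s0; rewrite /= s0. Qed.

Lemma measurable_invpos : measurable_fun setT (invpos : measurableTypeR R -> posreal R).
Proof.
apply: measurable_posreal => /=; apply: measurable_fun_ifT => //.
  exact: measurable_fun_ltr.
exact: measurable_inv.
Qed.

Let mpos : measurable (`]0, +oo[%classic : set (measurableTypeR R)).
Proof. exact: measurable_itv. Qed.

Let mpre B : measurable B -> measurable (invpos @^-1` B : set (measurableTypeR R)).
Proof. by move=> mB; rewrite -[X in measurable X]setTI; exact: measurable_invpos. Qed.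

(** The measure dt / t^2, built as the image of Lebesgue measure on the positive half-line under s =
    1 / t. *)
Definition kappa0 (B : set (posreal R)) : \bar R :=
  leb ((invpos @^-1` B) `&` `]0, +oo[).

Let kappa0_set0 : kappa0 set0 = 0%E.
Proof. by rewrite /kappa0 preimage_set0 set0I measure0. Qed.

Let kappa0_ge0 B : (0 <= kappa0 B)%E.
Proof. exact: measure_ge0. Qed.

Let kappa0_sigma_additive : semi_sigma_additive kappa0.
Proof.
move=> F mF tF mUF; rewrite /kappa0 preimage_bigcup setI_bigcupl.
apply: measure_semi_sigma_additive.
- by move=> n; apply: measurableI => //; exact: mpre.
- apply: trivIset_setIr; apply/trivIsetP => /= i j _ _ ij.
  rewrite -preimage_setI; move/trivIsetP : tF => /(_ i j I I ij) ->.
  by rewrite preimage_set0.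
- by rewrite -setI_bigcupl -preimage_bigcup; apply: measurableI => //; exact: mpre.
Qed.

HB.instance Definition _ := isMeasure.Build _ _ _ kappa0
  kappa0_set0 kappa0_ge0 kappa0_sigma_additive.

Lemma kappa0E B : kappa0 B = leb ((invpos @^-1` B) `&` `]0, +oo[).
Proof. by []. Qed.

Lemma measurable_ge (c : R) : measurable [set t : posreal R | c <= t%:num].
Proof.
rewrite -[X in measurable X]setTI (_ : [set t | _] = (fun t : posreal R => t%:num) @^-1` `[c, +oo[).
  exact: measurable_num.
by apply/seteqP; split => t /=; rewrite in_itv/= andbT.
Qed.

Lemma kappa0_ge_fin (c : R) : 0 < c -> (kappa0 [set t : posreal R | (c <= t%:num)%R] < +oo)%E.
Proof.
move=> c0; rewrite kappa0E.
apply: (@le_lt_trans _ _ (leb `]0, c^-1])); last first.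
  by rewrite lebesgue_measure_itv/=; case: ifP => // _; rewrite ltry.
apply: le_measure; rewrite ?inE//.
  apply: measurableI => //; rewrite -[X in measurable X]setTI.
  apply: measurable_invpos => //; exact: measurable_ge.
move=> s [/= cs]; rewrite !in_itv/= andbT => s0; rewrite s0/=.
by move: cs; rewrite s0 => cs; rewrite -[leLHS]invrK lef_pV2// posrE invr_gt0.
Qed.

Let kappa0_sigma_finite : sigma_finite setT kappa0.
Proof.
exists (fun n => [set t : posreal R | n.+1%:R^-1 <= t%:num]).
  apply/seteqP; split => // t _; exists (Num.truncn (t%:num^-1)) => //=.
  rewrite -[leRHS]invrK lef_pV2 ?posrE ?invr_gt0//.
  exact/ltW/truncnS_gt.
by move=> n; split; [exact: measurable_ge|exact: kappa0_ge_fin].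
Qed.

HB.instance Definition _ := Measure_isSigmaFinite.Build _ _ _ kappa0 kappa0_sigma_finite.

(** The law kappa(aB) = kappa(B) / a, with the preimage under multiplication by a in place of the
    image under its inverse. *)
Definition scaling_measure (kappa : set (posreal R) -> \bar R) := forall a B,
  measurable B -> kappa (pmul a @^-1` B) = (a%:num%:E * kappa B)%E.

Lemma kappa0_scaling : scaling_measure kappa0.
Proof.
move=> a B mB; rewrite !kappa0E.
have mD : measurable ((invpos @^-1` B) `&` `]0, +oo[ : set (measurableTypeR R)).
  apply: measurableI => //; rewrite -[X in measurable X]setTI.
  exact: measurable_invpos.
rewrite -(lebesgue_affine 0 _ mD)//; congr (leb _).
apply/seteqP; split => s /=; rewrite !in_itv/= !andbT subr0.
  move=> [+ s0]; rewrite divr_gt0// => H; split => //.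
  suff -> : invpos (s / a%:num) = pmul a (invpos s) by [].
  by apply/val_inj; rewrite /= s0 divr_gt0// invf_div mulrC.
rewrite pmulr_lgt0 ?invr_gt0// => -[H s0]; split => //.
suff <- : invpos (s / a%:num) = pmul a (invpos s) by [].
by apply/val_inj; rewrite /= s0 divr_gt0// invf_div mulrC.
Qed.

Lemma kappa0_neq0 : kappa0 setT != 0%E.
Proof.
rewrite kappa0E preimage_setT setTI lebesgue_measure_itv/=.
by rewrite ltry.
Qed.

Lemma kappa0_ge1_gt0 : (0 < kappa0 [set t : posreal R | (1 <= t%:num)%R])%E.
Proof.
rewrite kappa0E; apply: (@lt_le_trans _ _ (leb `]0, 1])).
  by rewrite lebesgue_measure_itv/= lte01 -EFinB lte_fin subr0.
apply: le_measure; rewrite ?inE//.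
  by apply: measurableI => //; apply: mpre; exact: measurable_ge.
move=> s /=; rewrite !in_itv/= andbT => /andP[s0 s1]; split => //.
by rewrite s0 -[leLHS]invr1 lef_pV2// posrE.
Qed.

(* Fubini: the sets a^-1 N have measure 0 for almost every, hence for every a. *)
Lemma scaling_measure_dominates (k k' : {sigma_finite_measure set (posreal R) -> \bar R}) :
  scaling_measure k -> scaling_measure k' -> k setT != 0%E ->
  forall N, measurable N -> k N = 0%E -> k' N = 0%E.
Proof.
move=> sk sk' k0 N mN kN.
pose M := [set p : posreal R * posreal R | N (pmul p.1 p.2)].
have mM : measurable M.
  rewrite -[X in measurable X]setTI.
  by apply: (measurable_pmul measurable_fst measurable_snd).
have M0 : (k' \x k)%E M = 0%E.
  rewrite /product_measure1 integral0_eq// => a _ /=.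
  rewrite (_ : xsection M a = pmul a @^-1` N); last first.
    by apply/seteqP; split => t; rewrite /xsection/= inE.
  by rewrite sk// kN mule0.
have M20 : (k' \x^ k)%E M = 0%E.
  rewrite -M0; apply/esym/product_measure_unique => // A B mA mB.
  exact: product_measure2E.
apply/eqP/negPn/negP => N0.
suff : k setT = 0%E by exact/eqP.
have : (\int[k]_t (k' N * (t%:num)%:E) = 0)%E.
  rewrite -[RHS]M20 /product_measure2; apply: eq_integral => t _ /=.
  rewrite (_ : ysection M t = pmul t @^-1` N); last first.
    by apply/seteqP; split => a; rewrite /ysection/= inE /M/= pmulC.
  by rewrite sk'// muleC.
have mf : measurable_fun setT (fun t : posreal R => (t%:num)%:E).
  by apply/measurable_EFinP; exact: measurable_num.
have f0 (t : posreal R) : (0 <= k' N * (t%:num)%:E)%E.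
  by rewrite mule_ge0// lee_fin.
move=> I0.
have : (\int[k]_t `|k' N * (t%:num)%:E| = 0)%E.
  by rewrite -[RHS]I0; apply: eq_integral => t _; rewrite gee0_abs.
move/ae_eq_integral_abs => /(_ measurableT (measurable_funeM _ mf)) [Z [mZ Z0 sZ]].
apply/eqP; rewrite eq_le measure_ge0 andbT -Z0; apply: le_measure; rewrite ?inE//.
move=> t _; apply: sZ => /= /(_ I) /eqP; rewrite mule_eq0 (negbTE N0)/=.
by rewrite eqe gt_eqF.
Qed.

End positive_reals.

(** * Null sets of products, and invertible maps *)

Section product_null_sets.
Context d1 d2 (T1 : measurableType d1) (T2 : measurableType d2) (R : realType).
Variables (m1 : {measure set T1 -> \bar R}).

Lemma measurable_xsection_neq0 (m2 : {sigma_finite_measure set T2 -> \bar R}) (A : set (T1 * T2)) : measurable A ->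
  measurable [set x | m2 (xsection A x) != 0%E].
Proof.
move=> mA; rewrite -[X in measurable X]setTI.
exact: emeasurable_neq (measurable_fun_xsection m2 mA) _.
Qed.

Lemma product_null (m2 : {sigma_finite_measure set T2 -> \bar R}) (A : set (T1 * T2)) : measurable A ->
  (m1 \x m2)%E A = 0%E <-> m1 [set x | m2 (xsection A x) != 0%E] = 0%E.
Proof.
move=> mA; have mf := measurable_fun_xsection m2 mA.
have -> : (m1 \x m2)%E A = (\int[m1]_x `|m2 (xsection A x)|)%E.
  by apply: eq_integral => x _; rewrite gee0_abs.
rewrite (ae_eq_integral_abs m1 measurableT mf); split.
  move=> [Z [mZ Z0 sZ]]; apply/eqP; rewrite eq_le measure_ge0 andbT -[leRHS]Z0.
  apply: le_measure; rewrite ?inE//; first exact: measurable_xsection_neq0.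
  by move=> x /= /eqP nx; apply: sZ => /= /(_ I).
move=> N0; exists [set x | m2 (xsection A x) != 0%E]; split => //.
  exact: measurable_xsection_neq0.
by move=> x /= Hx; apply/eqP => H; apply: Hx => _.
Qed.

Lemma product_null_eq (m2 m2' : {sigma_finite_measure set T2 -> \bar R}) (A : set (T1 * T2)) : measurable A ->
  (forall B, measurable B -> m2 B = 0%E <-> m2' B = 0%E) ->
  (m1 \x m2)%E A = 0%E <-> (m1 \x m2')%E A = 0%E.
Proof.
move=> mA m22; rewrite !product_null//.
rewrite (_ : [set x | m2 _ != _] = [set x | m2' (xsection A x) != 0%E])//.
apply/seteqP; split => x /= /eqP H; apply/eqP => /m22 H'; apply: H; apply: H';
  exact: measurable_xsection.
Qed.

End product_null_sets.

Section invertible_maps.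
Context d (X : measurableType d).
Implicit Types (S : X -> X) (A : set X).

Lemma measurable_pre d' (Y : measurableType d') (f : X -> Y) B :
  measurable_fun setT f -> measurable B -> measurable (f @^-1` B).
Proof. by move=> mf mB; rewrite -[X in measurable X]setTI; exact: mf. Qed.

Lemma image_can_pre S S' A : cancel S S' -> cancel S' S -> S @` A = S' @^-1` A.
Proof.
move=> SK S'K; apply/seteqP; split => y /=; first by move=> [x Ax <-]; rewrite SK.
by exists (S' y).
Qed.

Lemma invertible_borel_image S A : invertible_borel S -> measurable A ->
  measurable (S @` A).
Proof.
move=> [_ [S' mS' [SK S'K]]] mA; rewrite (image_can_pre _ SK S'K).
exact: measurable_pre.
Qed.

Lemma invertible_borel_inj S : invertible_borel S -> injective S.
Proof. by move=> [_ [S' _ [SK _]]]; exact: can_inj SK. Qed.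

Lemma preimage_image_inv S A : invertible_borel S -> S @^-1` (S @` A) = A.
Proof.
move=> iS; apply/seteqP; split => x /=; last by exists x.
by move=> [y Ay /(invertible_borel_inj iS) <-].
Qed.

Lemma image_preimage_inv S A : invertible_borel S -> S @` (S @^-1` A) = A.
Proof.
move=> [_ [S' mS' [SK S'K]]]; apply/seteqP; split => x /=; first by move=> [y Ay <-].
by move=> Ax; exists (S' x); rewrite /= S'K.
Qed.

Lemma invertible_borel_iter S n : invertible_borel S -> invertible_borel (iter n S).
Proof.
move=> [mS [S' mS' [SK S'K]]].
have mi k (f : X -> X) : measurable_fun setT f -> measurable_fun setT (iter k f).
  by move=> mf; elim: k => [|m IH]; [exact: measurable_id|exact: (measurableT_comp mf IH)].
split; first exact: mi.
exists (iter n S'); first exact: mi.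
by split => x; elim: n => //= m IH; rewrite -iterS iterSr ?SK ?S'K ?IH.
Qed.

End invertible_maps.

Lemma iterS_preimage T (f : T -> T) n (A : set T) :
  iter n.+1 f @^-1` A = iter n f @^-1` (f @^-1` A).
Proof. by []. Qed.

(** * Skew products over a nonsingular map, and the chain rule *)

Section skew_products.
Context d (X : measurableType d) (R : realType).
Implicit Types (S : X -> X) (w : X -> posreal R).

Definition skew S w (p : X * posreal R) : X * posreal R := (S p.1, pmul (w p.1) p.2).

Fixpoint cocycle S w n x : posreal R :=
  if n is m.+1 then pmul (cocycle S w m (S x)) (w x) else 1%:pos.

Lemma iter_skew S w n : iter n (skew S w) = skew (iter n S) (cocycle S w n).
Proof.
apply/funext; elim: n => [|n IH] [x t]; first by rewrite /skew pmul1.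
by rewrite iterSr IH /skew -iterSr/= pmulA.
Qed.

Lemma cocycleD S w m n x :
  cocycle S w (m + n) x = pmul (cocycle S w m (iter n S x)) (cocycle S w n x).
Proof.
elim: n x => [|n IH] x; first by rewrite addn0 /= pmulC pmul1.
by rewrite addnS /= IH -iterSr -pmulA.
Qed.

Lemma measurable_cocycle S w n : measurable_fun setT S -> measurable_fun setT w ->
  measurable_fun setT (cocycle S w n).
Proof.
move=> mS mw; elim: n => [|n IH]; first exact: measurable_cst.
by apply: measurable_pmul => //; exact: measurableT_comp IH mS.
Qed.

Lemma measurable_skew S w : measurable_fun setT S -> measurable_fun setT w ->
  measurable_fun setT (skew S w).
Proof.
move=> mS mw; apply/measurable_fun_pairP; split.
  exact: (measurableT_comp mS measurable_fst).
apply: measurable_pmul; last exact: measurable_snd.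
exact: (measurableT_comp mw measurable_fst).
Qed.

Lemma invertible_skew S w : invertible_borel S -> measurable_fun setT w ->
  invertible_borel (skew S w).
Proof.
move=> [mS [S' mS' [SK S'K]]] mw; split; first exact: measurable_skew.
exists (skew S' (fun x => pinv (w (S' x)))).
  apply: measurable_skew => //; apply: measurable_pinv.
  exact: measurableT_comp mw mS'.
by split=> -[x t]; rewrite /skew/= ?SK ?S'K ?pmulK ?pmulVK.
Qed.

Variables (P : {sigma_finite_measure set X -> \bar R}).

Lemma xsection_skew S w (B : set X) (E : set (posreal R)) x :
  xsection (skew S w @^-1` (B `*` E)) x =
  if S x \in B then pmul (w x) @^-1` E else set0.
Proof.
apply/seteqP; split => t; rewrite /xsection/= inE/=; case: ifPn => //=.
- by move=> _ [].
- by move=> /negP SB [] /mem_set.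
- by move=> /set_mem SB Et.
Qed.

(** The fibre over x contributes k(E / w(x)) = w(x) k(E), and the integral of w over the preimage of
    B is P(B). *)
Lemma skew_preserving S w (k : {sigma_finite_measure set (posreal R) -> \bar R}) :
  invertible_borel S -> is_rn_derivative P S w -> scaling_measure k ->
  measure_preserving (P \x k)%E (skew S w).
Proof.
move=> iS [mw wE] sk A mA; have [mS _] := iS.
have mT := measurable_skew mS mw.
pose m' := pushforward_measure
  ((P \x k)%E : {measure set (X * posreal R) -> \bar R}) mT.
apply/esym/(product_measure_unique (m' := m')) => // B E mB mE.
rewrite /= /pushforward /product_measure1.
transitivity (\int[P]_x (k E * ((w x)%:num%:E * (\1_(S @^-1` B) x)%:E)))%E.
  apply: eq_integral => x _; rewrite /= xsection_skew indicE.
  have -> : (x \in S @^-1` B) = (S x \in B) by apply/idP/idP; rewrite !inE.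
  by case: ifP => _; rewrite ?mule1 ?mule0 ?measure0// sk// muleC.
have mSB := measurable_pre mS mB.
have mwE : measurable_fun setT (fun x => (w x)%:num%:E).
  by apply/measurable_EFinP; exact: measurable_num_comp.
rewrite ge0_integralZl//; last first.
  by apply: emeasurable_funM => //; apply/measurable_EFinP.
rewrite muleC; congr (_ * _)%E.
rewrite -[in RHS](image_preimage_inv B iS) wE// [RHS]integral_mkcond.
apply: eq_integral => x _; rewrite patchE indicE.
by case: ifP => _; rewrite ?mule1 ?mule0.
Qed.

Lemma skew_rn_derivative S w (k : {sigma_finite_measure set (posreal R) -> \bar R}) E :
  invertible_borel S -> measurable_fun setT w -> scaling_measure k ->
  measurable E -> (0 < k E)%E -> (k E < +oo)%E ->
  measure_preserving (P \x k)%E (skew S w) -> is_rn_derivative P S w.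
Proof.
move=> iS mw sk mE k0 koo Sp; have [mS _] := iS; split => // A mA.
have mSA := invertible_borel_image iS mA.
have := Sp (S @` A `*` E) (measurableX mSA mE).
rewrite product_measure1E// {1}/product_measure1.
have mwE : measurable_fun setT (fun x => (w x)%:num%:E).
  by apply/measurable_EFinP; exact: measurable_num_comp.
have -> : (\int[P]_x (k \o xsection (skew S w @^-1` (S @` A `*` E))) x =
    k E * \int[P]_(x in A) (w x)%:num%:E)%E.
  rewrite -ge0_integralZl//; last exact: measurable_funTS.
  rewrite [RHS]integral_mkcond; apply: eq_integral => x _.
  rewrite /= xsection_skew patchE.
  have -> : (S x \in S @` A) = (x \in A).
    apply/idP/idP => /set_mem H; apply/mem_set; last by exists x.
    by rewrite -(preimage_image_inv A iS).
  by case: ifP => _; rewrite ?measure0// sk// muleC.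
move: k0 koo; case: (k E) => // r; rewrite lte_fin => r0 _ H.
have K (x : \bar R) : (r^-1%:E * (r%:E * x) = x)%E.
  by rewrite muleA -EFinM mulVf ?gt_eqF// mul1e.
by rewrite -[LHS]K -[RHS]K; congr (_ * _)%E; rewrite H muleC.
Qed.

(** The chain rule without a change of variables: iterates of the skew product preserve the product
    measure and are skew products by the cocycle, and preservation characterises the derivative. *)
Lemma cocycle_rn_derivative S w n : invertible_borel S ->
  is_rn_derivative P S w -> is_rn_derivative P (iter n S) (cocycle S w n).
Proof.
move=> iS wS; have [mS _] := iS.
apply: (@skew_rn_derivative _ _ (@kappa0 R) [set t : posreal R | 1 <= t%:num]).
- exact: invertible_borel_iter.
- by apply: measurable_cocycle => //; case: wS.
- exact: kappa0_scaling.
- exact: measurable_ge.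
- exact: kappa0_ge1_gt0.
- exact: kappa0_ge_fin.
- move=> A mA; rewrite -iter_skew.
  have Sp := skew_preserving iS wS (@kappa0_scaling R).
  have msk : measurable_fun setT (skew S w) by apply: measurable_skew => //; case: wS.
  elim: n A mA => // n IH A mA.
  by rewrite iterS_preimage IH ?Sp//; exact: measurable_pre.
Qed.

End skew_products.

Section quasi_invariance.
Context d (X : measurableType d) (R : realType).
Variables (P : {measure set X -> \bar R}) (S : X -> X).
Hypothesis nsS : nonsingular P S.

Lemma nonsingular_null A : measurable A -> P (S @^-1` A) = 0%E <-> P A = 0%E.
Proof.
move=> mA; have [[mS _] [d1 d2]] := nsS.
have mSA := measurable_pre mS mA.
split => A0.
  have /d2 : (pushforward P S).-null_set A.
    move=> B mB BA; apply: (subset_measure0 _ mSA _ A0); first exact: measurable_pre.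
    exact: preimage_subset.
  by move=> /(_ A mA (@subset_refl _ A)).
have /d1 : P.-null_set A by move=> B mB BA; exact: subset_measure0 mB mA BA A0.
by move=> /(_ A mA (@subset_refl _ A)).
Qed.

Lemma nonsingular_iter_null n A : measurable A ->
  P (iter n S @^-1` A) = 0%E <-> P A = 0%E.
Proof.
have [[mS _] _] := nsS.
by elim: n A => // n IH A mA; rewrite iterS_preimage IH ?nonsingular_null//; exact: measurable_pre.
Qed.

End quasi_invariance.

(** * The derivative cocycle of a conservative map *)

Section conservative_cocycle.
Context d (X : measurableType d) (R : realType).
Variables (P : probability X R) (S : X -> X) (w : X -> posreal R).
Hypothesis nsS : nonsingular P S.
Hypothesis consS : conservative P S.
Hypothesis wS : is_rn_derivative P S w.

Let iS : invertible_borel S. Proof. by case: nsS. Qed.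
Let mS : measurable_fun setT S. Proof. by case: iS. Qed.
Let mSn n : measurable_fun setT (iter n S).
Proof. by case: (invertible_borel_iter n iS). Qed.
Let mw : measurable_fun setT w. Proof. by case: wS. Qed.
Let mcoc n : measurable_fun setT (fun x => (cocycle S w n x)%:num).
Proof. exact: measurable_num_comp (measurable_cocycle n mS mw). Qed.

Lemma conservative_wandering W : measurable W ->
  (forall n x, (0 < n)%N -> W x -> ~ W (iter n S x)) -> P W = 0%E.
Proof.
move=> mW wW; apply/eqP; rewrite eq_le measure_ge0 andbT leNgt; apply/negP.
move=> /(consS mW)[n n0]; rewrite (_ : _ `&` _ = set0) ?measure0 ?ltxx//.
by apply/seteqP; split => // x [/= H1 H2]; exact: (wW n x n0 H2 H1).
Qed.

Let B := [set x | forall n, (0 < n)%N -> (cocycle S w n x)%:num < 1].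

Lemma measurable_cocycle_lt1 n : measurable [set x | (cocycle S w n x)%:num < 1].
Proof.
rewrite (_ : [set x | _] = (fun x => (cocycle S w n x)%:num) @^-1` `]-oo, 1[).
  exact: measurable_pre.
by apply/seteqP; split => x /=; rewrite in_itv/=.
Qed.

Let mB : measurable B.
Proof.
have -> : B = \bigcap_n [set x | (cocycle S w n.+1 x)%:num < 1].
  by apply/seteqP; split => x H n; [move=> _; exact: H|case: n => // n _; exact: H].
by apply: bigcapT_measurable => n; exact: measurable_cocycle_lt1.
Qed.

(** The points of B whose first return to B takes place at time n + 1. *)
Let ret n := [set x | [/\ B x, B (iter n.+1 S x) &
  forall j, (0 < j)%N -> (j <= n)%N -> ~ B (iter j S x)]].

Let mret n : measurable (ret n).
Proof.
have -> : ret n = B `&` (iter n.+1 S @^-1` B) `&`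
    \bigcap_j [set x | (0 < j <= n)%N -> ~ B (iter j S x)].
  apply/seteqP; split => x; first by move=> [? ? H]; split => // j _ /andP[]; exact: H.
  by move=> [[? ?] H]; split => // j j0 jn; apply: (H j I); exact/andP.
apply: measurableI; first by apply: measurableI => //; exact: measurable_pre (mSn _) mB.
apply: bigcapT_measurable => j; case: (0 < j <= n)%N.
  rewrite (_ : [set x | _] = ~` (iter j S @^-1` B)).
    exact/measurableC/(measurable_pre (mSn j)).
  by apply/seteqP; split => x /=; [exact|].
by rewrite (_ : [set x | _] = setT)//; apply/seteqP; split.
Qed.

Let ret_cover : P (B `\` \bigcup_n ret n) = 0%E.
Proof.
apply: conservative_wandering.
  by apply: measurableD => //; exact: bigcupT_measurable.
move=> n x n0 [Bx nx] [Bn _]; apply: nx.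
have ex : exists k, (0 < k)%N && `[< B (iter k S x) >].
  by exists n; rewrite n0/=; apply/asboolP.
case: (ex_minnP ex) => -[//|k] /andP[_ /asboolP Bk] kmin.
exists k => //; split => // j j0 jk Bj.
by have := kmin j; rewrite j0/= (asboolT Bj) => /(_ isT); rewrite ltnNge jk.
Qed.

(** A point of B that is no first return has no earlier visit to B at all, so the set of these
    points is wandering. *)
Let im_cover : P (B `\` \bigcup_n (iter n.+1 S @` ret n)) = 0%E.
Proof.
have [_ [S' mS' [SK S'K]]] := iS.
have SnK n : cancel (iter n S) (iter n S').
  by elim: n => // n IH x; rewrite iterSr [iter n.+1 S x]iterS SK IH.
have S'nK n : cancel (iter n S') (iter n S).
  by elim: n => // n IH x; rewrite iterSr [iter n.+1 S' x]iterS S'K IH.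
apply: conservative_wandering.
  apply: measurableD => //; apply: bigcupT_measurable => n.
  by apply: invertible_borel_image => //; exact: invertible_borel_iter.
move=> n x n0 [Bx nx] [Bn nn]; apply: nn.
set y := iter n S x in Bn *.
have ex : exists k, (0 < k)%N && `[< B (iter k S' y) >].
  by exists n; rewrite n0/=; apply/asboolP; rewrite SnK.
case: (ex_minnP ex) => -[//|k] /andP[_ /asboolP Bk] kmin.
exists k => //; exists (iter k.+1 S' y); last exact: S'nK.
split => //; first by rewrite S'nK.
move=> j j0 jk Bj.
have e : iter j S (iter k.+1 S' y) = iter (k.+1 - j) S' y.
  set m := (k.+1 - j)%N.
  have -> : k.+1 = (j + m)%N by rewrite subnKC// leqW.
  by rewrite iterD S'nK.
rewrite e in Bj.
have := kmin (k.+1 - j)%N; rewrite subn_gt0 ltnS jk/= (asboolT Bj) => /(_ isT).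
by rewrite leqNgt ltn_subrL j0.
Qed.

Let im_le n : (P (iter n.+1 S @` ret n) <= P (ret n))%E.
Proof.
have [_ ->//] := cocycle_rn_derivative n.+1 iS wS.
rewrite -[leRHS]mul1e -integral_cst//; apply: ge0_le_integral => //.
- exact/measurable_EFinP/measurable_funTS/mcoc.
- by move=> x [Bx _ _]; rewrite lee_fin ltW// (Bx n.+1).
Qed.

Let im_lt n : P (ret n) != 0%E -> (P (iter n.+1 S @` ret n) < P (ret n))%E.
Proof.
move=> rn0; rewrite lt_neqAle im_le andbT; apply: contra rn0 => /eqP.
have [_ ->//] := cocycle_rn_derivative n.+1 iS wS.
move=> e.
have mc : measurable_fun (ret n) (fun x => (cocycle S w n.+1 x)%:num).
  exact/measurable_funTS/mcoc.
have c1 x : ret n x -> (cocycle S w n.+1 x)%:num < 1.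
  by move=> [Bx _ _]; exact: (Bx n.+1).
have ic : P.-integrable (ret n) (fun x => (cocycle S w n.+1 x)%:num%:E).
  apply/integrableP; split; first exact/measurable_EFinP.
  under eq_integral do rewrite gee0_abs//.
  by rewrite e (le_lt_trans (probability_le1 _ _))// ltry.
have i1 : P.-integrable (ret n) (cst 1%E).
  exact: finite_measure_integrable_cst.
have i0 : (\int[P]_(x in ret n) (1 - (cocycle S w n.+1 x)%:num%:E) = 0)%E.
  rewrite integralB// e integral_cst// mul1e subee//.
  exact: fin_num_measure.
have mf : measurable_fun (ret n) (fun x => (1 - (cocycle S w n.+1 x)%:num%:E)%E).
  by apply/measurable_EFinP; apply: measurable_funB.
have i1' : (\int[P]_(x in ret n) `|1 - (cocycle S w n.+1 x)%:num%:E| = 0)%E.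
  rewrite -[RHS]i0; apply: eq_integral => x /set_mem /c1 c.
  by rewrite gee0_abs// -EFinB lee_fin subr_ge0 ltW.
have [Z [mZ Z0 sZ]] := (ae_eq_integral_abs P (mret n) mf).1 i1'.
rewrite eq_le measure_ge0 andbT -[leRHS]Z0; apply: le_measure; rewrite ?inE//.
move=> x rx; apply: sZ => /= /(_ rx) /eqP.
by rewrite -EFinB eqe subr_eq0 eq_sym lt_eqF// c1.
Qed.

(* The returns to B map B onto itself up to null sets, but would strictly
   decrease its measure. *)
Lemma cocycle_lt1_null : P B = 0%E.
Proof.
have retB n : ret n `<=` B by move=> x [].
have imB n : iter n.+1 S @` ret n `<=` B by move=> _ [x [_ + _] <-].
have mim n : measurable (iter n.+1 S @` ret n).
  by apply: invertible_borel_image => //; exact: invertible_borel_iter.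
have tret : trivIset setT ret.
  apply/trivIsetP => i j _ _; rewrite neq_ltn => /orP[ij|ij];
    apply/seteqP; split => // x [[_ Bi Hi] [_ Bj Hj]].
    exact: (Hj i.+1).
  exact: (Hi j.+1).
have PB (F : (set X)^nat) : (forall n, measurable (F n)) -> (forall n, F n `<=` B) ->
    P (B `\` \bigcup_n F n) = 0%E -> P B = P (\bigcup_n F n).
  move=> mF FB B0; have mU := bigcupT_measurable _ mF.
  have BU : B = (\bigcup_n F n) `|` (B `\` \bigcup_n F n).
    by rewrite setDUK//; exact: bigcup_sub.
  rewrite [in LHS]BU measureU//; last 2 first.
  - exact: measurableD.
  - by rewrite setIDA setIC -setIDA setDv setI0.
  by rewrite [X in (_ + X)%E]B0 adde0.
have B1 := PB _ mret retB ret_cover.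
have B2 := PB _ mim imB im_cover.
have [[m rm]|allz] := pselect (exists m, P (ret m) != 0%E); last first.
  rewrite B1; apply/eqP; rewrite eq_le measure_ge0 andbT.
  rewrite (le_trans (measure_sigma_subadditive _ mret (bigcupT_measurable _ mret) (subset_refl _)))//.
  by rewrite eseries0// => n _ _; apply/eqP/negPn/negP => n0; apply: allz; exists n.
have := im_lt rm; rewrite ltNge => /negP; case.
(* The index m with a strict loss is isolated. All other pieces do not grow, so comparing the two
   decompositions of B would force the m-th piece not to shrink. *)
pose F (n : nat) : set X := if n == m then set0 else ret n.
pose G (n : nat) : set X := if n == m then set0 else iter n.+1 S @` ret n.
have mF (n : nat) : measurable (F n) by rewrite /F; case: ifP.
have mG (n : nat) : measurable (G n) by rewrite /G; case: ifP.
have GF n : (P (G n) <= P (F n))%E by rewrite /G /F; case: ifP => // _; exact: im_le.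
have tF : trivIset setT F.
  apply/trivIsetP => i j _ _ ij; rewrite /F; case: ifP => _; rewrite ?set0I//.
  case: ifP => _; rewrite ?setI0//; by move/trivIsetP : tret => /(_ i j I I ij).
have GFU : (P (\bigcup_n G n) <= P (\bigcup_n F n))%E.
  rewrite (measure_semi_bigcup P mF tF (bigcupT_measurable _ mF)).
  apply: (@le_trans _ _ (\sum_(n <oo) P (G n))%E).
    exact: (measure_sigma_subadditive _ mG (bigcupT_measurable _ mG) (subset_refl _)).
  by apply: lee_nneseries.
have mFU := bigcupT_measurable _ mF; have mGU := bigcupT_measurable _ mG.
have retE : \bigcup_n ret n = ret m `|` \bigcup_n F n.
  apply/seteqP; split => x.
    move=> [n _ rx]; have [<-|nm] := eqVneq n m; first by left.
    by right; exists n => //; rewrite /F (negbTE nm).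
  by move=> [rx|[n _]]; [exists m|rewrite /F; case: ifP => // _ rx; exists n].
have imE : \bigcup_n (iter n.+1 S @` ret n) `<=` (iter m.+1 S @` ret m) `|` \bigcup_n G n.
  move=> x [n _ rx]; have [e|nm] := eqVneq n m; first by left; rewrite -e.
  by right; exists n => //; rewrite /G (negbTE nm).
have H1 : P B = (P (ret m) + P (\bigcup_n F n))%E.
  rewrite B1 retE measureU//; apply/seteqP; split => // x [rx [n _]].
  rewrite /F; case: ifP => // /negbT nm rnx.
  by move/trivIsetP : tret => /(_ n m I I nm) => <-.
have H2 : (P B <= P (iter m.+1 S @` ret m) + P (\bigcup_n F n))%E.
  rewrite B2 (le_trans (le_measure _ _ _ imE))// ?inE//.
  - exact: bigcupT_measurable.
  - exact: measurableU.
  rewrite (le_trans (measureU2 _ _ _))//.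
  by rewrite leeD2l.
have fU : P (\bigcup_n F n) \is a fin_num by rewrite fin_num_measure.
by rewrite -(leeD2rE _ _ fU) -H1.
Qed.

(** Off the points whose orbit meets B, every time has a later one such that the cocycle between the
    two is at least 1; the cocycle identity multiplies these bounds. *)
Lemma cocycle_ge1_infinitely_often :
  exists N, [/\ measurable N, P N = 0%E & forall x, ~ N x -> forall m,
    exists2 n, (m <= n)%N & 1 <= (cocycle S w n x)%:num].
Proof.
exists (\bigcup_n (iter n S @^-1` B)); split.
- by apply: bigcupT_measurable => n; exact: measurable_pre (mSn n) mB.
- apply/eqP; rewrite eq_le measure_ge0 andbT.
  have mU n : measurable (iter n S @^-1` B) by exact: measurable_pre (mSn n) mB.
  rewrite (le_trans (measure_sigma_subadditive _ mU (bigcupT_measurable _ mU) (subset_refl _)))//.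
  rewrite eseries0// => n _ _; apply/(nonsingular_iter_null nsS) => //.
  exact: cocycle_lt1_null.
- move=> x Nx; elim=> [|m [n mn cn]]; first by exists 0.
  have : ~ B (iter n S x) by move=> Bn; apply: Nx; exists n.
  move=> /existsNP[k] /not_implyP[k0 /negP]; rewrite -leNgt => ck.
  exists (k + n)%N; first by rewrite -(add1n m) leq_add.
  rewrite cocycleD /=; have := ler_pM ler01 ler01 ck cn.
  by rewrite mulr1.
Qed.

End conservative_cocycle.

(** * Recurrence of maps that preserve an infinite measure *)

Section recurrence.
Context d (Y : measurableType d) (R : realType).
Variables (m : {measure set Y -> \bar R}) (V V' : Y -> Y) (D : (set Y)^nat).
Hypothesis mV : measurable_fun setT V.
Hypothesis mV' : measurable_fun setT V'.
Hypothesis VK : cancel V V'.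
Hypothesis V'K : cancel V' V.
Hypothesis Vm : measure_preserving m V.
Hypothesis mD : forall k, measurable (D k).
Hypothesis D_fin : forall k, (m (D k) < +oo)%E.
Hypothesis D_cover : \bigcup_k D k = setT.
Hypothesis D_return : forall k, exists N, [/\ measurable N, m N = 0%E &
  forall y, D k y -> ~ N y -> forall i, exists2 n, (i <= n)%N & D k (iter n V y)].

Let VnK n : cancel (iter n V) (iter n V').
Proof. by elim: n => // n IH x; rewrite iterSr [iter n.+1 V x]iterS VK IH. Qed.

Let V'nK n : cancel (iter n V') (iter n V).
Proof. by elim: n => // n IH x; rewrite iterSr [iter n.+1 V' x]iterS V'K IH. Qed.

Let mVn n : measurable_fun setT (iter n V).
Proof. by elim: n => [|n IH]; [exact: measurable_id|exact: (measurableT_comp mV IH)]. Qed.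

Let mV'n n : measurable_fun setT (iter n V').
Proof. by elim: n => [|n IH]; [exact: measurable_id|exact: (measurableT_comp mV' IH)]. Qed.

Let Vmn n : measure_preserving m (iter n V).
Proof.
elim: n => // n IH A mA; rewrite iterS_preimage IH ?Vm//.
exact: measurable_pre.
Qed.

Let V'mn n : measure_preserving m (iter n V').
Proof.
move=> A mA; rewrite -(Vmn n); last exact: measurable_pre (mV'n n) mA.
by congr (m _); apply/seteqP; split => x /=; rewrite VnK.
Qed.

Lemma null_bigcup (F : (set Y)^nat) : (forall n, measurable (F n)) ->
  (forall n, m (F n) = 0%E) -> m (\bigcup_n F n) = 0%E.
Proof.
move=> mF F0; apply/eqP; rewrite eq_le measure_ge0 andbT.
rewrite (le_trans (measure_sigma_subadditive _ mF (bigcupT_measurable _ mF) (subset_refl _)))//.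
by rewrite eseries0.
Qed.

(** The images of [Wk] are disjoint, so their parts in [D k] have finite total measure, and by
    invariance so have the sets of points of [Wk] that are in [D k] at time n. By Borel-Cantelli
    almost no point of [Wk] visits [D k] infinitely often, whereas [D_return] says that almost all
    do. *)
Lemma wandering_null W : measurable W ->
  (forall n y, (0 < n)%N -> W y -> ~ W (iter n V y)) -> m W = 0%E.
Proof.
move=> mW wW.
have -> : W = \bigcup_k (W `&` D k) by rewrite -setI_bigcupr D_cover setIT.
apply: null_bigcup => k; first exact: measurableI.
set Wk := W `&` D k.
have mWk : measurable Wk by exact: measurableI.
pose H n := iter n V @` Wk `&` D k.
have imE n : iter n V @` Wk = iter n V' @^-1` Wk by exact: image_can_pre.
have mH n : measurable (H n).
  by apply: measurableI => //; rewrite imE; exact: measurable_pre (mV'n n) mWk.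
have tH : trivIset setT H.
  apply/trivIsetP => i j _ _; wlog ij : i j / (i < j)%N.
    move=> hw; rewrite neq_ltn => /orP[ij|ij]; first by apply: hw => //; rewrite ltn_eqF.
    by rewrite setIC; apply: hw => //; rewrite ltn_eqF.
  move=> _; apply/seteqP; split => // y [[[a [Wa _] <-] _] [[b [Wb _] e] _]].
  apply: (wW (j - i)%N b _ Wb); first by rewrite subn_gt0.
  suff -> : iter (j - i) V b = a by [].
  by apply: (can_inj (VnK i)); rewrite -iterD subnKC// ltnW.
have sH : (\sum_(n <oo) m (H n) < +oo)%E.
  rewrite -(measure_semi_bigcup m mH tH (bigcupT_measurable _ mH)).
  apply: le_lt_trans (D_fin k); apply: le_measure; rewrite ?inE//.
    exact: bigcupT_measurable.
  by move=> y [n _ []].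
pose G n := Wk `&` iter n V @^-1` D k.
have mG n : measurable (G n) by apply: measurableI => //; exact: measurable_pre (mVn n) (mD k).
have GH n : m (G n) = m (H n).
  rewrite -(Vmn n (mH n)); congr (m _); apply/seteqP; split => y.
    by move=> [Wy Dy]; split => //; exists y.
  by move=> [[z Wz /(can_inj (VnK n)) <-] Dy].
have sG : (\sum_(n <oo) m (G n) < +oo)%E.
  by rewrite (eq_eseriesr (fun n _ => GH n)).
have lim0 := lim_sup_set_cvg0 mG sG.
have [N [mN N0 HN]] := D_return k.
have mlim : measurable (lim_sup_set G).
  by apply: bigcapT_measurable => i; apply: bigcup_measurable.
apply/eqP; rewrite eq_le measure_ge0 andbT.
have : (m (lim_sup_set G `|` N) <= 0)%E.
  by rewrite (le_trans (measureU2 _ _ _))// [X in (X + _)%E]lim0 [X in (_ + X)%E]N0 adde0.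
apply: le_trans; apply: le_measure; rewrite ?inE//; first exact: measurableU.
move=> y Wy; have [Ny|Ny] := pselect (N y); [by right|left => i _].
by have [n ni Dn] := HN y Wy.2 Ny i; exists n.
Qed.

(** The points of C whose backward orbit never meets C again form a wandering set for V. A point
    with no return after time i reaches this set at its last visit to C. *)
Lemma recurrence C i : measurable C ->
  m [set y | C y /\ forall n, (i <= n)%N -> ~ C (iter n V' y)] = 0%E.
Proof.
move=> mC.
pose C' := [set y | C y /\ forall n, (0 < n)%N -> ~ C (iter n V' y)].
have mesE j : [set y | C y /\ forall n, (j <= n)%N -> ~ C (iter n V' y)] =
    C `&` \bigcap_n ~` (iter (n + j) V' @^-1` C).
  apply/seteqP; split => y [Cy H]; split => //.
    by move=> n _; apply: H; rewrite leq_addl.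
  by move=> n jn; have := H (n - j)%N I; rewrite /= subnK.
have mes j : measurable [set y | C y /\ forall n, (j <= n)%N -> ~ C (iter n V' y)].
  rewrite mesE; apply: measurableI => //; apply: bigcapT_measurable => n.
  by apply: measurableC; exact: measurable_pre (mV'n _) mC.
have C'0 : m C' = 0%E.
  apply: wandering_null; first exact: (mes 1).
  by move=> n y n0 [Cy _] [_ /(_ n n0)]; rewrite VnK.
have mU n : measurable (iter n V' @^-1` C') by exact: measurable_pre (mV'n _) (mes 1).
apply/eqP; rewrite eq_le measure_ge0 andbT.
rewrite -(null_bigcup mU) => [|n]; last by rewrite V'mn//; exact: (mes 1).
apply: le_measure; rewrite ?inE//; first exact: bigcupT_measurable.
move=> y [Cy Hy].
have ex : exists n, `[< C (iter n V' y) >] by exists 0; apply/asboolP.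
have bd n : `[< C (iter n V' y) >] -> (n <= i)%N.
  move=> /asboolP Cn; rewrite leqNgt; apply/negP => ni.
  exact: (Hy n (ltnW ni) Cn).
case: (ex_maxnP ex bd) => n /asboolP Cn nmax.
exists n => //; split => // k k0; rewrite -iterD => Ck.
by have := nmax (k + n)%N (asboolT Ck); rewrite -[leqRHS]add0n leq_add2r leqNgt k0.
Qed.

End recurrence.

(** * Products of measure-preserving maps *)

Section product_maps.
Context d1 d2 d3 (T1 : measurableType d1) (T2 : measurableType d2)
  (T3 : measurableType d3) (R : realType).
Variables (m1 : {sigma_finite_measure set T1 -> \bar R})
  (m2 : {sigma_finite_measure set T2 -> \bar R})
  (m3 : {sigma_finite_measure set T3 -> \bar R}).

Lemma measurable_prod_map (f : T1 -> T1) (g : T2 -> T2) :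
  measurable_fun setT f -> measurable_fun setT g ->
  measurable_fun setT (fun p : T1 * T2 => (f p.1, g p.2)).
Proof.
move=> mf mg; apply/measurable_fun_pairP; split.
  exact: (measurableT_comp mf measurable_fst).
exact: (measurableT_comp mg measurable_snd).
Qed.

Lemma product_preserving (f : T1 -> T1) (g : T2 -> T2) :
  measurable_fun setT f -> measurable_fun setT g ->
  measure_preserving m1 f -> measure_preserving m2 g ->
  measure_preserving (m1 \x m2)%E (fun p => (f p.1, g p.2)).
Proof.
move=> mf mg pf pg A mA.
pose m' := pushforward_measure
  ((m1 \x m2)%E : {measure set (T1 * T2) -> \bar R}) (measurable_prod_map mf mg).
apply/esym/(product_measure_unique (m' := m')) => // B E mB mE.
rewrite -(pf _ mB) -(pg _ mE) /= /pushforward.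
rewrite -product_measure1E//; exact: measurable_pre.
Qed.

Definition prod_assoc (p : (T1 * T2) * T3) : T1 * (T2 * T3) := (p.1.1, (p.1.2, p.2)).

Lemma measurable_prod_assoc : measurable_fun setT prod_assoc.
Proof.
apply/measurable_fun_pairP; split.
  exact: (measurableT_comp measurable_fst measurable_fst).
apply/measurable_fun_pairP; split; last exact: measurable_snd.
exact: (measurableT_comp measurable_snd measurable_fst).
Qed.

Lemma product_measureA A : measurable A ->
  ((m1 \x m2) \x m3)%E (prod_assoc @^-1` A) = (m1 \x (m2 \x m3))%E A.
Proof.
move=> mA; have mpA := measurable_pre measurable_prod_assoc mA.
rewrite {1}/product_measure1 fubini_tonelli1//; last first.
  exact: measurable_fun_xsection.
apply: eq_integral => x _; apply: eq_integral => y _ /=.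
by congr (m3 _); apply/seteqP; split => z; rewrite /xsection/= !inE/= !inE.
Qed.

End product_maps.

(** * Approximation of measurable sets by an increasing sequence of algebras *)

Section approximation.
Context d (T : measurableType d) (R : realType).
Variables (m : {measure set T -> \bar R}) (K : set T) (G : nat -> set (set T)).
Hypothesis mK : measurable K.
Hypothesis K_fin : (m K < +oo)%E.
Hypothesis mG : forall n, G n `<=` measurable.
Hypothesis G_ndec : forall n k, (n <= k)%N -> G n `<=` G k.
Hypothesis G0 : G 0 set0.
Hypothesis GC : forall n B, G n B -> G n (~` B).
Hypothesis GU : forall n A B, G n A -> G n B -> G n (A `|` B).

Definition approximable : set (set T) := [set A | measurable A /\
  forall e : R, 0 < e -> exists n B, G n B /\ (m (K `&` (A `+` B)) < e%:E)%E].

Let mKY A B : measurable A -> measurable B -> measurable (K `&` (A `+` B)).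
Proof.
by move=> mA mB; apply: measurableI => //; apply: measurableU; exact: measurableD.
Qed.

Lemma approximable_gen n A : G n A -> approximable A.
Proof.
move=> GA; split; first exact: mG GA.
by move=> e e0; exists n, A; rewrite setYK setI0 measure0.
Qed.

Let approximableC A : approximable A -> approximable (~` A).
Proof.
move=> [mA HA]; split; first exact: measurableC.
move=> e /HA[n [B [GB mAB]]]; exists n, (~` B); split; first exact: GC.
rewrite (_ : ~` A `+` ~` B = A `+` B)//.
by apply/seteqP; split => x /=; move: (pselect (A x)) (pselect (B x)); tauto.
Qed.

Let approximableU A B : approximable A -> approximable B -> approximable (A `|` B).
Proof.
move=> [mA HA] [mB HB]; split; first exact: measurableU.
move=> e e0; have e2 : 0 < e / 2 by rewrite divr_gt0.
have [n [A' [GA mAA]]] := HA _ e2; have [k [B' [GB mBB]]] := HB _ e2.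
exists (maxn n k), (A' `|` B'); split.
  by apply: GU; [apply: G_ndec GA; exact: leq_maxl|apply: G_ndec GB; exact: leq_maxr].
rewrite (splitr e) EFinD; apply: le_lt_trans (lteD mAA mBB).
have mA' := mG GA; have mB' := mG GB.
apply: le_trans (measureU2 m (mKY mA mA') (mKY mB mB')).
apply: le_measure; rewrite ?inE.
- by apply: mKY; exact: measurableU.
- by apply: measurableU; exact: mKY.
- by move=> x /=; tauto.
Qed.

Lemma approximableI A B : approximable A -> approximable B -> approximable (A `&` B).
Proof.
move=> hA hB; rewrite -[_ `&` _]setCK setCI; apply: approximableC.
by apply: approximableU; exact: approximableC.
Qed.

Let approximable0 : approximable set0.
Proof. exact: approximable_gen G0. Qed.

(** Countable unions are the only case with content: inside K, of finite measure, what the first n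
    sets leave of the union decreases to the empty set. *)
Lemma approx_sigma_algebra : sigma_algebra setT approximable.
Proof.
split => //; first by move=> A /approximableC; rewrite setTD.
move=> A HA; pose F n := \big[setU/set0]_(i < n) A i.
have HF n : approximable (F n).
  rewrite /F; elim: n => [|n IH]; first by rewrite big_ord0.
  by rewrite big_ord_recr; exact: approximableU.
have mA n : measurable (A n) by case: (HA n).
have mU : measurable (\bigcup_k A k) by exact: bigcupT_measurable.
split => // e e0; have e2 : 0 < e / 2 by rewrite divr_gt0.
pose D n := K `&` (\bigcup_k A k `\` F n).
have mF n : measurable (F n) by case: (HF n).
have mD n : measurable (D n) by apply: measurableI => //; exact: measurableD.
have D0 : \bigcap_n D n = set0.
  apply/seteqP; split => // x Dx; have [_ [[k _ Akx] _]] := Dx 0%N I.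
  have [_ [_]] := Dx k.+1 I; apply; rewrite /F -bigcup_mkord.
  by exists k => /=.
have : m (D n) @[n --> \oo] --> m (\bigcap_n D n).
  apply: nonincreasing_cvg_mu => //.
  - apply: le_lt_trans K_fin; apply: le_measure; rewrite ?inE//.
    by move=> x [].
  - by rewrite D0.
  - move=> n k nk; apply/subsetPset => x [Kx [Ax Fx]]; split => //; split => //.
    move=> Fn; apply: Fx; move: Fn; rewrite /F -!bigcup_mkord => -[i /= iltn Ai].
    by exists i => //=; exact: leq_trans nk.
rewrite D0 measure0 => /fine_cvgP[_ /cvgrPdist_lt/(_ _ e2)][N _ /(_ N (leqnn _))].
rewrite /= sub0r normrN ger0_norm ?fine_ge0//.
have DN : m (D N) \is a fin_num.
  rewrite ge0_fin_numE//; apply: le_lt_trans K_fin; apply: le_measure; rewrite ?inE//.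
  by move=> x [].
rewrite -lte_fin fineK// => mDN.
have [n [B [GB mFB]]] := (HF N).2 _ e2.
exists n, B; split => //.
rewrite (splitr e) EFinD; apply: le_lt_trans (lteD mDN mFB).
have mB := mG GB.
apply: le_trans (measureU2 m (mD N) (mKY (mF N) mB)).
apply: le_measure; rewrite ?inE; [exact: mKY|by apply: measurableU => //; exact: mKY|].
have FU : F N `<=` \bigcup_k A k.
  by rewrite /F -bigcup_mkord => x [k _ Ak]; exists k.
by move=> x; rewrite /D /=; move: (FU x) (pselect (F N x)); tauto.
Qed.

End approximation.

(** * Shifts of product measures *)

Section shifts.
Context (R : realType).
Implicit Types (nu : int -> probability bool R).
Local Notation PM := infinite_product.

Definition shift (k : int) (x : bits int) : bits int := fun i => x (i + k).

Lemma measurable_shift k : measurable_fun setT (shift k).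
Proof. by apply: measurable_bitsP => // i; exact: measurable_coord. Qed.

Lemma iter_bits_shift n : iter n bits_shift = shift n%:Z.
Proof.
apply/funext => x; elim: n x => [|n IH] x; first by apply/funext => i; rewrite /shift addr0.
rewrite iterSr IH; apply/funext => i; rewrite /shift /bits_shift; congr x.
by rewrite -addn1 PoszD addrA.
Qed.

Lemma iter_shiftN n : iter n (shift (-1)) = shift (- n%:Z).
Proof.
apply/funext => x; elim: n x => [|n IH] x.
  by apply/funext => i; rewrite /shift oppr0 addr0.
rewrite iterSr IH; apply/funext => i; rewrite /shift; congr x.
by rewrite -addn1 PoszD opprD addrA.
Qed.

Lemma shift_merge k (J J' : pred int) y x : (forall i, J' i = J (i + k)) ->
  shift k (merge J y x) = merge J' (shift k y) (shift k x).
Proof. by move=> JJ; apply/funext => i; rewrite /shift /merge JJ. Qed.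

Lemma product_shift nu k A : measurable A ->
  PM nu (shift k @^-1` A) = PM (fun i => nu (i + k)) A.
Proof.
move=> mA.
pose f := mfun_Sub (mem_set (measurable_shift k)).
pose Q : probability _ _ := distribution (PM nu) f.
change (Q A = PM (fun i => nu (i + k)) A).
apply: bits_measure_unique mA; first by rewrite [X in (X < _)%E]probability_setT ltry.
move=> s a us; rewrite [RHS]cylinderE//.
pose t := [seq i + k | i <- s].
transitivity (PM nu (cylinder t (shift (- k) a))).
  change (PM nu (shift k @^-1` cylinder s a) = PM nu (cylinder t (shift (- k) a))).
  congr (PM nu _); apply/seteqP; split => x H i.
    by move=> /mapP[j js ->]; rewrite /shift addrK -H.
  by move=> is_; have := H (i + k) (map_f _ is_); rewrite /shift addrK.
have ut : uniq t by rewrite map_inj_uniq//; exact: addIr.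
rewrite [LHS](cylinderE _ _ ut).
rewrite big_map; congr EFin; apply: eq_bigr => i _.
by rewrite /wt /shift !addrK.
Qed.

End shifts.

(** * Conditional probabilities given the future, by redrawing the past *)

Section resampling.
Context (R : realType) (nu : int -> probability bool R).
Context dW (W : measurableType dW).
Variable eta : {sigma_finite_measure set W -> \bar R}.
Local Notation P := (infinite_product nu).
Local Notation m := (P \x eta)%E.
Local Notation X := (bits int).

Definition past (N : nat) : pred int := fun i => i <= - N%:Z.

Definition future_set (N : nat) (B : set (X * W)) :=
  forall u, depends_on (predC (past N)) (fun x => B (x, u)).

Definition resample (N : nat) (q : (X * W) * X) : X * W :=
  (merge (past N) q.2 q.1.1, q.1.2).

Lemma measurable_resample N : measurable_fun setT (resample N).
Proof.
apply/measurable_fun_pairP; split.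
  apply: (@measurableT_comp _ _ _ _ _ _ (fun p : X * X => merge (past N) p.1 p.2)
    _ (fun q : (X * W) * X => (q.2, q.1.1))); first exact: measurable_merge.
  apply/measurable_fun_pairP; split; first exact: measurable_snd.
  exact: (measurableT_comp measurable_fst measurable_fst).
exact: (measurableT_comp measurable_snd measurable_fst).
Qed.

(** An everywhere defined version of the conditional probability of B given the coordinates after -N
    and the W-component. *)
Definition resample_prob N (B : set (X * W)) (p : X * W) : \bar R :=
  P (xsection (resample N @^-1` B) p).

Lemma measurable_resample_pre N (B : set (X * W)) : measurable B ->
  measurable (resample N @^-1` B).
Proof. exact: measurable_pre (measurable_resample N). Qed.

Lemma measurable_resample_prob N B : measurable B ->
  measurable_fun setT (resample_prob N B).
Proof. by move=> mB; exact: measurable_fun_xsection (measurable_resample_pre N mB). Qed.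

Lemma resample_probE N B p :
  resample_prob N B p = P [set y | B (merge (past N) y p.1, p.2)].
Proof. by congr (P _); apply/seteqP; split => y; rewrite /xsection/= inE. Qed.

Lemma measurable_section N (B : set (X * W)) x u : measurable B ->
  measurable [set y | B (merge (past N) y x, u)].
Proof.
move=> mB; rewrite (_ : [set y | _] = xsection (resample N @^-1` B) (x, u)).
  exact: measurable_xsection (measurable_resample_pre N mB).
by apply/seteqP; split => y; rewrite /xsection/= inE.
Qed.

Lemma integral_resample_prob N B : measurable B ->
  (\int[m]_p resample_prob N B p)%E = m B.
Proof.
move=> mB; have mf := measurable_resample_prob N mB.
rewrite fubini_tonelli1// fubini_tonelli//.
transitivity ((P \x^ eta)%E B); last first.
  by apply/esym/product_measure_unique => // C E mC mE; exact: product_measure2E.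
apply: eq_integral => u _ /=.
have mBu : measurable (ysection B u) by exact: measurable_ysection.
rewrite -[RHS](product_merge_self nu (predC (past N)) mBu).
rewrite /fubini_G /product_measure1; apply: eq_integral => x _ /=.
rewrite resample_probE/=; congr (P _); apply/seteqP; split => y;
  rewrite /xsection/= inE/= /ysection/= inE/=;
  suff -> : merge (predC (past N)) x y = merge (past N) y x by [];
  by apply/funext => i; rewrite /merge /=; case: (past N i).
Qed.

(** The defining property of conditional expectation: membership in D is not affected by the
    redrawing, so the indicator of D can be moved inside. *)
Lemma integral_resample_prob_future N B D : measurable B -> measurable D ->
  future_set N D -> (\int[m]_(p in D) resample_prob N B p)%E = m (D `&` B).
Proof.
move=> mB mD fD; rewrite -(integral_resample_prob N (measurableI _ _ mD mB)).
rewrite [LHS]integral_mkcond; apply: eq_integral => -[x u] _.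
have DE y : D (merge (past N) y x, u) = D (x, u) := fD u _ _ (@mergeEC _ _ _ _).
rewrite patchE; case: ifPn => [/set_mem Dx|/negP Dx]; rewrite !resample_probE.
  by congr (P _); apply/seteqP; split => y /=; rewrite DE => //; case.
rewrite (_ : [set y | _] = set0) ?measure0//.
by apply/seteqP; split => // y /=; rewrite DE => -[/mem_set].
Qed.

Lemma future_set_resample_prob N B c :
  future_set N [set p | (c%:E < resample_prob N B p)%E].
Proof.
move=> u x x' xx'; rewrite /= !resample_probE /=.
suff -> : (fun y => B (merge (past N) y x, u)) = (fun y => B (merge (past N) y x', u)) by [].
apply/funext => y; congr (B (_, u)); apply/funext => i; rewrite /merge.
by case: ifPn => // /xx'.
Qed.

Lemma future_setS N N' B : (N <= N')%N -> future_set N B -> future_set N' B.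
Proof.
move=> NN fB u; apply: depends_onS (fB u) => i; rewrite !inE /past /= -!ltNge.
by apply: le_lt_trans; rewrite lerN2 lez_nat.
Qed.

Lemma future_setC N B : future_set N B -> future_set N (~` B).
Proof. by move=> fB u x y xy; rewrite /setC/= (fB u _ _ xy). Qed.

Lemma future_setU N A B : future_set N A -> future_set N B -> future_set N (A `|` B).
Proof. by move=> fA fB u x y xy; rewrite /setU/= (fA u _ _ xy) (fB u _ _ xy). Qed.

(* Doob's maximal inequality for the conditional probabilities of B given the
   coordinates after -N. *)
Lemma resample_maximal n B (c : R) : 0 < c -> measurable B ->
  (c%:E * m (\bigcup_j [set p | (c%:E < resample_prob (n + j) B p)%E]) <= m B)%E.
Proof.
move=> c0 mB; set F := fun j => [set p | (c%:E < resample_prob (n + j) B p)%E].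
have mF j : measurable (F j).
  rewrite -[X in measurable X]setTI; apply: emeasurable_fun_o_infty => //.
  exact: measurable_resample_prob.
have fF j : future_set (n + j) (F j) by exact: future_set_resample_prob.
(* The event that the level c is exceeded for the first time at index j. It is decided by the
   coordinates after -(n + j), which makes [integral_resample_prob_future] available. *)
have mD j : measurable (seqDU F j).
  by apply: measurableD => //; apply: bigsetU_measurable.
have fD j : future_set (n + j) (seqDU F j).
  rewrite /seqDU setDE; move=> u x y xy; rewrite /setI/= (fF j u _ _ xy).
  suff e : (\big[setU/set0]_(k < j) F k) (x, u) = (\big[setU/set0]_(k < j) F k) (y, u).
    by rewrite /setC/= e.
  rewrite -!bigcup_mkord; apply/propext; split=> -[k /= kj Fk]; exists k => //;
    move: Fk; have := future_setS _ (fF k) => /(_ (n + j)%N); rewrite leq_add2l => /(_ (ltnW kj) u).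
    by move=> /(_ _ _ xy) ->.
  by move=> /(_ _ _ xy) ->.
rewrite seqDU_bigcup_eq measure_semi_bigcup//; last exact: bigcupT_measurable.
rewrite -nneseriesZl//.
apply: (@le_trans _ _ (\sum_(j <oo) m (seqDU F j `&` B))%E).
  apply: lee_nneseries => // j _; first by rewrite mule_ge0// lee_fin ltW.
  rewrite -(integral_resample_prob_future mB (mD j) (fD j)).
  rewrite -integral_cst//; apply: ge0_le_integral => //.
  - by move=> *; rewrite lee_fin ltW.
  - by apply: measurable_funTS; exact: measurable_resample_prob.
  - by move=> p [Fp _]; exact: ltW.
rewrite -measure_semi_bigcup//; last 3 first.
- by move=> j; exact: measurableI.
- exact/trivIset_setIr/trivIset_seqDU.
- by apply: bigcupT_measurable => j; exact: measurableI.
apply: le_measure; rewrite ?inE//.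
  by apply: bigcupT_measurable => j; exact: measurableI.
by move=> p [j _ []].
Qed.

End resampling.

(** * Invariant sets of recurrent maps that shift the past away *)

Section invariant_sets.
Context (R : realType) (nu : int -> probability bool R).
Context dW (W : measurableType dW).
Variable eta : {sigma_finite_measure set W -> \bar R}.
Local Notation P := (infinite_product nu).
Local Notation m := (P \x eta)%E.
Local Notation X := (bits int).
Hypothesis past_stationary : forall (N : nat) i b, i <= 0 ->
  wt nu (i - N%:Z) b = wt nu i b.
Variables (V : X * W -> X * W) (g : X -> W -> W).
Hypothesis mV : measurable_fun setT V.
Hypothesis VE : forall x u, V (x, u) = (shift (-1) x, g x u).
Hypothesis g_dep : forall u, depends_on (fun i : int => 0 <= i) (fun x => g x u).
Hypothesis recV : forall C i, measurable C ->
  m [set y | C y /\ forall n, (i <= n)%N -> ~ C (iter n V y)] = 0%E.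

Lemma iter_fst n p : (iter n V p).1 = shift (- n%:Z) p.1.
Proof.
rewrite -iter_shiftN; elim: n => // n IH; rewrite !iterS -IH.
by case: (iter n V p) => x u; rewrite VE.
Qed.

(** Step j + 1 reads coordinates from -j on, so n steps read only coordinates after -n. *)
Lemma iter_snd_dep n x x' u : agree_on (predC (past n)) x x' ->
  (iter n V (x, u)).2 = (iter n V (x', u)).2.
Proof.
elim: n => // n IH xx'; rewrite !iterS.
have {}IH : (iter n V (x, u)).2 = (iter n V (x', u)).2.
  apply: IH => i; rewrite /past /= -!ltNge => ni; apply: xx'.
  rewrite /past /= -ltNge; apply: le_lt_trans ni.
  by rewrite lerN2 lez_nat.
have := iter_fst n (x, u); have := iter_fst n (x', u).
case: (iter n V (x, u)) IH => y v /= ->; case: (iter n V (x', u)) => y' v' /= -> ->.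
rewrite !VE /=; apply: g_dep => i i0; rewrite /shift; apply: xx'.
rewrite /past /= -ltNge -addn1 PoszD opprD.
by rewrite (addrC i) ltrD2l (lt_le_trans _ i0).
Qed.

Section one_set.
Variable A : set (X * W).
Hypothesis mA : measurable A.
Hypothesis invA : V @^-1` A = A.

Lemma iter_invariant n : iter n V @^-1` A = A.
Proof. by elim: n => // n IH; rewrite iterS_preimage invA. Qed.

(** The n-th iterate of V moves the coordinates up to -n to the positions up to 0 without reading
    them, and their law is stationary. Redrawing them before or after the iteration is thus the
    same, and A is invariant. *)
Lemma resample_prob_invariant n p :
  resample_prob nu n A p = resample_prob nu 0 A (iter n V p).
Proof.
have pastE i : past 0 i = past n (i + - n%:Z).
  by rewrite /past oppr0 gerDr.
case: p => x u; rewrite !resample_probE.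
set v := (iter n V (x, u)).2.
have -> : [set y | A (merge (past n) y (x, u).1, (x, u).2)] =
    shift (- n%:Z) @^-1` [set y | A (merge (past 0) y (iter n V (x, u)).1, v)].
  apply/seteqP; split => y /=; rewrite iter_fst /=.
    rewrite -{1}(iter_invariant n) /= [iter n V _]surjective_pairing iter_fst/=.
    rewrite (shift_merge _ _ pastE).
    by rewrite (@iter_snd_dep n _ x) //; exact: mergeEC.
  move=> H; rewrite -(iter_invariant n) /= [iter n V _]surjective_pairing iter_fst/=.
  rewrite (shift_merge _ _ pastE).
  by rewrite (@iter_snd_dep n _ x) //; exact: mergeEC.
rewrite product_shift; last exact: measurable_section.
apply: (@product_local _ _ _ _ (past 0)).
- exact: measurable_section.
- move=> y y' yy'; rewrite /=; congr (A (_, _)); apply/funext => i; rewrite /merge.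
  by case: ifP => // /yy'.
- by move=> i b; rewrite /past oppr0 => i0; exact: past_stationary.
Qed.

Lemma coord_approximable (E : set W) :
  let G (k : nat) := [set B : set (X * W) | measurable B /\ future_set k B] in
  measurable E -> (eta E < +oo)%E -> forall B : set (X * W), measurable B ->
  approximable m (setT `*` E) G B.
Proof.
move=> G mE Eoo.
have mK : measurable (setT `*` E : set (X * W)) by exact: measurableX.
have Koo : (m (setT `*` E) < +oo)%E.
  by rewrite [X in (X < _)%E]product_measure1E// [X in (X * _)%E]probability_setT mul1e.
have mG k : G k `<=` measurable by move=> B [].
have ndG k l : (k <= l)%N -> G k `<=` G l.
  by move=> kl B [mB fB]; split => //; exact: future_setS kl fB.
have G0 : G 0 set0 by split.
have GC k B : G k B -> G k (~` B).
  by move=> [mB fB]; split; [exact: measurableC|exact: future_setC].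
have GU k B B' : G k B -> G k B' -> G k (B `|` B').
  by move=> [mB fB] [mB' fB']; split; [exact: measurableU|exact: future_setU].
have [A0 AC AU] := approx_sigma_algebra mK Koo mG ndG G0 GC GU.
have fstA (C : set X) : measurable C -> approximable m (setT `*` E) G (C `*` setT).
  move: C; apply: smallest_sub.
    split; first by rewrite set0X.
      move=> C /AC; rewrite setTD.
      suff -> : ~` (C `*` [set: W]) = (setT `\` C) `*` setT by [].
      by apply/seteqP; split => -[x u] /=; tauto.
    by move=> F /AU; rewrite -setX_bigcupl.
  move=> _ [i [b ->]]; apply: (@approximable_gen _ _ _ _ _ _ mG `|i|.+1); split.
    by apply: measurableX => //; exact: measurable_coord_eq.
  move=> u x y xy; rewrite /setX/=; congr (_ /\ _); rewrite xy//.
  rewrite /past /= -ltNge ltrNl -addn1 PoszD.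
  by rewrite abszE (le_lt_trans (ler_norm _))// normrN ltrDl.
rewrite measurable_prod_measurableType => B; move: B; apply: smallest_sub => //.
move=> _ [C mC [D mD <-]].
have -> : C `*` D = (C `*` setT) `&` (setT `*` D).
  by apply/seteqP; split => -[x u] /=; tauto.
apply: approximableI => //; first exact: fstA.
by apply: (@approximable_gen _ _ _ _ _ _ mG 0); split => //; exact: measurableX.
Qed.

(** The conditional probabilities given more and more of the past should tend to 0 off A. But by
    [resample_prob_invariant] the n-th one at p exceeds c whenever the n-th iterate of p is in C,
    which recurrence provides for arbitrarily large n. The maximal inequality makes the
    contradiction quantitative. *)
Lemma resample_prob_notin (c : R) : 0 < c ->
  m [set p | ~ A p /\ (c%:E < resample_prob nu 0 A p)%E] = 0%E.
Proof.
move=> c0; set C := [set p | _].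
have mlt k B : measurable B -> measurable [set p | (c%:E < resample_prob nu k B p)%E].
  move=> mB; rewrite -[X in measurable X]setTI; apply: emeasurable_fun_o_infty => //.
  exact: measurable_resample_prob.
have mC : measurable C by apply: measurableI; [exact: measurableC|exact: mlt].
have [F [FT ndF Foo]] := (sigma_finiteP _ _).1 (sigma_finiteT eta).
have -> : C = \bigcup_k (C `&` (setT `*` F k)).
  by rewrite -setI_bigcupr -setX_bigcupr -FT setXTT setIT.
apply: null_bigcup => k; first by apply: measurableI => //; apply: measurableX => //; case: (Foo k).
set K := setT `*` F k.
have mK : measurable K by apply: measurableX => //; case: (Foo k).
have small e : 0 < e -> (m (C `&` K) <= (e + e / c)%:E)%E.
  move=> e0.
  have [_ /(_ e e0)[n [B [[mB fB] mAB]]]] := @coord_approximable (F k) (Foo k).1 (Foo k).2 A mA.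
  set R0 := K `&` (A `+` B) in mAB.
  have mR0 : measurable R0.
    by apply: measurableI => //; apply: measurableU; exact: measurableD.
  have := resample_maximal nu eta n c0 mR0.
  set D := \bigcup_j _ => mD.
  have measD : measurable D by apply: bigcupT_measurable => j; exact: mlt.
  have mDe : (m D <= (e / c)%:E)%E.
    rewrite mulrC EFinM -lee_pdivrMl ?invr_gt0// invrK.
    exact: le_trans mD (ltW mAB).
  have := recV n mC; set N := [set y | _] => N0.
  have mN : measurable N.
    rewrite (_ : N = C `&` \bigcap_j ~` (iter (n + j) V @^-1` C)).
      apply: measurableI => //; apply: bigcapT_measurable => j; apply: measurableC.
      apply: measurable_pre => //; elim: (n + j)%N => [|i IH]; first exact: measurable_id.
      exact: (measurableT_comp mV IH).
    apply/seteqP; split => p [Cp H]; split => //.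
      by move=> j _; apply: H; rewrite leq_addr.
    by move=> j nj; have := H (j - n)%N I; rewrite /= subnKC.
  have sub : C `&` K `<=` N `|` (R0 `|` D).
    move=> p [Cp Kp]; have [Np|Np] := pselect (N p); [by left|right].
    have [Rp|Rp] := pselect (R0 p); [by left|right].
    have : ~ forall j, (n <= j)%N -> ~ C (iter j V p) by move=> H; apply: Np.
    move=> /existsNP[j /not_implyP[nj /contrapT [_ Cj]]].
    exists (j - n)%N => //=; rewrite subnKC//.
    move: Cj; rewrite -resample_prob_invariant => /lt_le_trans; apply.
    case: p Cp Kp Rp {Np} => x u [nA _] [_ /= Fu] nR; rewrite !resample_probE.
    have nB : ~ B (x, u) by move=> Bx; apply: nR; split => //; right.
    apply: le_measure; rewrite ?inE; [exact: measurable_section|exact: measurable_section|].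
    move=> y /= Ay; split => //; left; split => //.
    have := future_setS nj fB => /(_ u _ _ (@mergeEC _ (past j) x y)) ->.
    exact: nB.
  apply: (@le_trans _ _ (m (N `|` (R0 `|` D)))).
    by apply: le_measure; rewrite ?inE//; [exact: measurableI|apply: measurableU => //; exact: measurableU].
  apply: le_trans (measureU2 m mN (measurableU _ _ mR0 measD)) _.
  rewrite [X in (X + _)%E]N0 add0e.
  apply: le_trans (measureU2 m mR0 measD) _.
  by rewrite EFinD; apply: leeD => //; exact: ltW.
apply/eqP; rewrite eq_le measure_ge0 andbT; apply/lee_addgt0Pr => e e0.
rewrite add0e.
have e1 : 0 < e / (1 + c^-1) by rewrite divr_gt0// addr_gt0// invr_gt0.
apply: le_trans (small _ e1) _; rewrite lee_fin.
rewrite le_eqVlt; apply/orP; left; apply/eqP; field.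
by rewrite gt_eqF//= gt_eqF// addr_gt0.
Qed.

End one_set.

(* A recurrent map that only moves the past coordinates independently of the
   future has no invariant sets beyond those determined by the future. *)
Lemma invariant_future A : measurable A -> V @^-1` A = A ->
  exists A0, [/\ measurable A0, future_set 0 A0 & m (A `+` A0) = 0%E].
Proof.
move=> mA invA.
exists [set p | ((2^-1)%:E < resample_prob nu 0 A p)%E].
have mlt (c : R) B : measurable B -> measurable [set p | (c%:E < resample_prob nu 0 B p)%E].
  move=> mB; rewrite -[X in measurable X]setTI; apply: emeasurable_fun_o_infty => //.
  exact: measurable_resample_prob.
have mAC := measurableC mA.
have invAC : V @^-1` (~` A) = ~` A by rewrite -preimage_setC invA.
split; [exact: mlt|exact: future_set_resample_prob|].
have c2 : 0 < (2^-1 : R) by rewrite invr_gt0.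
(* On A minus the chosen set the complement of A has conditional probability at least 1/2, hence
   more than 1/4, which puts the point in the second null set. *)
have c4 : 0 < (4^-1 : R) by rewrite invr_gt0.
have N1 := resample_prob_notin mA invA c2.
have N2 := resample_prob_notin mAC invAC c4.
have mN1 : measurable [set p | ~ A p /\ ((2^-1)%:E < resample_prob nu 0 A p)%E].
  by apply: measurableI => //; exact: mlt.
have mN2 : measurable [set p | ~ (~` A) p /\ ((4^-1)%:E < resample_prob nu 0 (~` A) p)%E].
  by apply: measurableI => //; [exact: measurableC|exact: mlt].
apply/eqP; rewrite eq_le measure_ge0 andbT.
apply: (@le_trans _ _ (m ([set p | ~ A p /\ ((2^-1)%:E < resample_prob nu 0 A p)%E] `|`
  [set p | ~ (~` A) p /\ ((4^-1)%:E < resample_prob nu 0 (~` A) p)%E]))).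
  apply: le_measure; rewrite ?inE.
  - by apply: measurableU; apply: measurableD => //; exact: mlt.
  - exact: measurableU.
  move=> [x u] [[Ap /negP]|[? ?]]; last by left.
  rewrite -leNgt => q; right; split; first by move=> /(_ Ap).
  rewrite resample_probE /= (_ : [set y | _] = ~` [set y | A (merge (past 0) y x, u)])//.
  rewrite probability_setC; last exact: measurable_section.
  move: q; rewrite resample_probE /=; set r := P _.
  have : r \is a fin_num by apply: fin_num_measure; exact: measurable_section.
  case: r => // r _; rewrite lee_fin lte_fin => r2.
  by lra.
apply: le_trans (measureU2 m mN1 mN2) _.
by rewrite [X in (X + _)%E]N1 [X in (_ + X)%E]N2 adde0.
Qed.

End invariant_sets.

(** * Approximation by sets that depend on finitely many coordinates *)

Section finite_coordinates.
Context (R : realType) (I : countType).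

Lemma finite_coordinates_dense (m : {measure set (bits I) -> \bar R}) A :
  (m setT < +oo)%E -> measurable A -> forall e : R, 0 < e ->
  exists s B, [/\ uniq s, measurable B, depends_on (mem s) B &
                 (m (A `+` B) < e%:E)%E].
Proof.
move=> moo mA e e0.
pose G (k : nat) := [set B : set (bits I) | measurable B /\
  exists2 s, uniq s & depends_on (mem s) B].
have mK : measurable [set: bits I] by [].
have mG k : G k `<=` measurable by move=> B [].
have ndG k l : (k <= l)%N -> G k `<=` G l by move=> _ B.
have G0 : G 0 set0 by split; [exact: measurable0|exists [::]].
have GC k B : G k B -> G k (~` B).
  move=> [mB [s us dB]]; split; first exact: measurableC.
  by exists s => // x y xy; rewrite /setC/= (dB _ _ xy).
have GU k B B' : G k B -> G k B' -> G k (B `|` B').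
  move=> [mB [s us dB]] [mB' [s' us' dB']]; split; first exact: measurableU.
  exists (undup (s ++ s')); first exact: undup_uniq.
  move=> x y xy; rewrite /setU/=.
  rewrite (dB x y); last by move=> i /= is_; apply: xy; rewrite /= mem_undup mem_cat is_.
  by rewrite (dB' x y)//; move=> i /= is_; apply: xy; rewrite /= mem_undup mem_cat is_ orbT.
have appA : measurable `<=` approximable m setT G.
  apply: smallest_sub; first exact: approx_sigma_algebra.
  move=> _ [i [b ->]]; apply: (@approximable_gen _ _ _ _ _ _ mG 0); split.
    exact: measurable_coord_eq.
  by exists [:: i] => // x y xy; rewrite /= xy//= inE.
have [_ /(_ e e0)[_ [B [[mB [s us dB]]]]]] := appA A mA.
by rewrite setTI => H; exists s, B.
Qed.

Lemma fine_measureD_le (Q : probability (bits I) R) B B' : measurable B -> measurable B' ->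
  fine (Q B) <= fine (Q B') + fine (Q (B `\` B')).
Proof.
move=> mB mB'; have mBB := measurableD mB mB'.
rewrite -fineD ?fin_num_measure//; apply: fine_le; rewrite ?fin_num_measure//.
  by rewrite fin_numD !fin_num_measure.
apply: le_trans (measureU2 Q mB' mBB).
apply: le_measure; rewrite ?inE//; first exact: measurableU.
by move=> x /=; move: (pselect (B' x)); tauto.
Qed.

End finite_coordinates.

(** * Chi-square and Hellinger bounds, by induction on the coordinates *)

Section cylinder_induction.
Context (R : realType) (I : countType).
Implicit Types (mu nu : I -> probability bool R) (s t : seq I) (a : bits I).
Local Notation PM := infinite_product.

Definition update a (i : I) (b : bool) : bits I := fun j => if j == i then b else a j.

Lemma cylinder_update t a i b : i \notin t -> cylinder t (update a i b) = cylinder t a.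
Proof.
move=> it; apply/seteqP; split => x H j jt; rewrite H// /update;
  by case: eqP => // e; rewrite -e jt in it.
Qed.

Lemma cylinder_split mu t a i A : i \notin t -> measurable A ->
  fine (PM mu (A `&` cylinder t a)) =
  fine (PM mu (A `&` cylinder (i :: t) (update a i false))) +
  fine (PM mu (A `&` cylinder (i :: t) (update a i true))).
Proof.
move=> it mA.
have mC b : measurable (A `&` cylinder (i :: t) (update a i b)).
  by apply: measurableI => //; exact: measurable_cylinder.
rewrite -fineD ?fin_num_measure// -measureU//; last first.
  apply/seteqP; split => // x [[_ H0] [_ H1]].
  by have := H0 i (mem_head _ _); rewrite (H1 i (mem_head _ _)) /update eqxx.
congr (fine (PM mu _)); rewrite -setIUr; congr (_ `&` _).
rewrite !cylinder_cons !cylinder_update// /update eqxx -setIUl.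
rewrite (_ : _ `|` _ = setT) ?setTI//.
by apply/seteqP; split => // x _ /=; case: (x i); [right|left].
Qed.

Lemma wt_cylinder mu t a : uniq t -> fine (PM mu (cylinder t a)) = \prod_(i <- t) wt mu i (a i).
Proof. by move=> ut; rewrite cylinderE. Qed.

Lemma prod_update mu t a i b : i \notin t ->
  \prod_(j <- i :: t) wt mu j (update a i b j) = wt mu i b * \prod_(j <- t) wt mu j (a j).
Proof.
move=> it; rewrite big_cons {1}/update eqxx; congr (_ * _).
apply: eq_big_seq => j jt; rewrite /update; case: eqP => // e.
by rewrite -e jt in it.
Qed.

Variables (mu nu : I -> probability bool R).
Hypothesis nu0 : forall i b, 0 < wt nu i b.

(** The second moment under nu of the likelihood ratio of the i-th coordinate. *)
Definition chi2_term i : R := wt mu i false ^+ 2 / wt nu i false + wt mu i true ^+ 2 / wt nu i true.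

(** The Hellinger affinity of the two laws of the i-th coordinate. *)
Definition hellinger_term i : R :=
  Num.sqrt (wt mu i false * wt nu i false) + Num.sqrt (wt mu i true * wt nu i true).

Lemma wprod_ge0 mu' t a : 0 <= \prod_(j <- t) wt mu' j (a j).
Proof. by apply: prodr_ge0 => *; exact: wt_ge0. Qed.

(* Cauchy-Schwarz for the likelihood ratio on the coordinates in s, one
   coordinate at a time. *)
Lemma chi2_cylinder s t a (A : set (bits I)) : uniq (s ++ t) -> measurable A ->
  depends_on (mem (s ++ t)) A ->
  fine (PM mu (A `&` cylinder t a)) ^+ 2 * \prod_(j <- t) wt nu j (a j) <=
  (\prod_(i <- s) chi2_term i) * fine (PM nu (A `&` cylinder t a)) *
  (\prod_(j <- t) wt mu j (a j)) ^+ 2.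
Proof.
elim: s t a => [|i s IH] t a /= ust mA dA.
  rewrite big_nil mul1r.
  have [Aa|Aa] := pselect (A a).
    have -> : A `&` cylinder t a = cylinder t a.
      apply/seteqP; split => x; first by case.
      move=> tx; split => //; rewrite (dA x a)// => j jt; exact: tx.
    by rewrite !wt_cylinder// mulrC.
  have -> : A `&` cylinder t a = set0.
    apply/seteqP; split => // x [Ax tx]; apply: Aa; rewrite -(dA x a)// => j jt; exact: tx.
  by rewrite !measure0/= expr0n/= !mul0r.
move: ust => /andP[ist ust].
have it : i \notin t by apply: contra ist => it; rewrite mem_cat it orbT.
have ust' : uniq (s ++ i :: t).
  by rewrite -cat1s uniq_catCA /= ist ust.
have dA' : depends_on (mem (s ++ i :: t)) A.
  by apply: depends_onS dA => j; rewrite !inE !mem_cat !inE; case: (j == i); rewrite ?orbT.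
have H0 := IH (i :: t) (update a i false) ust' mA dA'.
have H1 := IH (i :: t) (update a i true) ust' mA dA'.
rewrite !prod_update// in H0 H1.
rewrite !(@cylinder_split _ t a i)// big_cons.
set x0 := fine _ in H0 *; set x1 := fine (PM mu _) in H1 *.
set y0 := fine (PM nu _) in H0 *; set y1 := fine (PM nu _) in H1 *.
move: H0 H1.
have := wprod_ge0 nu t a; set be := \prod_(j <- t) _.
have := wprod_ge0 mu t a; set al := \prod_(j <- t) _ => al0 be0.
have M0 : 0 <= \prod_(j <- s) chi2_term j.
  by apply: prodr_ge0 => j _; rewrite addr_ge0// divr_ge0 ?sqr_ge0// ltW.
set M := \prod_(j <- s) _ in M0 *.
have := nu0 i false; have := nu0 i true; rewrite /chi2_term.
have := wt_ge0 mu i false; have := wt_ge0 mu i true.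
set w0 := wt mu i false; set w1 := wt mu i true; set v0 := wt nu i false; set v1 := wt nu i true.
move=> w1p w0p v1p v0p H0 H1.
have x0p : 0 <= x0 by exact: fine_ge0.
have x1p : 0 <= x1 by exact: fine_ge0.
have y0p : 0 <= y0 by exact: fine_ge0.
have y1p : 0 <= y1 by exact: fine_ge0.
pose k := M * al ^+ 2; have k0 : 0 <= k by rewrite mulr_ge0// sqr_ge0.
pose c0 := w0 ^+ 2 / v0; pose c1 := w1 ^+ 2 / v1.
have c0p : 0 <= c0 by rewrite divr_ge0 ?sqr_ge0// ltW.
have c1p : 0 <= c1 by rewrite divr_ge0 ?sqr_ge0// ltW.
have {}H0 : x0 ^+ 2 * be <= k * y0 * c0.
  rewrite /c0 mulrA ler_pdivlMr// /k; apply: le_trans (le_trans H0 _).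
    by rewrite le_eqVlt; apply/orP; left; apply/eqP; ring.
  by rewrite le_eqVlt; apply/orP; left; apply/eqP; ring.
have {}H1 : x1 ^+ 2 * be <= k * y1 * c1.
  rewrite /c1 mulrA ler_pdivlMr// /k; apply: le_trans (le_trans H1 _).
    by rewrite le_eqVlt; apply/orP; left; apply/eqP; ring.
  by rewrite le_eqVlt; apply/orP; left; apply/eqP; ring.
(* The cross term, by comparing squares: the arithmetic-geometric inequality for y0 c1 and y1 c0
   meets the product of [H0] and [H1]. *)
have H2 : 2 * x0 * x1 * be <= k * (y0 * c1 + y1 * c0).
  have S0 : 0 <= k * (y0 * c1 + y1 * c0) by rewrite mulr_ge0// addr_ge0// mulr_ge0.
  have L0 : 0 <= 2 * x0 * x1 * be by rewrite !mulr_ge0.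
  rewrite -ler_sqr ?nnegrE//.
  have := ler_pM (mulr_ge0 (sqr_ge0 x0) be0) (mulr_ge0 (sqr_ge0 x1) be0) H0 H1.
  have := sqr_ge0 (k * (y0 * c1 - y1 * c0)).
  have -> : (2 * x0 * x1 * be) ^+ 2 = 4 * (x0 ^+ 2 * be * (x1 ^+ 2 * be)) by ring.
  have -> : (k * (y0 * c1 + y1 * c0)) ^+ 2 =
    (k * (y0 * c1 - y1 * c0)) ^+ 2 + 4 * (k * y0 * c0 * (k * y1 * c1)) by ring.
  lra.
rewrite -/c0 -/c1.
have -> : (c0 + c1) * M * (y0 + y1) * al ^+ 2 =
  k * y0 * c0 + k * y1 * c1 + k * (y0 * c1 + y1 * c0) by rewrite /k; ring.
have -> : (x0 + x1) ^+ 2 * be = x0 ^+ 2 * be + x1 ^+ 2 * be + 2 * x0 * x1 * be by ring.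
lra.
Qed.

(** On a single cylinder, the measure of G is at most mu(C) and at most K nu(C), hence at most their
    geometric mean. Summing this over the values of a coordinate splits off its affinity. *)
Lemma hellinger_cylinder s t a (G : set (bits I)) (K : R) : uniq (s ++ t) ->
  measurable G -> 0 <= K ->
  (forall B, measurable B -> fine (PM mu (G `&` B)) <= K * fine (PM nu B)) ->
  fine (PM mu (G `&` cylinder t a)) <= (\prod_(i <- s) hellinger_term i) *
  Num.sqrt (K * (\prod_(j <- t) wt mu j (a j) * \prod_(j <- t) wt nu j (a j))).
Proof.
move=> + mG K0 GK; elim: s t a => [|i s IH] t a /= ust.
  rewrite big_nil mul1r.
  have mC := measurable_cylinder t a.
  have H1 := GK _ mC.
  have H2 : fine (PM mu (G `&` cylinder t a)) <= fine (PM mu (cylinder t a)).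
    apply: fine_le; rewrite ?fin_num_measure//; [exact: measurableI|].
    by apply: le_measure; rewrite ?inE//; exact: measurableI.
  rewrite !wt_cylinder// in H1 H2.
  have x0 : 0 <= fine (PM mu (G `&` cylinder t a)) by exact: fine_ge0.
  rewrite -(ger0_norm x0) -sqrtr_sqr ler_sqrt ?mulr_ge0 ?wprod_ge0//.
  by rewrite mulrCA expr2 ler_pM.
move: ust => /andP[ist ust].
have it : i \notin t by apply: contra ist => it; rewrite mem_cat it orbT.
have ust' : uniq (s ++ i :: t) by rewrite -cat1s uniq_catCA /= ist ust.
have H0 := IH (i :: t) (update a i false) ust'.
have H1 := IH (i :: t) (update a i true) ust'.
rewrite !prod_update// in H0 H1.
rewrite (@cylinder_split _ t a i)// big_cons /hellinger_term.
apply: le_trans (lerD H0 H1) _.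
set al := \prod_(j <- t) wt mu _ _; set be := \prod_(j <- t) wt nu _ _.
have e b : Num.sqrt (K * (wt mu i b * al * (wt nu i b * be))) =
    Num.sqrt (wt mu i b * wt nu i b) * Num.sqrt (K * (al * be)).
  rewrite -sqrtrM ?mulr_ge0 ?wt_ge0//; congr Num.sqrt; ring.
by rewrite !e le_eqVlt; apply/orP; left; apply/eqP; ring.
Qed.

Lemma hellinger_bound s (G : set (bits I)) (K : R) : uniq s ->
  measurable G -> 0 <= K ->
  (forall B, measurable B -> fine (PM mu (G `&` B)) <= K * fine (PM nu B)) ->
  fine (PM mu G) <= (\prod_(i <- s) hellinger_term i) * Num.sqrt K.
Proof.
move=> us mG K0 GK; have := @hellinger_cylinder s [::] point G K.
rewrite cats0 cylinder_nil setIT !big_nil !mulr1; exact.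
Qed.

(** One minus the affinity is half the sum of the squared differences of the square roots, and |p -
    p'| is at most twice the difference of the square roots of p and p'. *)
Lemma hellinger_term_le i :
  hellinger_term i <= 1 - (wt mu i false - wt nu i false) ^+ 2 / 8.
Proof.
have := wtD mu i; have := wtD nu i; have := wt_ge0 mu i false; have := wt_ge0 mu i true.
have := wt_ge0 nu i false; have := wt_ge0 nu i true; rewrite /hellinger_term.
set p := wt mu i false; set q := wt mu i true; set p' := wt nu i false; set q' := wt nu i true.
move=> q'0 p'0 q0 p0 pq' pq.
rewrite !sqrtrM//.
have := sqr_sqrtr p0; have := sqr_sqrtr q0; have := sqr_sqrtr p'0; have := sqr_sqrtr q'0.
have := sqrtr_ge0 p; have := sqrtr_ge0 q; have := sqrtr_ge0 p'; have := sqrtr_ge0 q'.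
set x := Num.sqrt p; set y := Num.sqrt q; set x' := Num.sqrt p'; set y' := Num.sqrt q'.
move=> y'0 x'0 y0 x0 y'q x'p yq xp.
rewrite -xp -x'p.
have x1 : x <= 1 by rewrite -(ler_sqr (R := R)) ?nnegrE// xp expr1n; lra.
have x'1 : x' <= 1 by rewrite -(ler_sqr (R := R)) ?nnegrE// x'p expr1n; lra.
have : (x ^+ 2 - x' ^+ 2) ^+ 2 <= 4 * (x - x') ^+ 2.
  have -> : (x ^+ 2 - x' ^+ 2) ^+ 2 = (x + x') ^+ 2 * (x - x') ^+ 2 by ring.
  apply: ler_wpM2r; first exact: sqr_ge0.
  rewrite (_ : 4 = 2 ^+ 2 :> R); last by rewrite -natrX.
  by rewrite ler_sqr ?nnegrE ?addr_ge0//; lra.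
have := sqr_ge0 (y - y').
have -> : (x - x') ^+ 2 = x ^+ 2 - 2 * (x * x') + x' ^+ 2 by ring.
have -> : (y - y') ^+ 2 = y ^+ 2 - 2 * (y * y') + y' ^+ 2 by ring.
rewrite xp x'p yq y'q.
lra.
Qed.

Lemma hellinger_term_ge0 i : 0 <= hellinger_term i.
Proof. by rewrite addr_ge0 ?sqrtr_ge0. Qed.

Lemma chi2_termE i :
  chi2_term i = 1 + (wt mu i false - wt nu i false) ^+ 2 / (wt nu i false * wt nu i true).
Proof.
rewrite /chi2_term; have := wtD mu i; have := wtD nu i.
have := nu0 i false; have := nu0 i true.
set p := wt mu i false; set q := wt mu i true; set p' := wt nu i false; set q' := wt nu i true.
move=> q'0 p'0 pq' pq.
have -> : q = 1 - p by lra.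
have e : q' = 1 - p' by lra.
rewrite e in q'0 *; field.
by rewrite !gt_eqF.
Qed.

(** The bound on finitely many coordinates passes to all sets by approximation in the sum of the two
    measures, so that one approximant serves both. *)
Lemma chi2_bound (M : R) : (forall s, uniq s -> \prod_(i <- s) chi2_term i <= M) ->
  forall A, measurable A -> fine (PM mu A) ^+ 2 <= M * fine (PM nu A).
Proof.
move=> HM.
have HB s B : uniq s -> measurable B -> depends_on (mem s) B ->
    fine (PM mu B) ^+ 2 <= M * fine (PM nu B).
  move=> us mB dB; have := @chi2_cylinder s [::] point B.
  rewrite cats0 cylinder_nil setIT !big_nil expr1n !mulr1.
  move=> /(_ us mB dB)/le_trans; apply; apply: ler_wpM2r; first exact: fine_ge0.
  exact: HM.
pose m := measure_add (PM mu) (PM nu).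
have mE B : m B = (PM mu B + PM nu B)%E by exact: measure_addE.
have moo : (m setT < +oo)%E.
  by rewrite mE lte_add_pinfty// -ge0_fin_numE// fin_num_measure.
move=> A mA; have HA := finite_coordinates_dense moo mA.
have M1 : 1 <= M by have := HM [::] isT; rewrite big_nil.
apply/ler_addgt0Pr => e e0.
(* Expanding the square costs at most 3 e', and replacing nu(B) by nu(A) costs M e'. *)
pose e' := Num.min 1 (e / (M + 3)).
have M3 : 0 < M + 3 by lra.
have e'0 : 0 < e' by rewrite lt_min ltr01 divr_gt0.
have e'1 : e' <= 1 by rewrite ge_min lexx.
have e'M : e' * (M + 3) <= e by rewrite -ler_pdivlMr// ge_min lexx orbT.
have [s [B [us mB dB]]] := HA e' e'0.
rewrite [X in (X < _)%E]mE => He.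
have mAB := measurableD mA mB; have mBA := measurableD mB mA.
have mY : measurable (A `+` B) by exact: measurableU.
have le1 (Q : probability (bits I) R) C : measurable C -> C `<=` A `+` B ->
    (Q (A `+` B) < e'%:E)%E -> fine (Q C) <= e'.
  move=> mC CAB Qe; rewrite -lee_fin fineK ?fin_num_measure//.
  by apply: le_trans (ltW Qe); apply: le_measure; rewrite ?inE.
have Qe1 : (PM mu (A `+` B) < e'%:E)%E.
  by apply: le_lt_trans He; rewrite leeDl.
have Qe2 : (PM nu (A `+` B) < e'%:E)%E.
  by apply: le_lt_trans He; rewrite leeDr.
have H1 : fine (PM mu A) <= fine (PM mu B) + e'.
  apply: le_trans (fine_measureD_le _ mA mB) _; rewrite lerD2l; apply: le1 => //.
  by move=> x ?; left.
have H2 : fine (PM nu B) <= fine (PM nu A) + e'.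
  apply: le_trans (fine_measureD_le _ mB mA) _; rewrite lerD2l; apply: le1 => //.
  by move=> x ?; right.
have H3 := HB s B us mB dB.
have B1 : fine (PM mu B) <= 1.
  by rewrite -lee_fin fineK ?fin_num_measure// probability_le1.
have B0 : 0 <= fine (PM mu B) by exact: fine_ge0.
have A0 : 0 <= fine (PM mu A) by exact: fine_ge0.
have H4 : fine (PM mu A) ^+ 2 <= (fine (PM mu B) + e') ^+ 2.
  by rewrite ler_sqr ?nnegrE ?addr_ge0// ltW.
apply: le_trans H4 _; rewrite sqrrD.
have H5 : M * fine (PM nu B) <= M * (fine (PM nu A) + e').
  by apply: ler_wpM2l => //; lra.
have H6 : fine (PM mu B) * e' <= e' by rewrite ler_piMl// ltW.
have H7 : e' ^+ 2 <= e' by rewrite expr2 ler_piMl// ltW.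
rewrite mulrDr in H5.
rewrite mulr2n; lra.
Qed.

Lemma chi2_dominates (M : R) : (forall s, uniq s -> \prod_(i <- s) chi2_term i <= M) ->
  PM mu `<< PM nu.
Proof.
move=> HM; apply/null_content_dominatesP => A mA A0.
have := chi2_bound HM mA; rewrite [X in _ * fine X]A0 mulr0 => H.
apply/eqP; rewrite -fine_eq0 ?fin_num_measure// -sqrf_eq0 eq_le H.
exact: sqr_ge0.
Qed.

End cylinder_induction.

(** * The sufficient half of Kakutani's criterion *)

Section equivalence_of_products.
Context (R : realType) (I : countType) (mu nu : I -> probability bool R).
Local Notation PM := infinite_product.

Lemma prod_le_expR (s : seq I) (c : I -> R) :
  (forall i, 0 <= c i) -> \prod_(i <- s) (1 + c i) <= expR (\sum_(i <- s) c i).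
Proof.
move=> c0; elim: s => [|i s IH]; first by rewrite !big_nil expR0.
rewrite !big_cons expRD ler_pM ?expR_ge1Dx ?addr_ge0//.
by apply: prodr_ge0 => j _; rewrite addr_ge0.
Qed.

(** The factors of the second moment are 1 + (p - p')^2 / (p' q'), and 1 + x <= exp x bounds their
    product. *)
Lemma kakutani_dominates (delta M : R) : 0 < delta ->
  (forall i b, 0 < wt nu i b) ->
  (forall i, delta <= wt nu i false * wt nu i true) ->
  (forall s, uniq s -> \sum_(i <- s) (wt mu i false - wt nu i false) ^+ 2 <= M) ->
  PM mu `<< PM nu.
Proof.
move=> d0 nu0 dnu HM; apply: (chi2_dominates nu0 (M := expR (M / delta))) => s us.
under eq_bigr do rewrite chi2_termE//.
apply: le_trans (prod_le_expR _ _) _.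
  by move=> i; rewrite divr_ge0 ?sqr_ge0// mulr_ge0// ltW.
rewrite ler_expR; apply: (@le_trans _ _ ((\sum_(i <- s) (wt mu i false - wt nu i false) ^+ 2) / delta)).
  rewrite mulr_suml; apply: ler_sum => i _; rewrite ler_wpM2l ?sqr_ge0//.
  by rewrite lef_pV2// posrE mulr_gt0.
by rewrite ler_pM2r ?invr_gt0// HM.
Qed.

End equivalence_of_products.

(** * Ergodicity of the Bernoulli shift, and nonatomicity *)

Section stationary_products.
Context (R : realType).
Implicit Types (nu : int -> probability bool R).
Local Notation PM := infinite_product.

Lemma iid_shift (l : probability bool R) k A : measurable A ->
  PM (fun _ : int => l) (shift k @^-1` A) = PM (fun _ : int => l) A.
Proof. by move=> mA; rewrite product_shift. Qed.

Lemma depends_on_shift (J : pred int) k (A : set (bits int)) : depends_on J A ->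
  depends_on (fun i => J (i - k)) (shift k @^-1` A).
Proof.
move=> dA x y xy; apply: (dA (shift k x) (shift k y)) => i Ji.
by apply: xy; rewrite addrK.
Qed.

Lemma shift_preimage_iter A n : bits_shift @^-1` A = A -> shift n%:Z @^-1` A = A.
Proof.
move=> iA; rewrite -iter_bits_shift; elim: n => // n IH.
by rewrite (_ : iter n.+1 _ @^-1` A = iter n bits_shift @^-1` (bits_shift @^-1` A))// iA.
Qed.

(** An invariant A is close to a set B of finitely many coordinates, and equally close to its far
    translates, which are independent of a given cylinder. So A is independent of all cylinders,
    hence of itself. *)
Lemma iid_ergodic (l : probability bool R) : ergodic (PM (fun _ : int => l)) bits_shift.
Proof.
set P := PM _ => A mA iA.
have indep s a : uniq s -> fine (P (A `&` cylinder s a)) = fine (P A) * fine (P (cylinder s a)).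
  move=> us; set C := cylinder s a.
  have mC : measurable C by exact: measurable_cylinder.
  apply/eqP; rewrite -subr_eq0 -normr_le0; apply/ler_addgt0Pl => e e0; rewrite addr0.
  have e2 : 0 < e / 2 by rewrite divr_gt0.
  have [t [B [ut mB dB HB]]] := finite_coordinates_dense (m := P) (fin_num_fun_lty (fin_num_measure P)) mA e2.
  pose n := (\max_(i <- s ++ t) `|i|)%N.
  have bn i : i \in s ++ t -> (`|i| <= n)%N by move=> ist; exact: leq_bigmax_seq.
  (* All indices in s and t are at most n in absolute value, so this shift separates the two
     lists. *)
  pose N := (n + n).+1.
  have mTB : measurable (shift N%:Z @^-1` B) by exact: measurable_pre (measurable_shift _) mB.
  have mTA : measurable (shift N%:Z @^-1` A) by exact: measurable_pre (measurable_shift _) mA.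
  have ind : P (C `&` shift N%:Z @^-1` B) = (P C * P B)%E.
    rewrite (@product_indep _ _ _ (mem s))//; first by rewrite [X in (_ * X)%E]iid_shift.
      exact: depends_on_cylinder.
    apply: depends_onS (depends_on_shift (k := N%:Z) dB) => i it.
    have {}it : i - N%:Z \in t by exact: it.
    apply/negP => /= is_.
    have := bn i; rewrite mem_cat is_ => /(_ isT) H1.
    have := bn (i - N%:Z); rewrite mem_cat it orbT => /(_ isT) H2.
    move: H1 H2; rewrite /N; lia.
  have mABC : measurable (A `&` C) by exact: measurableI.
  have mTBC : measurable (C `&` shift N%:Z @^-1` B) by exact: measurableI.
  have TA : shift N%:Z @^-1` A = A by exact: shift_preimage_iter.
  have small D : measurable D -> D `<=` A `+` B -> fine (P (shift N%:Z @^-1` D)) <= e / 2.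
    move=> mD DAB; rewrite [X in fine X]iid_shift// -lee_fin fineK ?fin_num_measure//.
    apply: le_trans (ltW HB); apply: le_measure; rewrite ?inE//.
    by apply: measurableU; exact: measurableD.
  have small' D D' : measurable D -> measurable D' -> D' `<=` shift N%:Z @^-1` D ->
      D `<=` A `+` B -> fine (P D') <= e / 2.
    move=> mD mD' DD DAB; apply: le_trans (small D mD DAB).
    apply: fine_le; rewrite ?fin_num_measure//; first exact: measurable_pre (measurable_shift _) mD.
    apply: le_measure; rewrite ?inE//; exact: measurable_pre (measurable_shift _) mD.
  have mAB := measurableD mA mB; have mBA := measurableD mB mA.
  have H1 := fine_measureD_le P mABC mTBC.
  have H2 := fine_measureD_le P mTBC mABC.
  have H3 := fine_measureD_le P mA mB.
  have H4 := fine_measureD_le P mB mA.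
  have S1 : fine (P (A `&` C `\` (C `&` shift N%:Z @^-1` B))) <= e / 2.
    apply: small' mAB (measurableD mABC mTBC) _ _; last by move=> x; left.
    by move=> x; rewrite -{1}TA /=; tauto.
  have S2 : fine (P ((C `&` shift N%:Z @^-1` B) `\` (A `&` C))) <= e / 2.
    apply: small' mBA (measurableD mTBC mABC) _ _; last by move=> x; right.
    by move=> x; rewrite -{1}TA /=; tauto.
  have S3 : fine (P (A `\` B)) <= e / 2.
    rewrite -lee_fin fineK ?fin_num_measure//; apply: le_trans (ltW HB).
    apply: le_measure; rewrite ?inE//; last by move=> x; left.
    exact: measurableU.
  have S4 : fine (P (B `\` A)) <= e / 2.
    rewrite -lee_fin fineK ?fin_num_measure//; apply: le_trans (ltW HB).
    apply: le_measure; rewrite ?inE//; last by move=> x; right.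
    exact: measurableU.
  move: H1 H2; rewrite [P (C `&` _)]ind fineM ?fin_num_measure// => H1 H2.
  have C0 : 0 <= fine (P C) by exact: fine_ge0.
  have C1 : fine (P C) <= 1 by rewrite -lee_fin fineK ?fin_num_measure// probability_le1.
  rewrite ler_norml; apply/andP; split; nra.
(* Independence from cylinders says that the restriction of P to A and P(A) times P agree;
   evaluation at A gives P(A) = P(A)^2. *)
pose m1 := mrestr_measure P mA.
have : fine (P A) = fine (P A) * fine (P A).
  have Pr : 0 <= fine (P A) by exact: fine_ge0.
  pose m2 := mscale_measure (NngNum Pr) P.
  suff : m1 A = m2 A.
    rewrite /m1 /m2 /= /mrestr /mscale/= setIid => /(congr1 fine).
    by rewrite fineM ?fin_num_measure.
  apply: (@bits_measure_unique _ _ m1 m2) => //.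
    by rewrite /m1 /= /mrestr setTI; rewrite -ge0_fin_numE//; exact: fin_num_measure.
  move=> s a us; rewrite /m1 /m2 /= /mrestr /mscale/= setIC.
  have mC := measurable_cylinder s a.
  have mAC := measurableI _ _ mA mC.
  rewrite -[LHS]fineK ?fin_num_measure// (indep s a us) EFinM fineK ?fin_num_measure//.
  by congr (_ * _)%E; rewrite fineK// fin_num_measure.
have : fine (P A) + fine (P (~` A)) = 1.
  by rewrite [P (~` A)]probability_setC// fineB ?fin_num_measure//= addrC subrK.
have fz D : measurable D -> fine (P D) = 0 -> P D = 0%E.
  by move=> mD D0; rewrite -[LHS]fineK ?fin_num_measure// D0.
move=> H1 H2; have : fine (P A) * (1 - fine (P A)) == 0 by rewrite mulrBr mulr1 -H2 subrr.
rewrite mulf_eq0 => /orP[/eqP H|/eqP H].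
  by left; apply: fz.
by right; apply: fz; [exact: measurableC|lra].
Qed.

Definition distribution_on_past nu := forall i b, i <= 0 -> wt nu i b = wt nu 0 b.

(** On a set that no coordinate divides into two non-null parts, each coordinate is almost surely
    constant. The coordinates 0, -1, ..., -(n - 1) are identically distributed and nondegenerate, so
    the set has measure at most c^n for every n. *)
Lemma product_nonatomic nu : distribution_on_past nu -> (forall b, 0 < wt nu 0 b) ->
  nonatomic (PM nu).
Proof.
move=> past nu0 A mA PA.
have [[i [b PAb]]|H] := pselect (exists i b, (0 < PM nu (A `&` [set x | x i = b]))%E /\
    (0 < PM nu (A `\` [set x | x i = b]))%E).
  exists (A `&` [set x | x i = b]); split.
  - by apply: measurableI => //; exact: measurable_coord_eq.
  - by move=> x [].
  - by case: PAb.
  - by rewrite setDIr setDv set0U; case: PAb.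
exfalso.
have mAi i b : measurable (A `&` [set x | x i = b]).
  by apply: measurableI => //; exact: measurable_coord_eq.
have mDi i b : measurable (A `\` [set x | x i = b]).
  by apply: measurableD => //; exact: measurable_coord_eq.
have /choice[a Ha] : forall i, exists b, PM nu (A `\` [set x | x i = b]) = 0%E.
  move=> i; apply: contrapT => /forallNP Hi; apply: H; exists i, true.
  have pos b : (0 < PM nu (A `\` [set x | x i = b]))%E.
    by rewrite lt_neqAle measure_ge0 andbT eq_sym; apply/eqP; exact: Hi.
  split => //; have -> : A `&` [set x | x i = true] = A `\` [set x | x i = false] => //.
  by apply/seteqP; split => x [Ax] /=; case: (x i).
pose c := Num.max (wt nu 0 false) (wt nu 0 true).
have c0 : 0 <= c by rewrite le_max !wt_ge0.
have c1 : c < 1.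
  have := wtD nu 0; have := nu0 false; have := nu0 true.
  by rewrite /c gt_max => ? ? ?; apply/andP; split; lra.
have Ple n : fine (PM nu A) <= c ^+ n.
  pose s := [seq - k%:Z | k <- iota 0 n].
  have us : uniq s by rewrite map_inj_uniq ?iota_uniq// => k l /oppr_inj [].
  have mC := measurable_cylinder s a.
  have PAC : PM nu A = PM nu (A `&` cylinder s a).
    apply/eqP; rewrite eq_le; apply/andP; split; last first.
      by apply: le_measure; rewrite ?inE//; exact: measurableI.
    have U0 : PM nu (\bigcup_k (A `\` [set x | x (- k%:Z) = a (- k%:Z)])) = 0%E.
      by apply: null_bigcup => k; [exact: mDi|exact: Ha].
    rewrite -[leRHS]adde0 -[X in (_ + X)%E]U0.
    apply: le_trans (measureU2 (PM nu) (measurableI _ _ mA mC) (bigcupT_measurable _ (fun k => mDi _ _))).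
    apply: le_measure; rewrite ?inE//.
      apply: measurableU; first exact: measurableI.
      by apply: bigcupT_measurable.
    move=> x Ax; have [Cx|Cx] := pselect (cylinder s a x); [by left|right].
    have /existsNP[i /not_implyP[is_ xi]] : ~ forall i, i \in s -> x i = a i by [].
    by move: is_ xi => /mapP[k _ ->] xk; exists k.
  rewrite PAC; apply: (@le_trans _ _ (fine (PM nu (cylinder s a)))).
    apply: fine_le; rewrite ?fin_num_measure//; first exact: measurableI.
    by apply: le_measure; rewrite ?inE//; exact: measurableI.
  rewrite wt_cylinder// big_map.
  apply: (@le_trans _ _ (\prod_(k <- iota 0 n) c)).
    apply: ler_prod => k _; rewrite wt_ge0/= past; last by rewrite oppr_le0.
    by rewrite /c le_max; case: (a _); rewrite lexx ?orbT.
  by rewrite big_const_seq count_predT size_iota -Monoid.iteropE exprnP /= -exprnP.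
have : fine (PM nu A) <= 0.
  apply/ler_addgt0Pl => e e0; rewrite addr0.
  have : `|c| < 1 by rewrite ger0_norm.
  move=> /cvg_expr /cvgrPdist_lt/(_ e e0)[n _ /(_ n (leqnn n))].
  by rewrite sub0r normrN ger0_norm ?exprn_ge0// => /ltW; exact: le_trans (Ple n).
by rewrite leNgt fine_gt0// PA (le_lt_trans (probability_le1 _ _))// ltry.
Qed.

End stationary_products.

(** * The square-summable case *)

Section two_sided_products.
Context (R : realType) (mu : nat -> probability bool R).
Hypothesis hmu : forall n, (1 <= n)%N -> 0 < fine (mu n [set false]) < 1.
Local Notation PM := infinite_product.
Local Notation nu := (two_sided mu).
Local Notation p n := (fine (mu n [set false])).

Lemma two_sided_past : distribution_on_past nu.
Proof. by case => [[|n]|n] b //. Qed.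

Lemma wt_two_sidedS n b : wt nu n.+1%:Z b = fine (mu n.+1 [set b]).
Proof. by []. Qed.

Lemma wt_two_sided0 b : wt nu 0 b = fine (mu 1%N [set b]).
Proof. by []. Qed.

Lemma two_sided_ex i : exists2 n, (1 <= n)%N & nu i = mu n.
Proof. by case: i => [[|n]|n]; [exists 1%N|exists n.+1|exists 1%N]. Qed.

Lemma two_sided_wt_gt0 i b : 0 < wt nu i b.
Proof.
have [n n1 e] := two_sided_ex i; have := wtD nu i; have := hmu n1.
by rewrite /wt -e; case: b; lra.
Qed.

Lemma mu1_wt_gt0 b : 0 < fine (mu 1%N [set b]).
Proof. by rewrite -wt_two_sided0 two_sided_wt_gt0. Qed.

Let d2 n : R := (p n - p 1) ^+ 2.

Lemma two_sided_sq_sum (s : seq int) (S : R) : uniq s ->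
  (forall N, \sum_(k < N) d2 k.+1 <= S) ->
  \sum_(i <- s) (wt nu i false - p 1) ^+ 2 <= S.
Proof.
move=> us HS.
pose N := (\max_(i <- s) `|i|)%N.
pose L := [seq Posz k.+1 | k <- iota 0 N].
have uL : uniq L by rewrite map_inj_uniq ?iota_uniq// => a b [].
apply: le_trans (HS N).
have -> : \sum_(k < N) d2 k.+1 = \sum_(i <- L) (wt nu i false - p 1) ^+ 2.
  by rewrite big_map -(big_mkord xpredT (fun k => d2 k.+1)) /index_iota subn0.
rewrite (bigID (mem L))/= [X in _ + X]big1_seq ?addr0; last first.
  move=> i /andP[iL is_]; have iN : (`|i| <= N)%N by exact: leq_bigmax_seq.
  case: i iL is_ iN => [[|n]|n] iL is_ iN; rewrite /wt/= ?subrr ?expr0n//.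
  case/negP: iL; apply/mapP; exists n => //; rewrite mem_iota/= add0n; exact: iN.
rewrite -big_filter (perm_big [seq i <- L | i \in s]); last first.
  apply: uniq_perm; rewrite ?filter_uniq// => i.
  by rewrite !mem_filter andbC.
rewrite big_filter [leRHS](bigID (mem s))/= lerDl.
by apply: sumr_ge0 => i _; exact: sqr_ge0.
Qed.

Hypothesis sum_fin : (\sum_(1 <= n <oo) (d2 n)%:E < +oo)%E.

Let S := fine (\sum_(1 <= n <oo) (d2 n)%:E)%E.

Let partial_le N : \sum_(k < N) d2 k.+1 <= S.
Proof.
have d20 n : (0 <= (d2 n)%:E)%E by rewrite lee_fin sqr_ge0.
have Sfin : (\sum_(1 <= n <oo) (d2 n)%:E)%E \is a fin_num.
  by rewrite ge0_fin_numE// nneseries_ge0.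
rewrite -lee_fin fineK// -sumEFin.
rewrite -(big_mkord xpredT (fun k => (d2 k.+1)%:E)).
have := @nneseries_lim_ge R (fun n => (d2 n)%:E) xpredT 1 N.+1 (fun n _ _ => d20 n).
by rewrite big_add1.
Qed.

Let d2_cvg0 : d2 n.+1 @[n --> \oo] --> (0 : R).
Proof.
apply: cvg_series_cvg_0; apply: nondecreasing_is_cvgn.
  by apply: nondecreasing_series => n _ _; exact: sqr_ge0.
exists S => _ [n _ <-]; rewrite /series/= big_mkord; exact: partial_le.
Qed.

(** The terms of a convergent series tend to 0, so mu_n(0) tends to mu_1(0); the finitely many
    exceptions are covered by a minimum. *)
Lemma two_sided_wt_lower : exists2 delta, 0 < delta &
  forall i, delta <= wt nu i false * wt nu i true.
Proof.
have := mu1_wt_gt0 false; have := mu1_wt_gt0 true.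
have := wtD nu 0; rewrite !wt_two_sided0; set p1 := p 1; set q1 := fine _ => pq q10 p10.
(* Within distance c of mu_1(0) both weights keep at least half their value, whence the bound p1 q1
   / 4. *)
pose c := Num.min p1 q1 / 2.
have c0 : 0 < c by rewrite divr_gt0// lt_min p10.
have cp : c <= p1 / 2 by rewrite ler_pM2r// ge_min lexx.
have cq : c <= q1 / 2 by rewrite ler_pM2r// ge_min lexx orbT.
have /cvgrPdist_lt/(_ _ (exprn_gt0 2 c0))[N _ HN] := d2_cvg0.
have [dl dl0 Hdl] : exists2 dl, 0 < dl & forall k, (k < N)%N ->
    dl <= wt nu k.+1%:Z false * wt nu k.+1%:Z true.
  elim: N {HN} => [|N [dl dl0 Hdl]]; first by exists 1.
  exists (Num.min dl (wt nu N.+1%:Z false * wt nu N.+1%:Z true)).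
    by rewrite lt_min dl0 mulr_gt0// two_sided_wt_gt0.
  move=> k; rewrite ltnS leq_eqVlt => /predU1P[->|/Hdl].
    by rewrite ge_min lexx orbT.
  by apply: le_trans; rewrite ge_min lexx.
pose dl' := Num.min dl (p1 * q1 / 4).
have pq0 : 0 < p1 * q1 by rewrite mulr_gt0.
exists dl'; first by rewrite lt_min dl0 divr_gt0.
have past i : i <= 0 -> dl' <= wt nu i false * wt nu i true.
  move=> i0; rewrite !two_sided_past// !wt_two_sided0 -/p1 -/q1.
  by rewrite ge_min; apply/orP; right; lra.
case=> [[|k]|k]; [exact: past| |exact: past].
have [/Hdl|Nk] := ltnP k N; first by apply: le_trans; rewrite ge_min lexx.
have := HN k Nk; rewrite sub0r normrN ger0_norm ?sqr_ge0// /d2.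
have := wtD nu k.+1%:Z; rewrite !wt_two_sidedS -/p1; set pk := p k.+1; set qk := fine _ => pqk.
move=> Hc; have : `|pk - p1| < c.
  by rewrite -ltr_sqr ?nnegrE ?(ltW c0)// real_normK ?num_real.
rewrite ltr_norml => /andP[H1 H2].
rewrite ge_min; apply/orP; right; nra.
Qed.

Lemma square_summable_equivalent :
  equivalent_measure (PM nu) (PM (fun _ : int => mu 1%N)).
Proof.
have [delta d0 Hd] := two_sided_wt_lower.
have Hsum s : uniq s -> \sum_(i <- s) (wt nu i false - p 1) ^+ 2 <= S.
  by move=> us; apply: two_sided_sq_sum => //; exact: partial_le.
split.
  apply: (@kakutani_dominates _ _ _ _ (p 1 * fine (mu 1%N [set true])) S) => //.
    by apply: mulr_gt0; exact: mu1_wt_gt0.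
  by move=> i b; exact: mu1_wt_gt0.
apply: (@kakutani_dominates _ _ _ _ delta S) => //.
  exact: two_sided_wt_gt0.
move=> s us; under eq_bigr do rewrite -sqrrN opprB.
exact: Hsum.
Qed.

Lemma square_summable_type_II1 :
  nonsingular (PM nu) bits_shift -> type_II1 (PM nu) bits_shift.
Proof.
move=> hT; have [d1 d2'] := square_summable_equivalent.
split => //.
- move=> A mA iA; have [A0|A0] := iid_ergodic (mu 1%N) mA iA; [left|right].
    by move/null_content_dominatesP : d1; exact.
  by move/null_content_dominatesP : d1; apply => //; exact: measurableC.
- by apply: product_nonatomic; [exact: two_sided_past|exact: two_sided_wt_gt0].
- exists (PM (fun _ : int => mu 1%N)); split => //.
  move=> A mA; rewrite -[bits_shift]/(shift 1); exact: iid_shift.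
Qed.

End two_sided_products.

(** * Divergence of the sum over small terms *)

Section small_jumps.
Context (R : realType).

(* If d has small steps and is frequently small, then it is either eventually
   small or infinitely often between eps / 2 and eps. *)
Lemma small_jumps_diverge (d : nat -> R) :
  (forall M, exists N, M <= \sum_(k < N) d k ^+ 2) ->
  (forall eps, 0 < eps -> exists N, forall n, (N <= n)%N -> `|d n.+1 - d n| < eps) ->
  (forall eps N, 0 < eps -> exists2 n, (N <= n)%N & `|d n| < eps) ->
  forall eps n M, 0 < eps -> exists k,
    M <= \sum_(j < k) (if `|d (n + j)%N| <= eps then d (n + j)%N ^+ 2 else 0).
Proof.
move=> D1 D2 D3 eps n M eps0.
pose g k : R := if `|d k| <= eps then d k ^+ 2 else 0.
have g0 k : 0 <= g k by rewrite /g; case: ifP; rewrite ?sqr_ge0.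
have gmono N N' : (N <= N')%N -> \sum_(k < N) g k <= \sum_(k < N') g k.
  move=> NN; rewrite -!(big_mkord xpredT g) (big_cat_nat (n := N) (p := N'))//= lerDl.
  exact: sumr_ge0.
suff div K : exists N, K <= \sum_(k < N) g k.
  have [N HN] := div (M + \sum_(k < n) g k).
  exists N; have := le_trans HN (gmono _ _ (leq_addl n N)).
  have -> : \sum_(k < n + N) g k = \sum_(k < n) g k + \sum_(j < N) g (n + j)%N.
    by rewrite big_split_ord.
  by rewrite addrC lerD2l.
have [[N0 HN0]|H] := pselect (exists N0, forall k, (N0 <= k)%N -> `|d k| <= eps).
  have [N HN] := D1 (K + \sum_(k < N0) d k ^+ 2).
  exists (N0 + N)%N.
  have : \sum_(k < N) d k ^+ 2 <= \sum_(k < N0 + N) d k ^+ 2.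
    rewrite -!(big_mkord xpredT (fun k => d k ^+ 2)) (big_cat_nat (n := N) (p := (N0 + N)%N))//= ?leq_addl// lerDl.
    by apply: sumr_ge0 => *; exact: sqr_ge0.
  move=> /(le_trans HN).
  have -> : \sum_(k < N0 + N) d k ^+ 2 =
      \sum_(k < N0) d k ^+ 2 + \sum_(j < N) d (N0 + j)%N ^+ 2.
    by rewrite big_split_ord.
  rewrite addrC lerD2l big_split_ord/= => /le_trans; apply.
  apply: (@le_trans _ _ (\sum_(i < N) g (N0 + i)%N)).
    by apply: ler_sum => i _; rewrite /g HN0// leq_addr.
  by rewrite lerDr; exact: sumr_ge0.
have eps2 : 0 < eps / 2 by rewrite divr_gt0.
(* Start at a late time with |d| < eps / 2. As eps is exceeded later on, there is a first time with
   |d| >= eps / 2, and there a step shorter than eps / 2 cannot have passed eps. *)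
have mid N : exists2 m, (N <= m)%N & eps / 2 <= `|d m| <= eps.
  have [N1 HN1] := D2 _ eps2.
  have [n0 Nn0 dn0] := D3 _ (maxn N N1) eps2.
  have [n1 [n01 dn1]] : exists n1, (n0 <= n1)%N /\ eps < `|d n1|.
    apply: contrapT => /forallNP H'; apply: H; exists n0 => k nk.
    by rewrite leNgt; apply/negP => Hk; apply: (H' k).
  have ex : exists m, (n0 <= m)%N && (eps / 2 <= `|d m|).
    by exists n1; rewrite n01/=; lra.
  case: (ex_minnP ex) => m /andP[nm dm] mmin.
  exists m; first by rewrite (leq_trans _ nm)// (leq_trans _ Nn0)// leq_maxl.
  rewrite dm/=; case: m nm dm mmin => [|m] nm dm mmin.
    have n00 : n0 = 0%N by apply/eqP; rewrite -leqn0.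
    by rewrite n00 in dn0; move: dm; rewrite leNgt dn0.
  have nm' : (n0 <= m)%N.
    move: nm; rewrite leq_eqVlt => /predU1P[e|//].
    by rewrite e in dn0; move: dm; rewrite leNgt dn0.
  have dm' : `|d m| < eps / 2.
    rewrite ltNge; apply/negP => dm'.
    by have := mmin m; rewrite nm' dm' => /(_ isT); rewrite ltnn.
  have := HN1 m (leq_trans (leq_maxr N N1) (leq_trans Nn0 nm')).
  have := ler_normD (d m.+1 - d m) (d m); rewrite subrK; lra.
have main k : exists N, k%:R * (eps / 2) ^+ 2 <= \sum_(j < N) g j.
  elim: k => [|k [N HN]]; first by exists 0; rewrite mul0r big_ord0.
  have [m Nm /andP[m1 m2]] := mid N; exists m.+1.
  rewrite big_ord_recr/= -natr1 mulrDl mul1r lerD//.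
    by rewrite (le_trans HN)// gmono.
  rewrite /g m2 -[d m ^+ 2]real_normK ?num_real// ler_sqr ?nnegrE//; exact: ltW.
have e0 : 0 < (eps / 2) ^+ 2 by rewrite exprn_gt0.
have [N HN] := main (Num.truncn (K / (eps / 2) ^+ 2)).+1.
exists N; apply: le_trans HN; rewrite -ler_pdivrMr//.
exact/ltW/truncnS_gt.
Qed.

Lemma nneseries_le (u : nat -> \bar R) (M : R) m : (forall n, (0 <= u n)%E) ->
  (forall N, (\sum_(m <= n < N) u n <= M%:E)%E) -> (\sum_(m <= n <oo) u n <= M%:E)%E.
Proof.
move=> u0 uM; apply: lime_le; last exact: nearW.
by apply: is_cvg_nneseries => *; exact: u0.
Qed.

Lemma nneseries_pinfty_unbounded (u : nat -> R) (M : R) :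
  (forall n, 0 <= u n) -> (\sum_(1 <= n <oo) (u n)%:E = +oo)%E ->
  exists N, M <= \sum_(k < N) u k.+1.
Proof.
move=> u0 uoo; apply: contrapT => /forallNP H.
suff : (\sum_(1 <= n <oo) (u n)%:E <= M%:E)%E by rewrite uoo leye_eq.
apply: nneseries_le => [n|[|N]]; first by rewrite lee_fin.
  rewrite big_geq// lee_fin; have := H 0%N; rewrite big_ord0 => /negP.
  by rewrite -ltNge => /ltW.
rewrite sumEFin lee_fin big_add1/= big_mkord.
by have /negP := H N; rewrite -ltNge => /ltW.
Qed.

End small_jumps.

(** * Densities between product measures and Hellinger affinities *)

Section likelihood.
Context (R : realType) (I : countType) (mu nu : I -> probability bool R).
Local Notation PM := infinite_product.
Variable w : bits I -> posreal R.
Hypothesis mw : measurable_fun setT w.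
Hypothesis wE : forall B, measurable B -> PM nu B = (\int[PM mu]_(x in B) (w x)%:num%:E)%E.

Lemma measurable_density_ge (c : R) : measurable [set x | c <= (w x)%:num].
Proof.
rewrite (_ : [set x | _] = w @^-1` [set t : posreal R | c <= t%:num]).
  by apply: measurable_pre => //; exact: measurable_ge.
by apply/seteqP; split.
Qed.

(* A density of nu bounded below on a set bounds its measure by the Hellinger
   affinities of the coordinates. *)
Lemma density_hellinger (s : seq I) (c : R) : uniq s -> 0 < c ->
  fine (PM mu [set x | c <= (w x)%:num]) <=
  (\prod_(i <- s) hellinger_term mu nu i) * Num.sqrt c^-1.
Proof.
move=> us c0; have mG := measurable_density_ge c.
apply: hellinger_bound => //; first by rewrite invr_ge0 ltW.
move=> B mB; set G := [set x | _] in mG *.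
have mGB : measurable (G `&` B) by exact: measurableI.
have mwE : measurable_fun setT (fun x => (w x)%:num%:E).
  by apply/measurable_EFinP; exact: measurable_num_comp.
rewrite mulrC ler_pdivlMr// mulrC -lee_fin EFinM !fineK ?fin_num_measure//.
rewrite wE// -integral_cst//.
apply: (@le_trans _ _ (\int[PM mu]_(x in G `&` B) (w x)%:num%:E)%E).
  apply: ge0_le_integral => //; last 2 first.
  - exact: measurable_funTS.
  - by move=> x [Gx _].
  - by move=> *; rewrite lee_fin ltW.
apply: ge0_subset_integral => //; exact: measurable_funTS.
Qed.

(** The density is positive, so it is at least 1 / (n + 1) on a set of positive measure for some n;
    [density_hellinger] at this level bounds every finite product of affinities from below. *)
Lemma hellinger_lower : exists2 c, 0 < c &
  forall s, uniq s -> c <= \prod_(i <- s) hellinger_term mu nu i.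
Proof.
pose G n := [set x | n.+1%:R^-1 <= (w x)%:num].
have mG n : measurable (G n) by exact: measurable_density_ge.
have [n Gn] : exists n, PM mu (G n) != 0%E.
  apply: contrapT => /forallNP H.
  have : PM mu (\bigcup_n G n) = 0%E.
    by apply: null_bigcup => // n; apply/eqP/negPn/negP; exact: H.
  rewrite (_ : \bigcup_n G n = setT).
    by rewrite probability_setT => /eqP; rewrite onee_eq0.
  apply/seteqP; split => // x _; exists (Num.truncn ((w x)%:num^-1)) => //=.
  rewrite /G/= -[leRHS]invrK lef_pV2 ?posrE ?invr_gt0//.
  exact/ltW/truncnS_gt.
have r0 : 0 < Num.sqrt (n.+1%:R^-1)^-1 :> R by rewrite sqrtr_gt0 !invr_gt0 ?invrK.
exists (fine (PM mu (G n)) / Num.sqrt (n.+1%:R^-1)^-1).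
  rewrite divr_gt0// fine_gt0// lt0e Gn measure_ge0/=.
  by rewrite (le_lt_trans (probability_le1 _ _))// ltry.
move=> s us; rewrite ler_pdivrMr//; exact: density_hellinger.
Qed.

End likelihood.

(** * What nonsingularity and conservativity say about the weights *)

Section two_sided_jumps.
Context (R : realType) (mu : nat -> probability bool R).
Hypothesis hmu : forall n, (1 <= n)%N -> 0 < fine (mu n [set false]) < 1.
Local Notation PM := infinite_product.
Local Notation nu := (two_sided mu).
Hypothesis hT : nonsingular (PM nu) bits_shift.

Let d n : R := fine (mu n.+1 [set false]) - fine (mu 1%N [set false]).

Lemma shift_image n A : iter n bits_shift @` A = shift (- n%:Z) @^-1` A.
Proof.
rewrite iter_bits_shift; apply: image_can_pre => x; apply/funext => i;
  by rewrite /shift; congr x; ring.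
Qed.

Lemma product_shift_image n A : measurable A ->
  PM nu (iter n bits_shift @` A) = PM (fun i => nu (i - n%:Z)) A.
Proof. by move=> mA; rewrite shift_image product_shift. Qed.

Lemma shift_rn_derivative n :
  is_rn_derivative (PM nu) (iter n bits_shift)
    (cocycle bits_shift (rn_derivative (PM nu) bits_shift) n).
Proof.
by apply: cocycle_rn_derivative; [case: hT|exact: rn_derivative_finite].
Qed.

Let coc_density n B : measurable B -> PM (fun i => nu (i - n%:Z)) B =
  (\int[PM nu]_(x in B) (cocycle bits_shift (rn_derivative (PM nu) bits_shift) n x)%:num%:E)%E.
Proof.
by move=> mB; rewrite -product_shift_image//; case: (shift_rn_derivative n) => _ ->.
Qed.

Let p01 n : 0 <= fine (mu n.+1 [set false]) <= 1.
Proof. by have /andP[/ltW -> /ltW ->] := @hmu n.+1 isT. Qed.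

Lemma hellinger_power (l1 l2 : int -> probability bool R) (s : seq int) eps :
  0 <= eps -> (forall i, i \in s -> eps <= `|wt l1 i false - wt l2 i false|) ->
  \prod_(i <- s) hellinger_term l1 l2 i <= (1 - eps ^+ 2 / 8) ^+ size s.
Proof.
move=> eps0; elim: s => [|i s IH] Hs; first by rewrite big_nil expr0.
have {}IH : \prod_(j <- s) hellinger_term l1 l2 j <= (1 - eps ^+ 2 / 8) ^+ size s.
  by apply: IH => j js; apply: Hs; rewrite inE js orbT.
rewrite big_cons /= exprS ler_pM ?hellinger_term_ge0//.
  by apply: prodr_ge0 => *; exact: hellinger_term_ge0.
apply: le_trans (hellinger_term_le _ _ _) _.
rewrite lerD2l lerN2 ler_pM2r ?invr_gt0// -[leRHS]real_normK ?num_real//.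
by rewrite ler_sqr ?nnegrE// Hs// mem_head.
Qed.

(** The shifted measure has a positive density, so finite products of affinities are bounded below,
    while each step of size at least eps contributes a factor at most 1 - eps^2 / 8. *)
Lemma nonsingular_small_steps eps : 0 < eps ->
  exists N, forall n, (N <= n)%N -> `|d n.+1 - d n| < eps.
Proof.
move=> eps0; apply: contrapT => /forallNP H.
have {}H N : exists2 n, (N <= n)%N & eps <= `|d n.+1 - d n|.
  by have /existsNP[n /not_implyP[Nn /negP]] := H N; rewrite -leNgt; exists n.
have [c c0 Hc] := hellinger_lower (measurable_cocycle 1 (measurable_shift 1)
  (rn_derivative_finite hT).1) (@coc_density 1).
have Hseq m : exists s : seq nat, [/\ uniq s, size s = m &
    forall k, k \in s -> eps <= `|d k.+1 - d k|].
  elim: m => [|m [s [us ss Hs]]]; first by exists [::].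
  have [n sn dn] := H (\max_(k <- s) k).+1.
  exists (n :: s); split => /=; last first.
  - by move=> k; rewrite inE => /orP[/eqP ->//|]; exact: Hs.
  - by rewrite ss.
  rewrite us andbT; apply/negP => ns.
  by move: sn; rewrite ltnNge (@leq_bigmax_seq _ _ xpredT id).
have eps1 : eps <= 1.
  have [n _ dn] := H 0%N; apply: (le_trans dn).
  have := p01 n.+1; have := p01 n; rewrite /d ler_norml.
  by move=> /andP[? ?] /andP[? ?]; apply/andP; lra.
pose th := 1 - eps ^+ 2 / 8.
have th0 : 0 <= th.
  have : eps ^+ 2 <= 1 by rewrite exprn_ile1// ltW.
  rewrite /th; lra.
have th1 : th < 1 by rewrite /th ltrBlDr ltrDl divr_gt0// exprn_gt0.
have : c <= 0.
  apply/ler_addgt0Pl => e e0; rewrite addr0.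
  have : `|th| < 1 by rewrite ger0_norm.
  move=> /cvg_expr /cvgrPdist_lt/(_ e e0)[m _ /(_ m (leqnn m))].
  rewrite sub0r normrN ger0_norm ?exprn_ge0// => /ltW; apply: le_trans.
  have [s [us ss Hs]] := Hseq m.
  (* At index k + 2 the shifted law is mu_(k+1) and the original one mu_(k+2), so the weights differ
     by d (k + 1) - d k in absolute value. *)
  pose t := [seq Posz k.+2 | k <- s].
  have ut : uniq t by rewrite map_inj_uniq// => a b [].
  apply: le_trans (Hc t ut) _; rewrite -ss -(size_map (fun k => Posz k.+2)).
  apply: hellinger_power; first exact: ltW.
  move=> i /mapP[k ks ->]; apply: le_trans (Hs k ks) _.
  rewrite (_ : wt (fun i => nu (i - 1%:Z)) k.+2%:Z false = wt nu k.+1%:Z false).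
    by rewrite !wt_two_sidedS /d; rewrite le_eqVlt; apply/orP; left; apply/eqP; congr `|_|; ring.
  by rewrite /wt; congr (fine (nu _ _)); rewrite -addn1 PoszD addrK.
by rewrite leNgt c0.
Qed.

Hypothesis consT : conservative (PM nu) bits_shift.

(** If |d n| stayed above eps, [density_hellinger] would make the probability of a cocycle of at
    least 1 at time n decay geometrically. By Borel-Cantelli the cocycle would finally be below 1,
    against [cocycle_ge1_infinitely_often]. *)
Lemma conservative_frequently_close eps N : 0 < eps ->
  exists2 n, (N <= n)%N & `|d n| < eps.
Proof.
move=> eps0; apply: contrapT => H.
have {}H n : (N <= n)%N -> eps <= `|d n|.
  by move=> Nn; rewrite leNgt; apply/negP => dn; apply: H; exists n.
have eps1 : eps <= 1.
  apply: (le_trans (H N (leqnn N))).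
  have := p01 N; have := p01 0; rewrite /d ler_norml.
  by move=> /andP[? ?] /andP[? ?]; apply/andP; lra.
pose th := 1 - eps ^+ 2 / 8.
have th0 : 0 < th.
  have : eps ^+ 2 <= 1 by rewrite exprn_ile1// ltW.
  rewrite /th; lra.
have th1 : th < 1 by rewrite /th ltrBlDr ltrDl divr_gt0// exprn_gt0.
pose w := rn_derivative (PM nu) bits_shift.
have wT : is_rn_derivative (PM nu) bits_shift w by exact: rn_derivative_finite.
pose G n := [set x | 1 <= (cocycle bits_shift w n x)%:num].
have mcoc n : measurable_fun setT (cocycle bits_shift w n).
  by apply: measurable_cocycle; [exact: (measurable_shift 1)|case: wT].
have mG n : measurable (G n) by exact: measurable_density_ge.
have PG n : fine (PM nu (G n)) <= th ^- N * th ^+ n.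
  have thN0 : 0 < th ^+ N by rewrite exprn_gt0.
  have [nN|/ltnW Nn] := leqP n N.
    apply: (@le_trans _ _ 1).
      by rewrite -lee_fin fineK ?fin_num_measure// probability_le1.
    by rewrite mulrC ler_pdivlMr// mul1r ler_wiXn2l// ltW.
  (* After a shift by n the coordinates N + 1, ..., n have law mu_1, so each of them contributes a
     factor at most [th]. *)
  pose t := [seq Posz k.+1 | k <- iota N (n - N)].
  have ut : uniq t by rewrite map_inj_uniq ?iota_uniq// => a b [].
  apply: le_trans (density_hellinger (mcoc n) (@coc_density n) ut ltr01) _.
  rewrite invr1 sqrtr1 mulr1 mulrC -{2}(subnK Nn) exprD -mulrA divff ?gt_eqF// mulr1.
  rewrite -[X in _ ^+ X](_ : size t = _); last by rewrite size_map size_iota.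
  apply: hellinger_power; first exact: ltW.
  move=> i /mapP[k]; rewrite mem_iota subnKC// => /andP[Nk kn] ->.
  have kn0 : k.+1%:Z - n%:Z <= 0 by rewrite subr_le0; exact: kn.
  rewrite (_ : wt (fun i => nu (i - n%:Z)) k.+1%:Z false = wt nu 0 false); last first.
    exact: (two_sided_past mu false kn0).
  exact: H.
have geo M : \sum_(0 <= i < M) th ^+ i <= (1 - th)^-1.
  rewrite -[leRHS]mul1r ler_pdivlMr ?subr_gt0//.
  have -> : (\sum_(0 <= i < M) th ^+ i) * (1 - th) = 1 - th ^+ M.
    elim: M => [|M IH]; first by rewrite big_geq// mul0r expr0 subrr.
    by rewrite big_nat_recr//= mulrDl IH exprS; ring.
  by rewrite lerBlDr lerDl exprn_ge0// ltW.
have sumG : (\sum_(0 <= n <oo) PM nu (G n) < +oo)%E.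
  apply: (@le_lt_trans _ _ ((th ^- N * (1 - th)^-1)%:E)); last by rewrite ltry.
  apply: nneseries_le => // M.
  apply: (@le_trans _ _ (\sum_(0 <= i < M) (th ^- N * th ^+ i)%:E)%E).
    apply: lee_sum => i _; rewrite -[X in (X <= _)%E]fineK ?fin_num_measure//.
    by rewrite lee_fin.
  rewrite sumEFin lee_fin -mulr_sumr; apply: ler_wpM2l => //.
  by rewrite invr_ge0 exprn_ge0// ltW.
have lim0 := lim_sup_set_cvg0 mG sumG.
have [Z [mZ Z0 HZ]] := cocycle_ge1_infinitely_often hT consT wT.
have mlim : measurable (lim_sup_set G).
  by apply: bigcapT_measurable => i; apply: bigcup_measurable.
have : (PM nu setT <= 0)%E.
  apply: (@le_trans _ _ (PM nu (lim_sup_set G `|` Z))).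
    apply: le_measure; rewrite ?inE//; first exact: measurableU.
    move=> x _; have [Zx|Zx] := pselect (Z x); [by right|left => i _].
    by have [n ni cn] := HZ x Zx i; exists n.
  apply: le_trans (measureU2 (PM nu) mlim mZ) _.
  by rewrite [X in (X + _)%E]lim0 [X in (_ + X)%E]Z0 adde0.
by rewrite [X in (X <= _)%E]probability_setT lee_fin ler10.
Qed.

End two_sided_jumps.

(** * The steps of the random walk and the size of its jumps *)

Section ratios.
Context (R : realType) (mu : nat -> probability bool R).
Hypothesis hmu : forall n, (1 <= n)%N -> 0 < fine (mu n [set false]) < 1.
Local Notation PM := infinite_product.
Local Notation nu := (two_sided mu).

Definition coord_ratio n b : R := wt nu n.+1%:Z b / wt nu 0 b.

(** The jump size, that is, the sequence e of the harmonic functions: the larger of the two possible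
    steps over the smaller one, minus 1. *)
Definition ratio_gap n : R :=
  if coord_ratio n true <= coord_ratio n false
  then coord_ratio n false / coord_ratio n true - 1
  else coord_ratio n true / coord_ratio n false - 1.

Lemma coord_ratio_gt0 n b : 0 < coord_ratio n b.
Proof. by rewrite divr_gt0// two_sided_wt_gt0. Qed.

Lemma ratio_gap_ge0 n : 0 <= ratio_gap n.
Proof.
rewrite /ratio_gap; case: ifPn => [H|]; last rewrite -ltNge => /ltW H;
  by rewrite subr_ge0 ler_pdivlMr ?mul1r// coord_ratio_gt0.
Qed.

Lemma ratio_gapE n : coord_ratio n false = (1 + ratio_gap n) * coord_ratio n true \/
  coord_ratio n true = (1 + ratio_gap n) * coord_ratio n false.
Proof.
rewrite /ratio_gap; case: ifP => _; [left|right];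
  by rewrite addrC subrK divfK// gt_eqF// coord_ratio_gt0.
Qed.

Let d n : R := fine (mu n.+1 [set false]) - fine (mu 1%N [set false]).

(* The gap is |p - p1| / (p1 q) or |p - p1| / (p q1), where p = mu_(n+1)(0),
   p1 = mu_1(0), q = 1 - p and q1 = 1 - p1. *)
Lemma ratio_gap_bounds n (r : R) :
  r <= wt nu 0 false * wt nu 0 true / 2 -> `|d n| <= r ->
  [/\ `|d n| <= ratio_gap n, ratio_gap n <= 2 * r / (wt nu 0 false * wt nu 0 true) &
      wt nu 0 false * wt nu 0 true / 4 <= wt nu n.+1%:Z false * (1 - wt nu n.+1%:Z false)].
Proof.
move=> rle dr.
have p1 := two_sided_wt_gt0 hmu 0 false; have q1 := two_sided_wt_gt0 hmu 0 true.
have p := two_sided_wt_gt0 hmu n.+1%:Z false; have q := two_sided_wt_gt0 hmu n.+1%:Z true.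
have e1 := wtD nu 0; have e := wtD nu n.+1%:Z.
have dE : d n = wt nu n.+1%:Z false - wt nu 0 false by [].
rewrite /ratio_gap /coord_ratio dE in dr *.
move: (wt nu 0 false) (wt nu 0 true) (wt nu n.+1%:Z false) (wt nu n.+1%:Z true) p1 q1 p q e1 e rle dr => P1 Q1 P Q p1 q1 p q e1 e rle dr {dE}.
have Q1E : Q1 = 1 - P1 by lra.
have QE : Q = 1 - P by lra.
have PQ1 : P1 * Q1 <= P1 by nra.
have PQ2 : P1 * Q1 <= Q1 by nra.
have PP : P1 / 2 <= P by move: dr; rewrite ler_norml => /andP[? ?]; lra.
have QQ : Q1 / 2 <= Q by move: dr; rewrite ler_norml => /andP[? ?]; lra.
have r0 : 0 <= r by apply: le_trans dr.
have key x y : 0 < x -> 0 < y -> x * y <= 1 -> P1 * Q1 / 2 <= x * y ->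
    `|P - P1| <= `|P - P1| / (x * y) <= 2 * r / (P1 * Q1).
  move=> x0 y0 xy1 xy; have xy0 : 0 < x * y by rewrite mulr_gt0.
  rewrite ler_pdivlMr// ler_piMr//= ler_pdivlMr ?mulr_gt0// mulrAC ler_pdivrMr//.
  rewrite (le_trans (ler_wpM2r _ dr))//; first by rewrite mulr_ge0 ?ltW.
  by nra.
have -> : (if Q / Q1 <= P / P1 then (P / P1) / (Q / Q1) - 1 else (Q / Q1) / (P / P1) - 1)
    = if P1 <= P then `|P - P1| / (P1 * Q) else `|P - P1| / (P * Q1).
  have -> : (Q / Q1 <= P / P1) = (P1 <= P).
    rewrite ler_pdivrMr// mulrAC ler_pdivlMr// QE Q1E.
    by apply/idP/idP => ?; nra.
  case: ifPn => [H|]; last rewrite -ltNge => H.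
    rewrite ger0_norm ?subr_ge0//; rewrite QE Q1E; field.
    by rewrite -QE -Q1E !gt_eqF.
  rewrite ltr0_norm ?subr_lt0//; rewrite QE Q1E; field.
  by rewrite -Q1E !gt_eqF.
split; last by nra.
- by case: ifP => _; [have /andP[] := key P1 Q p1 q ltac:(nra) ltac:(nra)|
    have /andP[] := key P Q1 p q1 ltac:(nra) ltac:(nra)].
- by case: ifP => _; [have /andP[] := key P1 Q p1 q ltac:(nra) ltac:(nra)|
    have /andP[] := key P Q1 p q1 ltac:(nra) ltac:(nra)].
Qed.

Hypothesis hT : nonsingular (PM nu) bits_shift.
Hypothesis consT : conservative (PM nu) bits_shift.
Hypothesis sum_inf : (\sum_(1 <= n <oo) ((fine (mu n [set false]) -
  fine (mu 1%N [set false])) ^+ 2)%:E = +oo)%E.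

Lemma ratio_gap_diverge (eta : R) n (M : R) : 0 < eta -> exists k,
  M <= \sum_(j < k) (if ratio_gap (n + j) <= eta then
    wt nu (n + j).+1%:Z false * (1 - wt nu (n + j).+1%:Z false) * ratio_gap (n + j) ^+ 2
    else 0).
Proof.
move=> eta0.
have pq0 : 0 < wt nu 0 false * wt nu 0 true by rewrite mulr_gt0 ?two_sided_wt_gt0.
move E : (wt nu 0 false * wt nu 0 true) pq0 => pq pq0.
(* The first bound makes [ratio_gap_bounds] applicable, the second turns its conclusion 2 r / pq
   into at most eta. The factor 4 / pq of the target pays for p (1 - p) >= pq / 4. *)
pose r := Num.min (pq / 2) (eta * pq / 2).
have r0 : 0 < r by rewrite lt_min !divr_gt0// mulr_gt0.
have [k Hk] := @small_jumps_diverge R d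
  (fun M => nneseries_pinfty_unbounded M (fun n => sqr_ge0 _) sum_inf)
  (fun eps => @nonsingular_small_steps R mu hmu hT eps)
  (fun eps N => @conservative_frequently_close R mu hmu hT consT eps N)
  r n (M * 4 / pq) r0.
exists k; rewrite ler_pdivrMr// in Hk.
have {Hk} : M <= \sum_(j < k) (if `|d (n + j)| <= r then d (n + j) ^+ 2 else 0) * pq / 4.
  by rewrite -!mulr_suml ler_pdivlMr.
move=> /le_trans; apply; apply: ler_sum => j _.
case: ifPn => [dr|_]; last first.
  rewrite !mul0r; case: ifP => // _; rewrite mulr_ge0 ?sqr_ge0// mulr_ge0//.
    exact/ltW/two_sided_wt_gt0.
  by have := wtD nu (n + j).+1%:Z; have := two_sided_wt_gt0 hmu (n + j).+1%:Z true; lra.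
have [||dle ler pqle] := @ratio_gap_bounds (n + j) r.
- by rewrite E /r ge_min lexx.
- exact: dr.
have -> : ratio_gap (n + j) <= eta.
  rewrite (le_trans ler)// E ler_pdivrMr//.
  by rewrite -ler_pdivlMl// mulrC /r ge_min lexx orbT.
rewrite -mulrA mulrC; apply: ler_pM; rewrite ?sqr_ge0//.
- by rewrite divr_ge0// ltW.
- by rewrite -E.
- rewrite -[leLHS]real_normK ?num_real//.
  by rewrite ler_sqr ?nnegrE// ratio_gap_ge0.
Qed.

End ratios.

(** * Densities of product measures, coordinate by coordinate *)

Section densities.
Context (R : realType) (I : countType).
Local Notation PM := infinite_product.
Implicit Types (mu nu : I -> probability bool R) (J : pred I) (w h : bits I -> posreal R).

(** Splitting along one more coordinate at a time; it allows checks to be made only on cylinders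
    that fix prescribed coordinates. *)
Lemma cylinder_refine (Q : set (bits I) -> Prop) (B : set (bits I)) s t :
  measurable B ->
  (forall A A', measurable A -> measurable A' -> A `&` A' = set0 -> Q A -> Q A' -> Q (A `|` A')) ->
  (forall a, Q (B `&` cylinder (t ++ s) a)) -> forall a, Q (B `&` cylinder s a).
Proof.
move=> mB QU; elim: t => [//|i t IH] H; apply: IH => a.
have [it|it] := boolP (i \in t ++ s).
  by rewrite -(@eq_cylinder _ (i :: t ++ s))// => j; rewrite inE; case: eqP => // ->.
have mC b : measurable (B `&` cylinder (i :: t ++ s) (update a i b)).
  by apply: measurableI => //; exact: measurable_cylinder.
rewrite (_ : B `&` _ = (B `&` cylinder (i :: t ++ s) (update a i false)) `|`
                       (B `&` cylinder (i :: t ++ s) (update a i true))).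
  apply: QU => //; apply/seteqP; split => // x [[_ H0] [_ H1]].
  by have := H0 i (mem_head _ _); rewrite (H1 i (mem_head _ _)) /update eqxx.
rewrite -setIUr !cylinder_cons !cylinder_update// /update eqxx -setIUl.
rewrite (_ : _ `|` _ = setT) ?setTI//.
by apply/seteqP; split => // x _ /=; case: (x i); [right|left].
Qed.

Lemma bits_measure_unique_refined (m1 m2 : {measure set (bits I) -> \bar R}) :
  (m1 setT < +oo)%E ->
  (forall s, uniq s -> exists t, uniq (t ++ s) /\
    forall a, m1 (cylinder (t ++ s) a) = m2 (cylinder (t ++ s) a)) ->
  forall A, measurable A -> m1 A = m2 A.
Proof.
move=> m1fin H; apply: bits_measure_unique => // s a us.
have [t [_ Ht]] := H s us.
rewrite -[cylinder s a]setTI.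
apply: (@cylinder_refine (fun A => m1 A = m2 A) setT s t) => //.
  by move=> A A' mA mA' AA' e e'; rewrite !measureU//; congr (_ + _)%E.
by move=> b; rewrite setTI.
Qed.

Lemma integral_mkindic d (T : measurableType d) (m : {measure set T -> \bar R}) (B : set T)
    (f : T -> \bar R) :
  (\int[m]_(x in B) f x = \int[m]_x ((\1_B x)%:E * f x))%E.
Proof.
rewrite integral_mkcond; apply: eq_integral => x _.
by rewrite patchE indicE; case: ifP => _; rewrite ?mul1e ?mul0e.
Qed.

Lemma integral_merge mu J (f : bits I -> \bar R) : measurable_fun setT f ->
  (forall x, (0 <= f x)%E) ->
  (\int[PM mu]_y \int[PM mu]_x f (merge J y x) = \int[PM mu]_x f x)%E.
Proof.
move=> mf f0.
pose g (p : bits I * bits I) := merge J p.1 p.2.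
have mg : measurable_fun setT g by exact: measurable_merge.
have mfg : measurable_fun setT (f \o g) by exact: measurableT_comp.
transitivity (\int[(PM mu \x PM mu)%E]_p f (g p))%E.
  exact: (esym (fubini_tonelli1 (f \o g) mfg (fun p => f0 _))).
rewrite -(ge0_integral_pushforward (phi := g) mg (PM mu \x PM mu)%E (D := setT))//.
apply: eq_measure_integral => A mA _; exact: product_merge_self.
Qed.

Lemma measurable_merger J (y : bits I) : measurable_fun setT (merge J y).
Proof. exact: (measurableT_comp (measurable_merge J) (pair1_measurable y)). Qed.

Lemma merge_merge J (y z x : bits I) : merge J y (merge J z x) = merge J y x.
Proof. by apply/funext => i; rewrite /merge; case: (J i). Qed.

(** Averaging the density w over the coordinates in J, drawn from mu, replaces the law nu by mu on J
    and removes the dependence on J. The future factor of the cocycle is obtained in this way. *)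
Lemma density_merge mu nu J w : measurable_fun setT w ->
  (forall B, measurable B -> PM nu B = \int[PM mu]_(x in B) (w x)%:num%:E)%E ->
  exists h, [/\ measurable_fun setT h, depends_on (predC J) h &
    forall B, measurable B -> PM (fun i => if J i then mu i else nu i) B =
      (\int[PM mu]_(x in B) (h x)%:num%:E)%E].
Proof.
move=> mw wE.
have mwE : measurable_fun setT (fun x => (w x)%:num%:E).
  by apply/measurable_EFinP; exact: measurable_num_comp.
have mww : measurable_fun setT (fun p : bits I * bits I => (w (merge J p.2 p.1))%:num%:E).
  apply: (measurableT_comp mwE).
  apply: (@measurableT_comp _ _ _ _ _ _ (fun p : bits I * bits I => merge J p.1 p.2)
    _ (fun p : bits I * bits I => (p.2, p.1))); first exact: measurable_merge.
  exact: measurable_swap.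
pose h x := (\int[PM mu]_z (w (merge J z x))%:num%:E)%E.
have mh : measurable_fun setT h.
  exact: (measurable_fun_fubini_tonelli_F (m2 := PM mu)
    (fun p => (w (merge J p.2 p.1))%:num%:E)).
have h_dep : depends_on (predC J) h.
  move=> x x' xx'; apply: eq_integral => z _.
  suff -> : merge J z x = merge J z x' by [].
  by apply/funext => i; rewrite /merge; case: ifPn => // /xx'.
have hE B : measurable B -> (PM (fun i => if J i then mu i else nu i) B =
    \int[PM mu]_(x in B) h x)%E.
  move=> mB; rewrite -product_merge//.
  pose g x := ((\1_B x)%:E * h x)%E.
  have h0 x : (0 <= h x)%E by apply: integral_ge0 => *; rewrite lee_fin.
  have mg : measurable_fun setT g.
    by apply: emeasurable_funM => //; apply/measurable_EFinP; exact: measurable_indic.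
  rewrite integral_mkindic -(integral_merge mu J mg); last first.
    by move=> x; rewrite mule_ge0// lee_fin.
  apply: eq_integral => y _.
  transitivity (\int[PM mu]_u ((\1_B (merge J y u))%:E * (w u)%:num%:E))%E.
    rewrite -(integral_mkindic (PM mu) [set u | B (merge J y u)] (fun u => (w u)%:num%:E)).
    rewrite -wE; last by apply: measurable_pre mB; exact: measurable_merger.
    by congr (PM nu _); apply/seteqP; split => u; rewrite /xsection/= inE.
  pose f u := ((\1_B (merge J y u))%:E * (w u)%:num%:E)%E.
  have mf : measurable_fun setT f.
    apply: emeasurable_funM => //; apply/measurable_EFinP.
    have m1B : measurable_fun setT (\1_B : bits I -> R) by exact: measurable_indic.
    exact: (measurableT_comp m1B (@measurable_merger J y)).
  rewrite -[LHS](integral_merge mu J mf); last by move=> x; rewrite mule_ge0// lee_fin.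
  rewrite (fubini_tonelli (fun p => f (merge J p.1 p.2))); last 2 first.
  - exact: (measurableT_comp mf (measurable_merge J)).
  - by move=> x; rewrite mule_ge0// lee_fin.
  apply: eq_integral => x _; rewrite /g (h_dep (merge J y x) x); last exact: mergeEC.
  rewrite -ge0_integralZl//; last first.
    exact: (measurableT_comp mwE (measurableT_comp (measurable_merge J) (pair2_measurable x))).
  by apply: eq_integral => z _; rewrite /f merge_merge.
have h0 x : (0 < h x)%E.
  rewrite lt0e integral_ge0 ?andbT; last by move=> *; rewrite lee_fin.
  apply/negP => /eqP hx0.
  have mwx : measurable_fun setT (fun z => (w (merge J z x))%:num%:E).
    exact: (measurableT_comp mwE (measurableT_comp (measurable_merge J) (pair2_measurable x))).
  have e0 : (\int[PM mu]_z `|(w (merge J z x))%:num%:E| = 0)%E.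
    by rewrite -[RHS]hx0; apply: eq_integral => z _; rewrite gee0_abs// lee_fin.
  have [Z [mZ Z0 sZ]] := (ae_eq_integral_abs (PM mu) measurableT mwx).1 e0.
  have : (PM mu setT <= PM mu Z)%E.
    apply: le_measure; rewrite ?inE// => z _; apply: sZ => /= /(_ Logic.I) /eqP.
    by rewrite eqe gt_eqF.
  by rewrite [X in (_ <= X)%E]Z0 [X in (X <= _)%E]probability_setT lee_fin ler10.
have inth : (PM mu).-integrable setT h.
  apply/integrableP; split => //.
  rewrite (eq_integral h); last by move=> x _; rewrite gee0_abs// ltW.
  by rewrite -hE// [X in (X < _)%E]probability_setT ltry.
(* The average may be infinite on a null set, where [fine] gives 0; the value 1 is a dummy there. *)
have hp x : 0 < (if 0 < fine (h x) then fine (h x) else 1) by case: ifP.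
exists (fun x => PosNum (hp x)); split.
- apply: measurable_posreal => /=.
  have mfh : measurable_fun setT (fun x => fine (h x)) by exact: measurableT_comp.
  by apply: measurable_fun_ifT => //; exact: measurable_fun_ltr.
- by move=> x x' xx'; apply/val_inj => /=; rewrite (h_dep x x').
move=> B mB; rewrite hE//; apply: ae_eq_integral => //.
- exact: measurable_funTS.
- apply: measurable_funTS; apply/measurable_EFinP.
  have mfh : measurable_fun setT (fun x => fine (h x)) by exact: measurableT_comp.
  by apply: measurable_fun_ifT => //; exact: measurable_fun_ltr.
apply: filterS (integrable_ae measurableT inth) => x /(_ Logic.I) hx _ /=.
by rewrite fine_gt0 ?fineK// h0/= ltey_eq hx.
Qed.

(* Changing the law of finitely many coordinates multiplies a density by the
   corresponding ratios of weights. *)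
Lemma density_finite_change mu lam nu s h : uniq s -> measurable_fun setT h ->
  (forall i b, 0 < wt lam i b) ->
  (forall i b, i \notin s -> wt nu i b = wt lam i b) ->
  (forall B, measurable B -> PM lam B = \int[PM mu]_(x in B) (h x)%:num%:E)%E ->
  forall B, measurable B -> PM nu B = (\int[PM mu]_(x in B)
    ((\prod_(i <- s) (wt nu i (x i) / wt lam i (x i))) * (h x)%:num)%:E)%E.
Proof.
move=> us mh lam0 nulam hE B mB.
pose rho (x : bits I) := \prod_(i <- s) (wt nu i (x i) / wt lam i (x i)).
have rho0 x : 0 <= rho x.
  by apply: prodr_ge0 => i _; rewrite divr_ge0 ?wt_ge0.
have mrho : measurable_fun setT rho.
  apply: measurable_prod => i _.
  apply: (@measurableT_comp _ _ _ _ _ _ (fun b => wt nu i b / wt lam i b) _ (fun x : bits I => x i)) => //.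
  exact: measurable_coord.
have mf : measurable_fun setT (fun x => (rho x * (h x)%:num)%:E).
  by apply/measurable_EFinP; apply: measurable_funM => //; exact: measurable_num_comp.
have f0 x : (0 <= (rho x * (h x)%:num)%:E)%E by rewrite lee_fin mulr_ge0.
rewrite -[B]setIT -(cylinder_nil (fun=> false)).
apply: (@cylinder_refine (fun A => PM nu A =
  \int[PM mu]_(x in A) (rho x * (h x)%:num)%:E)%E B [::] s) => //.
  move=> A A' mA mA' AA' e e'; rewrite measureU// ge0_integral_setU//.
  - by congr (_ + _)%E.
  - exact: measurable_funTS.
  - by apply/disj_set2P.
move=> a; rewrite cats0.
have mC : measurable (B `&` cylinder s a) by apply: measurableI => //; exact: measurable_cylinder.
transitivity ((rho a)%:E * PM lam (B `&` cylinder s a))%E; last first.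
  rewrite hE// -ge0_integralZl ?lee_fin//; last first.
    by apply: measurable_funTS; apply/measurable_EFinP; exact: measurable_num_comp.
  apply: eq_integral => x; rewrite inE => -[_ xa]; rewrite EFinM; congr ((_)%:E * _)%E.
  by rewrite /rho !big_seq; apply: eq_bigr => i is_; rewrite xa.
(* On the cylinder the coordinates in s are frozen at a, so B may be replaced by D, which does not
   depend on them and is thus independent of the cylinder. *)
pose D := [set x | B (merge (mem s) a x)].
have mD : measurable D by apply: measurable_pre mB; exact: measurable_merger.
have dD : depends_on (predC (mem s)) D.
  move=> x x' xx'; rewrite /D/=; congr B; apply/funext => i.
  by rewrite /merge; case: ifPn => // /xx'.
have -> : B `&` cylinder s a = cylinder s a `&` D.
  have e x : cylinder s a x -> merge (mem s) a x = x.
    by move=> xa; apply/funext => i; rewrite /merge; case: ifPn => // /xa ->.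
  apply/seteqP; split => x /= [H1 H2]; split => //; rewrite /D/=.
    by rewrite e.
  by move: H2; rewrite /D/= e.
have indep l : (PM l (cylinder s a `&` D) = (\prod_(i <- s) wt l i (a i))%:E * PM l D)%E.
  rewrite -cylinderE//; apply: (@product_indep _ _ l (mem s)) => //.
    exact: measurable_cylinder.
  exact: depends_on_cylinder.
rewrite !indep (product_local (J := predC (mem s)) mD dD (mu := nu) (nu := lam)); last first.
  by move=> i b; exact: nulam.
rewrite muleA -EFinM; congr (_%:E * _)%E; rewrite /rho -big_split/=.
by apply: eq_bigr => i _; rewrite divfK// gt_eqF.
Qed.
End densities.

(** * Products with [kappa0], in the coordinate s = 1 / t *)

Section product_with_kappa0.
Context d (X : measurableType d) (R : realType).
Variable P : {sigma_finite_measure set X -> \bar R}.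
Local Notation leb := (@lebesgue_measure R).
Local Notation kap := (@kappa0 R).
Local Notation m := (P \x kap)%E.

Lemma kappa0_ge (u : R) : 0 < u -> kap [set t : posreal R | u <= t%:num] = u^-1%:E.
Proof.
move=> u0; rewrite kappa0E (_ : _ `&` _ = `]0, u^-1]%classic).
  by rewrite lebesgue_measure_itv/= lte_fin invr_gt0 u0 oppr0 adde0.
apply/seteqP; split => s /=; rewrite !in_itv/= ?andbT.
  move=> [us s0]; move: us; rewrite s0/= => us.
  by rewrite -[leLHS]invrK lef_pV2 ?posrE ?invr_gt0.
move=> /andP[s0 su]; rewrite s0; split => //.
by rewrite -[leLHS]invrK lef_pV2 ?posrE ?invr_gt0.
Qed.

Lemma rescale_null (r : X -> posreal R) (M : set (X * posreal R)) :
  measurable_fun setT r -> measurable M -> m M = 0%E ->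
  m [set p | M (p.1, pmul (r p.1) p.2)] = 0%E.
Proof.
move=> mr mM M0.
have mf : measurable_fun setT (fun p : X * posreal R => (p.1, pmul (r p.1) p.2)).
  exact: (measurable_skew (S := id) (@measurable_id _ X setT) mr).
have mM' : measurable [set p | M (p.1, pmul (r p.1) p.2)] by exact: measurable_pre mf mM.
apply/product_null => //; move/product_null : M0 => /(_ mM) M0.
rewrite -[RHS]M0; congr (P _); apply/funext => x /=; congr (is_true (~~ _)).
rewrite (_ : xsection _ x = pmul (r x) @^-1` xsection M x); last first.
  by apply/seteqP; split => t; rewrite /xsection/= !inE.
rewrite [X in X == _](kappa0_scaling (r x)); last exact: measurable_xsection.
by rewrite mule_eq0 eqe gt_eqF.
Qed.

(** D in the coordinate s = 1 / t, in which [kappa0] is Lebesgue measure. *)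
Definition invset (D : set (X * posreal R)) : set (X * measurableTypeR R) :=
  [set q | 0 < q.2 /\ D (q.1, invpos q.2)].

Lemma measurable_invset D : measurable D -> measurable (invset D).
Proof.
move=> mD; apply: measurableI.
  have := measurable_pre (measurable_snd : measurable_fun setT (snd : X * measurableTypeR R -> _))
    (measurable_itv `]0, +oo[).
  by congr measurable; apply/seteqP; split => q /=; rewrite in_itv/= andbT.
have mf : measurable_fun setT (fun q : X * measurableTypeR R => (q.1, invpos q.2)).
  apply/measurable_fun_pairP; split; first exact: measurable_fst.
  apply: (@measurableT_comp _ _ _ _ _ _ (@invpos R : measurableTypeR R -> posreal R) _
    (snd : X * measurableTypeR R -> _)); [exact: measurable_invpos|exact: measurable_snd].
exact: measurable_pre mf mD.
Qed.

Lemma product_kappa0E D : measurable D ->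
  m D = (\int[leb]_s P [set x | (0 < s)%R /\ D (x, invpos s)])%E.
Proof.
move=> mD; have mI := measurable_invset mD.
transitivity ((P \x leb)%E (invset D)).
  apply: eq_integral => x _; rewrite /= kappa0E; congr (leb _).
  have -> : xsection (invset D) x = @invpos R @^-1` (xsection D x) `&` `]0, +oo[.
    rewrite set_itvE; apply/seteqP; split => s; rewrite /xsection/= !inE/=.
      by move=> [].
    by move=> [].
  by [].
transitivity ((P \x^ leb)%E (invset D)).
  apply: product_measure_unique => //= ? ? ? ?.
  by rewrite [LHS]product_measure2E.
by apply: eq_integral => s _; congr (P _); apply/seteqP; split => x; rewrite /ysection/= !inE.
Qed.

Lemma measurable_kappa0_section D : measurable D ->
  measurable_fun setT (fun s : R => P [set x | 0 < s /\ D (x, invpos s)]).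
Proof.
move=> mD; have := measurable_fun_ysection P (measurable_invset mD).
congr measurable_fun; apply/funext => s /=; congr (P _).
by apply/seteqP; split => x; rewrite /ysection/= !inE.
Qed.

Lemma product_kappa0_null D : measurable D -> m D = 0%E ->
  \forall s \ae leb, 0 < s -> P [set x | D (x, invpos s)] = 0%E.
Proof.
move=> mD; rewrite product_kappa0E// => D0.
have : (\int[leb]_s `|P [set x | (0 < s)%R /\ D (x, invpos s)]| = 0)%E.
  by rewrite -[RHS]D0; apply: eq_integral => s _; rewrite gee0_abs.
move=> /(ae_eq_integral_abs leb measurableT (measurable_kappa0_section mD)).1.
apply: filterS => s /(_ I) /= + s0; move=> <-; congr (P _).
by apply/seteqP; split => x // [].
Qed.

End product_with_kappa0.

(** * Measures determined by products with rays *)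

Section uniqueness_on_rays.
Context d (X : measurableType d) (R : realType).

Lemma product_ray_unique (m1 m2 : {measure set (X * posreal R) -> \bar R}) :
  (forall B (u : R), measurable B -> 0 < u ->
    m1 (B `*` [set t : posreal R | (u <= t%:num)%R]) = m2 (B `*` [set t : posreal R | (u <= t%:num)%R])) ->
  (forall u : R, 0 < u -> (m1 (setT `*` [set t : posreal R | (u <= t%:num)%R]) < +oo)%E) ->
  forall A, measurable A -> m1 A = m2 A.
Proof.
move=> m12 fin1.
pose G : set (set (X * posreal R)) := [set A | exists B u, [/\ measurable B, 0 < u &
  A = B `*` [set t : posreal R | u <= t%:num]]].
pose g n : set (X * posreal R) := setT `*` [set t : posreal R | n.+1%:R^-1 <= t%:num].
have tn (t : posreal R) : exists n, (n.+1%:R : R)^-1 <= t%:num.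
  exists (Num.truncn (t%:num^-1)); rewrite -[leRHS]invrK lef_pV2 ?posrE ?invr_gt0//.
  exact/ltW/truncnS_gt.
apply: (measure_unique G g).
- apply/seteqP; split; last first.
    apply: smallest_sub; first exact: sigma_algebra_measurable.
    move=> _ [B [u [mB u0 ->]]]; apply: measurableX => //; exact: measurable_ge.
  have gG : forall A, G A -> (<<s G >>) A by move=> A GA; exact: sub_sigma_algebra.
  pose id' : g_sigma_algebraType G -> X * posreal R := id.
  suff mid : measurable_fun setT id'.
    by move=> A mA; have := mid measurableT A mA; rewrite setTI.
  apply/measurable_fun_pairP; split.
    move=> _ B mB; rewrite setTI.
    rewrite (_ : _ @^-1` _ = \bigcup_n (B `*` [set t : posreal R | n.+1%:R^-1 <= t%:num])).
      by apply: bigcupT_measurable => n; apply: gG; exists B, n.+1%:R^-1; rewrite invr_gt0.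
    apply/seteqP; split => [[x t] /= Bx|[x t] [n _ []]//].
    by have [n nt] := tn t; exists n.
  apply: measurable_posreal; apply: (measurability (@RGenCInfty.G R)).
    exact: RGenCInfty.measurableE.
  move=> _ [_ [u ->] <-]; rewrite setTI.
  have [u0|u0] := ltP 0 u.
    rewrite (_ : _ @^-1` _ = setT `*` [set t : posreal R | u <= t%:num]).
      by apply: gG; exists setT, u.
    by apply/seteqP; split => [[x t]|[x t] []] /=; rewrite in_itv/= andbT.
  rewrite (_ : _ @^-1` _ = setT); first exact: measurableT.
  apply/seteqP; split => [//|[x t] _] /=; rewrite in_itv/= andbT.
  by rewrite (le_trans u0).
- move=> _ _ [B [u [mB u0 ->]]] [B' [u' [mB' u'0 ->]]].
  exists (B `&` B'), (Num.max u u'); split; first exact: measurableI.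
    by rewrite lt_max u0.
  apply/seteqP; split => [[x t] /= [[Bx ut] [B'x u't]]|[x t] /= [[Bx B'x]]];
    rewrite ge_max; first by rewrite ut u't.
  by move=> /andP[].
- by move=> n; exists setT, n.+1%:R^-1; rewrite invr_gt0.
- by apply/seteqP; split => // -[x t] _; have [n nt] := tn t; exists n.
- by move=> _ [B [u [mB u0 ->]]]; exact: m12.
- by move=> n; apply: fin1; rewrite invr_gt0.
Qed.

End uniqueness_on_rays.

(** * Factorization of the cocycle of the shift *)

Section cocycle_factorization.
Context (R : realType) (mu : nat -> probability bool R).
Hypothesis hmu : forall n, (1 <= n)%N -> 0 < fine (mu n [set false]) < 1.
Local Notation PM := infinite_product.
Local Notation nu := (two_sided mu).
Local Notation X := (bits int).

(** The likelihood ratio of the coordinates 1, ..., n against independent coordinates of law mu_1;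
    also the position of the random walk after n steps. *)
Definition tilt n (x : X) : R := \prod_(k < n) coord_ratio mu k (x k.+1%:Z).

Lemma tilt_gt0 n x : 0 < tilt n x.
Proof. by apply: prodr_gt0 => k _; exact: coord_ratio_gt0. Qed.

Lemma tiltS n x : tilt n.+1 x = tilt n x * coord_ratio mu n (x n.+1%:Z).
Proof. by rewrite /tilt big_ord_recr. Qed.

Lemma measurable_coord_fun (f : bool -> R) i : measurable_fun setT (fun x : X => f (x i)).
Proof.
apply: (@measurableT_comp _ _ _ _ _ _ f _ (fun x : X => x i)) => //.
exact: measurable_coord.
Qed.

Lemma measurable_tilt n : measurable_fun setT (tilt n).
Proof. by apply: measurable_prod => k _; exact: measurable_coord_fun. Qed.

Variable w : X -> posreal R.
Hypothesis iT : invertible_borel bits_shift.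
Hypothesis wT : is_rn_derivative (PM nu) bits_shift w.
Local Notation coc := (cocycle bits_shift w).

Lemma shift_cocycle_density n B : measurable B -> PM (fun i => nu (i - n%:Z)) B =
  (\int[PM nu]_(x in B) (coc n x)%:num%:E)%E.
Proof.
move=> mB; rewrite -product_shift_image//.
by have [_ ->] := cocycle_rn_derivative n iT wT.
Qed.

(** Formally the n-th derivative is the product over i of nu_(i-n)(x_i) / nu_i(x_i): the factors
    with i <= 0 are 1, those with 1 <= i <= n make 1 / [tilt], and the rest sees only coordinates
    after n. *)
Lemma cocycle_factor n : exists h : X -> posreal R,
  [/\ measurable_fun setT h, depends_on (fun i => n%:Z < i) h &
      {ae PM nu, forall x, coc n x = pmul (invpos (tilt n x)) (h x)}].
Proof.
have mw : measurable_fun setT w by case: wT.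
have mcoc : measurable_fun setT (coc n).
  by apply: measurable_cocycle => //; exact: (measurable_shift 1).
have [h [mh dh hE]] := density_merge (fun i : int => i <= n%:Z) mcoc (@shift_cocycle_density n).
exists h; split => //.
  by apply: depends_onS dh => i; rewrite !unfold_in/= -ltNge.
pose s := [seq Posz k.+1 | k <- iota 0 n].
have us : uniq s by rewrite map_inj_uniq ?iota_uniq// => a b [].
(* The intermediate law, already shifted after n. [density_merge] gives its density h, and passing
   to the fully shifted law changes only the coordinates 1, ..., n. *)
pose lam i := if i <= n%:Z then nu i else nu (i - n%:Z).
have lam0 i b : 0 < wt lam i b.
  rewrite /wt /lam; case: ifP => _; exact: (two_sided_wt_gt0 hmu).
have past_wt i b : i <= n%:Z -> wt (fun i => nu (i - n%:Z)) i b = wt nu 0 b.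
  by move=> i0; apply: two_sided_past; lia.
have nulam i b : i \notin s -> wt (fun i => nu (i - n%:Z)) i b = wt lam i b.
  move=> is_; have [in_|ni] := leP i n%:Z; last first.
    by rewrite /wt /lam leNgt ni.
  rewrite past_wt// {2}/wt /lam in_ -/(wt nu i b).
  have [i0|i0] := leP i 0; first by rewrite two_sided_past.
  case/negP: is_; apply/mapP; exists (`|i| - 1)%N; last by lia.
  by rewrite mem_iota; lia.
have dens := density_finite_change us mh lam0 nulam hE.
have rhoE x : \prod_(i <- s) (wt (fun i => nu (i - n%:Z)) i (x i) / wt lam i (x i)) =
    (tilt n x)^-1.
  rewrite big_map -[X in iota 0 X](subn0 n) -/(index_iota 0 n) big_mkord /tilt -prodfV.
  apply: eq_bigr => k _; rewrite /coord_ratio invf_div.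
  have kn : k.+1%:Z <= n%:Z by rewrite lez_nat; exact: ltn_ord.
  by rewrite (past_wt _ _ kn) /wt /lam kn.
have mt : measurable_fun setT (fun x => (invpos (tilt n x))).
  apply: (@measurableT_comp _ _ _ _ _ _ (@invpos R : measurableTypeR R -> posreal R) _ (tilt n)).
    exact: measurable_invpos.
  exact: measurable_tilt.
have int_coc : (PM nu).-integrable setT (fun x => (coc n x)%:num%:E).
  apply/integrableP; split.
    by apply/measurable_EFinP; exact: measurable_num_comp.
  rewrite (eq_integral (fun x => (coc n x)%:num%:E)).
    by rewrite -shift_cocycle_density// [X in (X < _)%E]probability_setT ltry.
  by move=> x _; rewrite gee0_abs// lee_fin.
have mht : measurable_fun setT (fun x => (pmul (invpos (tilt n x)) (h x))%:num%:E).
  by apply/measurable_EFinP; apply: measurable_num_comp; exact: measurable_pmul.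
have := integral_ae_eq measurableT int_coc mht.
have H E : E `<=` setT -> measurable E -> (\int[PM nu]_(x in E) (coc n x)%:num%:E =
    \int[PM nu]_(x in E) (pmul (invpos (tilt n x)) (h x))%:num%:E)%E.
  move=> _ mE; rewrite -shift_cocycle_density// dens//.
  by apply: eq_integral => x _; rewrite rhoE /= tilt_gt0.
move=> /(_ H); apply: filterS => x /(_ Logic.I) [e].
exact/val_inj.
Qed.

End cocycle_factorization.

(** * Sets up to null sets *)

Section measure_up_to_null.
Context d (Y : measurableType d) (R : realType) (m : {measure set Y -> \bar R}).

Lemma measure_eq_off_null C D Z : measurable C -> measurable D -> measurable Z ->
  m Z = 0%E -> (forall y, ~ Z y -> C y <-> D y) -> m C = m D.
Proof.
move=> mC mD mZ Z0 CD.
have le (C' D' : set Y) : measurable C' -> measurable D' ->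
    (forall y, ~ Z y -> C' y -> D' y) -> (m C' <= m D')%E.
  move=> mC' mD' C'D'; apply: (@le_trans _ _ (m (D' `|` Z))).
    apply: le_measure; rewrite ?inE//; first exact: measurableU.
    by move=> y C'y; have [Zy|Zy] := pselect (Z y); [right|left; exact: C'D'].
  apply: le_trans (measureU2 m mD' mZ) _.
  by rewrite [X in (_ + X)%E]Z0 adde0.
by apply/eqP; rewrite eq_le !le// => y /CD[].
Qed.

Lemma null_sub C Z : measurable C -> measurable Z -> m Z = 0%E -> C `<=` Z -> m C = 0%E.
Proof.
move=> mC mZ Z0 CZ; apply/eqP; rewrite eq_le measure_ge0 andbT -Z0.
by apply: le_measure; rewrite ?inE.
Qed.

Lemma null_setU C Z : measurable C -> measurable Z -> m C = 0%E -> m Z = 0%E ->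
  m (C `|` Z) = 0%E.
Proof.
move=> mC mZ C0 Z0; apply/eqP; rewrite eq_le measure_ge0 andbT.
apply: le_trans (measureU2 m mC mZ) _.
by rewrite [X in (X + _)%E]C0 [X in (_ + X)%E]Z0 adde0.
Qed.

Lemma symdiffE (C D : set Y) y : (C `+` D) y <-> ~ (C y <-> D y).
Proof. by rewrite /setY/=; move: (pselect (C y)) (pselect (D y)); tauto. Qed.

Lemma measurableY (C D : set Y) : measurable C -> measurable D -> measurable (C `+` D).
Proof. by move=> mC mD; apply: measurableU; exact: measurableD. Qed.

End measure_up_to_null.

(** * Triviality of the tail of the skew product *)

Section tail_sets.
Context (R : realType) (mu : nat -> probability bool R).
Hypothesis hmu : forall n, (1 <= n)%N -> 0 < fine (mu n [set false]) < 1.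
Local Notation PM := infinite_product.
Local Notation nu := (two_sided mu).
Local Notation X := (bits int).
Local Notation P := (PM nu).
Local Notation leb := (@lebesgue_measure R).
Local Notation m := (P \x @kappa0 R)%E.
Hypothesis hT : nonsingular P bits_shift.
Hypothesis consT : conservative P bits_shift.
Hypothesis sum_inf : (\sum_(1 <= n <oo) ((fine (mu n [set false]) -
  fine (mu 1%N [set false])) ^+ 2)%:E = +oo)%E.
Variable w : X -> posreal R.
Hypothesis wT : is_rn_derivative P bits_shift w.
Local Notation coc := (cocycle bits_shift w).
Local Notation S := (skew bits_shift w).

Lemma invposM (a b : R) : 0 < a -> 0 < b -> invpos (a * b) = pmul (invpos a) (invpos b).
Proof.
by move=> a0 b0; apply/val_inj; rewrite /= a0 b0 mulr_gt0// invfM.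
Qed.

Lemma null_fst N : measurable N -> P N = 0%E -> m (N `*` setT) = 0%E.
Proof.
by move=> mN N0; rewrite product_measure1E// [X in (X * _)%E]N0 mul0e.
Qed.

Lemma measurable_iter_shift n : measurable_fun setT (iter n bits_shift).
Proof. by rewrite iter_bits_shift; exact: measurable_shift. Qed.

Section one_tail_set.
Variables (A : set (X * posreal R)) (B : nat -> set (X * posreal R))
  (h : nat -> X -> posreal R).
Hypothesis mA : measurable A.
Hypothesis mB : forall n, measurable (B n).
Hypothesis dB : forall n u, depends_on (fun i : int => 0 < i) (fun x => B n (x, u)).
Hypothesis AB : forall n, m (A `+` (iter n S @^-1` B n)) = 0%E.
Hypothesis mh : forall n, measurable_fun setT (h n).
Hypothesis dh : forall n, depends_on (fun i => n%:Z < i) (h n).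
Hypothesis hE : forall n, {ae P, forall x, coc n x = pmul (invpos (tilt mu n x)) (h n x)}.

(** The preimage of [B n] without the factor [tilt], so an event of the coordinates after n and of
    t. Up to a null set, A holds at (x, t) exactly when D n holds at (x, t / tilt n x). *)
Let D n := skew (iter n bits_shift) (h n) @^-1` B n.

Let mD n : measurable (D n).
Proof.
apply: measurable_pre (mB n); apply: measurable_skew => //.
exact: measurable_iter_shift.
Qed.

Let D_dep n t : depends_on (fun i => n%:Z < i) (fun x => D n (x, t)).
Proof.
move=> x x' xx'; rewrite /D /skew/= (dh xx').
apply: dB => i i0; rewrite iter_bits_shift /shift; apply: xx'.
by rewrite ltrDr.
Qed.

Let mDt n t : measurable [set x | D n (x, t)].
Proof. exact: measurable_pre (pair2_measurable t) (mD n). Qed.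

Let twist n := skew id (fun x => invpos (tilt mu n x)) @^-1` D n.

Let mtilt n : measurable_fun setT (fun x => invpos (tilt mu n x)).
Proof.
apply: (@measurableT_comp _ _ _ _ _ _ (@invpos R : measurableTypeR R -> posreal R) _ (tilt mu n)).
  exact: measurable_invpos.
exact: measurable_tilt.
Qed.

Let mtwist n : measurable (twist n).
Proof. by apply: measurable_pre (mD n); apply: measurable_skew. Qed.

Let mSn n : measurable_fun setT (iter n S).
Proof.
have mw : measurable_fun setT w by case: wT.
have mS : measurable_fun setT S by apply: measurable_skew => //; exact: (measurable_shift 1).
by elim: n => [|n IH]; [exact: measurable_id|exact: (measurableT_comp mS IH)].
Qed.

Let A_twist n : m (A `+` twist n) = 0%E.
Proof.
have [N [mN N0 sN]] := hE n.
have mNT : measurable (N `*` setT : set (X * posreal R)) by exact: measurableX.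
have NT0 : m (N `*` setT) = 0%E := null_fst mN N0.
have mAB : measurable (A `+` (iter n S @^-1` B n)).
  by apply: measurableY => //; exact: measurable_pre (mSn n) (mB n).
apply: (@null_sub _ _ _ _ _ ((A `+` (iter n S @^-1` B n)) `|` (N `*` setT))).
- by apply: measurableY.
- exact: measurableU.
- exact: (null_setU mAB mNT (AB n) NT0).
move=> [x t] H; have [Nx|Nx] := pselect (N x); first by right.
left; move: H; rewrite !symdiffE; apply: contra_not; rewrite iter_skew /twist /D /skew/= => ->.
have -> : coc n x = pmul (invpos (tilt mu n x)) (h n x).
  by apply: contrapT => Hx; apply: Nx; exact: sN.
by rewrite [pmul (invpos _) _]pmulC pmulA.
Qed.

Let D_step n : exists M, [/\ measurable M, m M = 0%E & forall x t, ~ M (x, t) ->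
  D n (x, t) <-> D n.+1 (x, pmul (invpos (coord_ratio mu n (x n.+1%:Z))) t)].
Proof.
pose U := (A `+` twist n) `|` (A `+` twist n.+1).
have mAt k : measurable (A `+` twist k) by exact: (measurableY mA (mtwist k)).
have mU : measurable U by exact: measurableU.
have U0 : m U = 0%E by exact: (null_setU (mAt n) (mAt n.+1) (A_twist n) (A_twist n.+1)).
(* Rescaling t by [tilt] undoes the twist; it preserves null sets because the scaling law does so in
   every fibre. *)
pose r x := pinv (invpos (tilt mu n x)).
have mr : measurable_fun setT r by exact: measurable_pinv.
exists [set p | U (p.1, pmul (r p.1) p.2)]; split.
- exact: measurable_pre (measurable_skew (S := id) (@measurable_id _ X setT) mr) mU.
- exact: rescale_null.
move=> x t /= /not_orP[]; rewrite !symdiffE => /contrapT E1 /contrapT E2.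
have {E1 E2} : twist n (x, pmul (r x) t) <-> twist n.+1 (x, pmul (r x) t) by tauto.
rewrite /twist /preimage/= /skew/=.
rewrite tiltS invposM ?tilt_gt0 ?coord_ratio_gt0//.
by rewrite [pmul (invpos (tilt mu n x)) (invpos _)]pmulC -pmulA !pmulVK.
Qed.

(** The conditional probability of A when the walk stands at a position that turns t into 1 / s. *)
Let F n s : R := fine (P [set x | D n (x, invpos s)]).

Let FE n s : P [set x | D n (x, invpos s)] = (F n s)%:E.
Proof. by rewrite /F fineK// fin_num_measure. Qed.

Let F01 n s : 0 <= F n s <= 1.
Proof. by rewrite fine_ge0//= -lee_fin -FE probability_le1. Qed.

Let mF n : measurable_fun setT (F n).
Proof.
apply: measurableT_comp => //.
rewrite (_ : (fun s => _) = (P \o ysection (D n)) \o @invpos R); last first.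
  apply/funext => s /=; congr (P _).
  by apply/seteqP; split => x; rewrite /ysection/= inE.
apply: (@measurableT_comp _ _ _ _ _ _ (P \o ysection (D n)) _
  (@invpos R : measurableTypeR R -> posreal R)).
  exact: measurable_fun_ysection.
exact: measurable_invpos.
Qed.

(** By [D_step], D n splits according to coordinate n + 1, of which D n.+1 is independent. *)
Let F_harmonic n : \forall s \ae leb, 0 < s -> F n s =
  wt nu n.+1%:Z false * F n.+1 (coord_ratio mu n false * s) +
  (1 - wt nu n.+1%:Z false) * F n.+1 (coord_ratio mu n true * s).
Proof.
have [M [mM M0 MD]] := D_step n.
have [N [mN N0 sN]] := product_kappa0_null mM M0.
exists N; split => // s Hs; apply: sN => Ms0; apply: Hs => s0; move/(_ s0) in Ms0.
have mMs : measurable [set x | M (x, invpos s)].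
  exact: measurable_pre (pair2_measurable _) mM.
pose C b := [set x : X | x n.+1%:Z = b] `&` [set x | D n.+1 (x, invpos (coord_ratio mu n b * s))].
have mC b : measurable (C b) by apply: measurableI => //; exact: measurable_coord_eq.
have PC b : P (C b) = (wt nu n.+1%:Z b * F n.+1 (coord_ratio mu n b * s))%:E.
  rewrite EFinM -FE.
  have -> : (wt nu n.+1%:Z b)%:E = P (cylinder [:: n.+1%:Z] (fun=> b)).
    by rewrite cylinderE// big_seq1.
  rewrite -(@product_indep _ _ _ (mem [:: n.+1%:Z])) //.
  - by congr (P _); rewrite cylinder_cons cylinder_nil setIT.
  - exact: measurable_cylinder.
  - exact: depends_on_cylinder.
  - apply: depends_onS (@D_dep n.+1 _) => i; rewrite !unfold_in/= inE.
    by apply: contraTN => /eqP ->; rewrite ltxx.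
apply: EFin_inj; rewrite EFinD -FE.
have -> : 1 - wt nu n.+1%:Z false = wt nu n.+1%:Z true by have := wtD nu n.+1%:Z; lra.
rewrite -!PC -measureU//; last first.
  by apply/seteqP; split => // x [[/= e0 _] [/= e1 _]]; rewrite e0 in e1.
apply: (@measure_eq_off_null _ _ _ _ _ _ [set x | M (x, invpos s)]) => //.
  exact: measurableU.
move=> x Mx; rewrite /= (MD _ _ Mx) -invposM ?coord_ratio_gt0//.
split => [|[[-> ]|[-> ]]//]; rewrite /C/=.
by case: (x n.+1%:Z) => H; [right|left].
Qed.

Let prim_F : exists c, forall n v, 0 < v -> prim (F n) v = c * v.
Proof.
apply: (@harmonic_prim_linear _ (fun n => wt nu n.+1%:Z false) (ratio_gap mu) (coord_ratio mu) F).
- move=> n; rewrite wt_ge0/=.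
  by have := wtD nu n.+1%:Z; have := wt_ge0 nu n.+1%:Z true; lra.
- by move=> n b; exact: coord_ratio_gt0.
- exact: ratio_gap_ge0.
- exact: ratio_gapE.
- exact: mF.
- exact: F01.
- exact: F_harmonic.
- exact: ratio_gap_diverge.
Qed.

(** A cylinder that fixes the coordinates 1, ..., n makes [tilt] a constant tau. There A is a
    rescaling of D n, which is independent of the cylinder, and the mass is the integral of F n (tau
    t) over ]0, 1/u], equal to c / u by linearity of the primitive. *)
Let cylinder_mass : exists c : R, forall n s a (u : R), 0 < u -> uniq s ->
  (forall i, i \in s -> i <= n%:Z) -> (forall k, (k < n)%N -> k.+1%:Z \in s) ->
  m (A `&` (cylinder s a `*` [set t : posreal R | (u <= t%:num)%R])) =
  ((c / u)%:E * P (cylinder s a))%E.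
Proof.
have [c Hc] := prim_F; exists c => n s a u u0 us sn ns.
pose E := [set t : posreal R | u <= t%:num].
pose tau := tilt mu n a.
have tau0 : 0 < tau by exact: tilt_gt0.
have mC : measurable (cylinder s a) by exact: measurable_cylinder.
have mE : measurable E by exact: measurable_ge.
pose D' := (cylinder s a `*` E) `&` skew id (fun=> invpos tau) @^-1` D n.
have mD' : measurable D'.
  apply: measurableI; first exact: measurableX.
  by apply: measurable_pre (mD n); apply: measurable_skew.
transitivity (m D').
  apply: (@measure_eq_off_null _ _ _ _ _ _ (A `+` twist n)) => //.
  - by apply: measurableI => //; exact: measurableX.
  - exact: measurableY mA (mtwist n).
  - exact: A_twist.
  move=> [x t]; rewrite symdiffE => /contrapT AD.
  have tE : cylinder s a x -> tilt mu n x = tau.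
    move=> xa; apply: eq_bigr => k _; rewrite xa//.
    by apply: ns; exact: ltn_ord.
  split => [[Ax [xa ut]]|[[xa ut] Dx]]; do !split => //.
    by move: Ax; rewrite AD /twist /skew/= tE.
  by apply/AD; move: Dx; rewrite /twist /skew/= tE.
rewrite product_kappa0E//.
have sec t : 0 < t -> P [set x | (0 < t)%R /\ D' (x, invpos t)] =
    (if (t <= u^-1)%R then P (cylinder s a) * (F n (tau * t))%:E else 0)%E.
  move=> t0; case: ifPn => tu.
    rewrite -FE -(@product_indep _ _ _ (mem s))//; last 2 first.
    - exact: depends_on_cylinder.
    - apply: depends_onS (@D_dep n _) => i; rewrite !unfold_in/= => ni.
      by apply/negP => /sn; rewrite leNgt ni.
    congr (P _); apply/seteqP; split => x /=.
      by move=> [_ [[xa _]]]; rewrite /skew/= -invposM.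
    move=> [xa Dx]; split => //; split; first split => //=.
      by rewrite /E/= t0 -[u]invrK lef_pV2 ?posrE ?invr_gt0.
    by rewrite /skew/= -invposM.
  rewrite (_ : [set x | _] = set0) ?measure0//.
  apply/seteqP; split => // x /= [_ [[_ ]]]; rewrite /E/= t0 => ut.
  by case/negP: tu; rewrite -[t]invrK lef_pV2 ?posrE ?invr_gt0.
have mFt : measurable_fun setT (fun t => F n (tau * t)).
  by apply: measurableT_comp => //; exact: measurable_scale.
transitivity (\int[leb]_(t in `]0%R, u^-1%R]) (P (cylinder s a) * (F n (tau * t)%R)%:E))%E.
  rewrite [RHS]integral_mkcond; apply: eq_integral => t _.
  rewrite patchE; have [t0|/negP t0] := pselect (is_true (0 < t)).
    by rewrite [LHS]sec// mem_setE in_itv/= t0.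
  rewrite mem_setE in_itv/= (negbTE t0)/= -[RHS](measure0 P); congr (P _).
  by apply/seteqP; split => // x /= [].
rewrite ge0_integralZl//; last 2 first.
- by apply: measurable_funTS; exact/measurable_EFinP.
- by move=> t _; rewrite lee_fin; have /andP[] := F01 n (tau * t).
rewrite muleC; congr (_ * _)%E.
have -> : c / u = prim (fun t => F n (tau * t)) u^-1.
  rewrite prim_scale//; last by move=> t _; have /andP[] := F01 n t.
  rewrite Hc ?mulr_gt0 ?invr_gt0//.
  by field; rewrite !gt_eqF.
rewrite /prim /Rintegral fineK// ge0_fin_numE; last first.
  by apply: integral_ge0 => t _; rewrite lee_fin; have /andP[] := F01 n (tau * t).
apply: (@le_lt_trans _ _ (\int[leb]_(t in `]0%R, u^-1%R]) (cst 1 t))%E).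
  apply: ge0_le_integral => //.
  - by move=> t _; rewrite lee_fin; have /andP[] := F01 n (tau * t).
  - by apply: measurable_funTS; exact/measurable_EFinP.
  - by move=> t _; rewrite lee_fin; have /andP[] := F01 n (tau * t).
by rewrite integral_cst// mul1e leb_itvoc_fin.
Qed.

Let rectangle_mass : exists2 c : R, 0 <= c & forall C (u : R), measurable C -> 0 < u ->
  m (A `&` (C `*` [set t : posreal R | (u <= t%:num)%R])) = ((c / u)%:E * P C)%E.
Proof.
have [c Hc] := cylinder_mass.
(* With n = 0, the empty cylinder and u = 1, c is the mass of the part of A where t >= 1. *)
have c0 : 0 <= c.
  have := @Hc 0%N [::] (fun=> false) 1 ltr01 isT (fun i => ltac:(by rewrite in_nil))
    (fun k => ltac:(by rewrite ltn0)).
  rewrite cylinder_nil [in RHS]probability_setT mule1 divr1 => e.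
  by rewrite -lee_fin -e measure_ge0.
exists c => // C u mC u0; have cu0 : 0 <= c / u by rewrite divr_ge0// ltW.
have mAE : measurable (A `&` (setT `*` [set t : posreal R | u <= t%:num])).
  by apply: measurableI => //; apply: measurableX => //; exact: measurable_ge.
pose m1 := pushforward_measure (mrestr_measure m mAE) measurable_fst.
pose m2 := mscale_measure (NngNum cu0) P.
have m1E C' : m1 C' = m (A `&` (C' `*` [set t : posreal R | u <= t%:num])).
  change (m ((fst @^-1` C') `&` (A `&` (setT `*` [set t : posreal R | u <= t%:num]))) =
    m (A `&` (C' `*` [set t : posreal R | u <= t%:num]))).
  congr (m _); apply/seteqP; split => [[x t] [/= Cx [Ax [_ ut]]]|[x t] [/= Ax [Cx ut]]];
    by do !split.
rewrite -m1E.
apply: (@bits_measure_unique_refined _ _ m1 m2 _ _ C mC).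
  rewrite [X in (X < _)%E]m1E.
  apply: (@le_lt_trans _ _ (m (setT `*` [set t : posreal R | (u <= t%:num)%R]))).
    apply: le_measure; rewrite ?inE; [exact: mAE| |exact: subIsetr].
    by apply: measurableX => //; exact: measurable_ge.
  rewrite product_measure1E//; last exact: measurable_ge.
  by rewrite [X in (X * _)%E]probability_setT mul1e kappa0_ge_fin.
move=> s us; pose n := (\max_(i <- s) `|i|)%N.
pose L := [seq Posz k.+1 | k <- iota 0 n].
have uL : uniq L by rewrite map_inj_uniq ?iota_uniq// => a b [].
exists [seq i <- L | i \notin s].
have ut : uniq ([seq i <- L | i \notin s] ++ s).
  rewrite cat_uniq us filter_uniq//= andbT; apply/hasPn => i is_.
  by rewrite mem_filter is_.
split => // a.
transitivity (((c / u)%:E * P (cylinder ([seq i <- L | i \notin s] ++ s) a))%E); last by [].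
rewrite [LHS]m1E; apply: (Hc n) => //.
  move=> i; rewrite mem_cat mem_filter => /orP[/andP[_ /mapP[k]]|is_].
    by rewrite mem_iota add0n => /andP[_ kn] ->; rewrite lez_nat.
  have : (`|i| <= n)%N by exact: leq_bigmax_seq.
  by move: (n) => n'; lia.
move=> k kn; rewrite mem_cat mem_filter orbC; case: (boolP (_ \in s)) => //= _.
by apply/mapP; exists k => //; rewrite mem_iota.
Qed.

(** As 1 / u is the [kappa0]-mass of the ray from u, A occupies the proportion c of every rectangle,
    hence of every measurable set. For the complement of A this reads 0 = c m(~A). *)
Lemma tail_trivial_family : m A = 0%E \/ m (~` A) = 0%E.
Proof.
have [c c0 Hc] := rectangle_mass.
pose m1 := mrestr_measure m mA.
pose m2 := mscale_measure (NngNum c0) m.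
have H : forall C, measurable C -> m1 C = m2 C.
  apply: product_ray_unique => [C u mC u0|u u0].
    change (m (C `*` [set t : posreal R | (u <= t%:num)%R] `&` A) =
      (c%:E * m (C `*` [set t : posreal R | (u <= t%:num)%R]))%E).
    rewrite setIC Hc// product_measure1E//; last exact: measurable_ge.
    by rewrite EFinM muleAC -muleA -(kappa0_ge u0).
  apply: (@le_lt_trans _ _ (m (setT `*` [set t : posreal R | (u <= t%:num)%R]))).
    have mE : measurable (setT `*` [set t : posreal R | u <= t%:num] : set (X * posreal R)).
      by apply: measurableX => //; exact: measurable_ge.
    change (m ((setT `*` [set t : posreal R | (u <= t%:num)%R]) `&` A) <=
      m (setT `*` [set t : posreal R | (u <= t%:num)%R]))%E.
    by apply: le_measure; rewrite ?inE; [exact: measurableI|exact: mE|exact: subIsetl].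
  rewrite product_measure1E//; last exact: measurable_ge.
  by rewrite [X in (X * _)%E]probability_setT mul1e kappa0_ge_fin.
have : (0 = c%:E * m (~` A))%E.
  have <- : m1 (~` A) = (c%:E * m (~` A))%E by exact/H/measurableC.
  change (0%E = m (~` A `&` A)).
  by rewrite setICl measure0.
move=> /esym/eqP; rewrite mule_eq0 => /orP[/eqP c00|/eqP]; last by right.
left; have : m1 A = (c%:E * m A)%E by exact: H.
by rewrite c00 mul0e => <-; change (m A = m (A `&` A)); rewrite setIid.
Qed.

End one_tail_set.

(** The exactness behind both weak mixing and the K-property. What remains is to choose the events B
    n and the factors h n as sequences. *)
Theorem tail_trivial A : measurable A ->
  (forall n, exists B, [/\ measurable B,
    forall u, depends_on (fun i : int => 0 < i) (fun x => B (x, u)) &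
    m (A `+` (iter n S @^-1` B)) = 0%E]) ->
  m A = 0%E \/ m (~` A) = 0%E.
Proof.
move=> mA /choice[B HB].
have iT : invertible_borel bits_shift by case: hT.
have /choice[h Hh] n := cocycle_factor hmu iT wT n.
apply: (@tail_trivial_family A B h) => // n.
- by case: (HB n).
- by case: (HB n).
- by case: (HB n).
- by case: (Hh n).
- by case: (Hh n).
- by case: (Hh n).
Qed.

End tail_sets.

(** * Products of sigma-finite measures, iterates and sections *)

Section sigma_finite_products.
Context d1 d2 (T1 : measurableType d1) (T2 : measurableType d2) (R : realType).
Variables (m1 : {sigma_finite_measure set T1 -> \bar R})
  (m2 : {sigma_finite_measure set T2 -> \bar R}).

Lemma product_sigma_finite : sigma_finite setT (m1 \x m2)%E.
Proof.
have /sigma_finiteP[F [TF ndF Foo]] := sigma_finiteT m1.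
have /sigma_finiteP[G [TG ndG Goo]] := sigma_finiteT m2.
exists (fun n => F n `*` G n).
  apply/seteqP; split => // -[x y] _.
  have [n _ Fx] : (\bigcup_n F n) x by rewrite -TF.
  have [k _ Gy] : (\bigcup_n G n) y by rewrite -TG.
  exists (maxn n k) => //; split.
    by move: x Fx; exact/subsetPset/ndF/leq_maxl.
  by move: y Gy; exact/subsetPset/ndG/leq_maxr.
move=> k; have [mF Fk] := Foo k; have [mG Gk] := Goo k; split; first exact: measurableX.
by rewrite product_measure1E// lte_mul_pinfty// ge0_fin_numE.
Qed.

(* The library's canonical sigma-finite structure on [m1 \x m2] only applies to
   finite measures. *)
Definition product_sf : {sigma_finite_measure set (T1 * T2)%type -> \bar R} :=
  HB.pack (product_measure1 m1 m2)
    (Measure_isSigmaFinite.Build _ _ _ (product_measure1 m1 m2) product_sigma_finite)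
    (Measure.class (lebesgue_integral_fubini_product_measure1__canonical__measure_function_Measure m1 m2)).

End sigma_finite_products.

Section iterates_of_preserving_maps.
Context d (Y : measurableType d) (R : realType) (m : {measure set Y -> \bar R}) (f : Y -> Y).
Hypothesis mf : measurable_fun setT f.
Hypothesis fm : measure_preserving m f.

Lemma measurable_iter n : measurable_fun setT (iter n f).
Proof. by elim: n => [|n IH]; [exact: measurable_id|exact: (measurableT_comp mf IH)]. Qed.

Lemma measure_preserving_iter n : measure_preserving m (iter n f).
Proof.
elim: n => [A _ //|n IH A mA]; rewrite iterS_preimage.
apply: etrans (fm mA); apply: IH; exact: measurable_pre mf mA.
Qed.

End iterates_of_preserving_maps.

Section null_sets_by_ysections.
Context d1 d2 (T1 : measurableType d1) (T2 : measurableType d2) (R : realType).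
Variables (m1 : {sigma_finite_measure set T1 -> \bar R})
  (m2 : {sigma_finite_measure set T2 -> \bar R}).

Lemma measurable_ysection_null (A : set (T1 * T2)) : measurable A ->
  measurable [set y | m1 (ysection A y) = 0%E].
Proof.
move=> mA; rewrite (_ : [set y | _] = (m1 \o ysection A) @^-1` [set 0%E]).
  by apply: measurable_pre; [exact: measurable_fun_ysection|exact: emeasurable_set1].
by apply/seteqP; split.
Qed.

Lemma product_ysection_null (A : set (T1 * T2)) : measurable A ->
  (m1 \x m2)%E A = 0%E <-> m2 [set y | m1 (ysection A y) <> 0%E] = 0%E.
Proof.
move=> mA; have mf := measurable_fun_ysection m1 mA.
have mN : measurable [set y | m1 (ysection A y) <> 0%E].
  exact: measurableC (measurable_ysection_null mA).
have -> : (m1 \x m2)%E A = (\int[m2]_y `|m1 (ysection A y)|)%E.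
  transitivity ((m1 \x^ m2)%E A).
    apply: product_measure_unique => //= ? ? ? ?.
    by rewrite [LHS]product_measure2E.
  by apply: eq_integral => y _; rewrite gee0_abs.
rewrite (ae_eq_integral_abs m2 measurableT mf); split.
  by move=> [Z [mZ Z0 sZ]]; apply: null_sub Z0 _ => // y /= ny; apply: sZ => /= /(_ I).
move=> N0; exists [set y | m1 (ysection A y) <> 0%E]; split => //.
by move=> y /= Hy ny; apply: Hy => _.
Qed.

End null_sets_by_ysections.

(** * Invariant null sets, and a version of the derivative that sees only the future *)

Section invariant_null_covers.
Context d (X : measurableType d) (R : realType) (P : {measure set X -> \bar R}) (S : X -> X).
Hypothesis nsS : nonsingular P S.

(** The saturation of N along orbits: first all preimages, then all their images. *)
Lemma invariant_null_cover N : measurable N -> P N = 0%E ->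
  exists M, [/\ measurable M, P M = 0%E, N `<=` M & forall x, M (S x) <-> M x].
Proof.
have [iS _] := nsS; have iSn n := invertible_borel_iter n iS.
move=> mN N0.
pose M0 := \bigcup_n (iter n S @^-1` N).
have mpre n : measurable (iter n S @^-1` N) by case: (iSn n) => ? _; exact: measurable_pre.
have mM0 : measurable M0 by exact: bigcupT_measurable.
have M00 : P M0 = 0%E.
  by apply: null_bigcup => // n; apply/(nonsingular_iter_null nsS).
have img n C : measurable C -> P C = 0%E -> P (iter n S @` C) = 0%E.
  move=> mC C0; apply/(nonsingular_iter_null nsS n); first exact: invertible_borel_image.
  by rewrite preimage_image_inv.
exists (\bigcup_n (iter n S @` M0)); split.
- by apply: bigcupT_measurable => n; exact: invertible_borel_image.
- apply: null_bigcup => n; first exact: invertible_borel_image.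
  exact: img.
- by move=> x Nx; exists 0%N => //; exists x => //; exists 0%N.
move=> x; split.
  move=> [[|n] _ [y M0y /= e]].
    case: M0y => k _ Nk; exists 0%N => //; exists x => //; exists k.+1 => //.
    by rewrite /preimage/= -iterS iterSr -e.
  by exists n => //; exists y => //; exact: (invertible_borel_inj iS).
by move=> [n _ [y M0y <-]]; exists n.+1 => //; exists y.
Qed.

End invariant_null_covers.

Section future_versions.
Context (R : realType) (mu : nat -> probability bool R).
Hypothesis hmu : forall n, (1 <= n)%N -> 0 < fine (mu n [set false]) < 1.
Local Notation P := (infinite_product (two_sided mu)).
Hypothesis hT : nonsingular P bits_shift.

(** The case n = 1 of [cocycle_factor]: coordinate 1 has law mu_1, so [tilt mu 1] is 1 and the
    derivative is h itself. *)
Lemma future_rn_derivative : exists w, [/\ is_rn_derivative P bits_shift w,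
  depends_on (fun i : int => 0 < i) w &
  exists N, [/\ measurable N, P N = 0%E &
    forall x, ~ N x -> rn_derivative P bits_shift x = w x]].
Proof.
have [iT _] := hT; have [mr rE] := rn_derivative_finite hT.
have [h [mh dh [N [mN N0 sN]]]] := cocycle_factor hmu iT (conj mr rE) 1.
have rh x : ~ N x -> rn_derivative P bits_shift x = h x.
  move=> Nx; have : cocycle bits_shift (rn_derivative P bits_shift) 1 x =
      pmul (invpos (tilt mu 1 x)) (h x).
    by apply: contrapT => H; apply: Nx; exact: sN.
  rewrite /cocycle pmul1 => ->.
  rewrite (_ : invpos _ = 1%:pos); first by rewrite pmul1.
  apply/val_inj; rewrite /= tilt_gt0// /tilt big_ord1 /coord_ratio.
  by rewrite divff ?invr1// gt_eqF// two_sided_wt_gt0.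
exists h; split; last by exists N.
- split => // A mA; rewrite rE//; apply: ae_eq_integral => //.
  + by apply: measurable_funTS; apply/measurable_EFinP; exact: measurable_num_comp.
  + by apply: measurable_funTS; apply/measurable_EFinP; exact: measurable_num_comp.
  + exists N; split => // x /= Hx; apply: contrapT => Nx; apply: Hx => _.
    by rewrite rh.
- by apply: depends_onS dh => i; rewrite !unfold_in/=; apply: lt_trans.
Qed.

End future_versions.

(** * Ergodicity of the product of the skew product with an ergodic Q *)

Section weak_mixing_of_skew_product.
Context (R : realType) (mu : nat -> probability bool R).
Hypothesis hmu : forall n, (1 <= n)%N -> 0 < fine (mu n [set false]) < 1.
Local Notation nu := (two_sided mu).
Local Notation X := (bits int).
Local Notation P := (infinite_product nu).
Local Notation kap := (@kappa0 R).
Local Notation m := (P \x kap)%E.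
Hypothesis hT : nonsingular P bits_shift.
Hypothesis consT : conservative P bits_shift.
Hypothesis sum_inf : (\sum_(1 <= n <oo) ((fine (mu n [set false]) -
  fine (mu 1%N [set false])) ^+ 2)%:E = +oo)%E.
Variable w : X -> posreal R.
Hypothesis wT : is_rn_derivative P bits_shift w.
Hypothesis dw : depends_on (fun i : int => 0 < i) w.
Local Notation S := (skew bits_shift w).

Let mw : measurable_fun setT w. Proof. by case: wT. Qed.
Let iT : invertible_borel bits_shift. Proof. by case: hT. Qed.
Let mS : measurable_fun setT S.
Proof. by apply: measurable_skew => //; exact: (measurable_shift 1). Qed.
Let mSn n : measurable_fun setT (iter n S).
Proof. exact: measurable_iter. Qed.
Let Sm : measure_preserving m S.
Proof. by apply: skew_preserving => //; exact: kappa0_scaling. Qed.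

Let T' := shift (-1).
Let S' (p : X * posreal R) : X * posreal R := (T' p.1, pmul (pinv (w (T' p.1))) p.2).

Let TK : cancel bits_shift T'.
Proof. by move=> x; apply/funext => i; rewrite /T' /shift /bits_shift; congr x; ring. Qed.
Let T'K : cancel T' bits_shift.
Proof. by move=> x; apply/funext => i; rewrite /T' /shift /bits_shift; congr x; ring. Qed.
Let SK : cancel S S'.
Proof. by move=> [x t]; rewrite /S' /skew/= TK pmulK. Qed.
Let S'K : cancel S' S.
Proof. by move=> [x t]; rewrite /S' /skew/= T'K pmulVK. Qed.
Let mT' : measurable_fun setT T'. Proof. exact: measurable_shift. Qed.
Let mS' : measurable_fun setT S'.
Proof.
apply: (@measurable_skew _ _ _ T' (fun x => pinv (w (T' x)))) => //.
by apply: measurable_pinv; exact: (measurableT_comp mw mT').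
Qed.

Context dZ (Z : measurableType dZ) (PZ : probability Z R) (Q Q' : Z -> Z).
Hypothesis mQ : measurable_fun setT Q.
Hypothesis mQ' : measurable_fun setT Q'.
Hypothesis QK : cancel Q Q'.
Hypothesis Q'K : cancel Q' Q.
Hypothesis pQ : measure_preserving PZ Q.
Hypothesis eQ : ergodic PZ Q.

Let V (y : (X * posreal R) * Z) := (S y.1, Q y.2).
Let V' (y : (X * posreal R) * Z) := (S' y.1, Q' y.2).

Let iterV n y : iter n V y = (iter n S y.1, iter n Q y.2).
Proof. by elim: n => [|n IH]; [case: y|rewrite !iterS IH]. Qed.

(** The sets [D k], where t >= 1 / (k + 1), have finite measure, and an orbit is back in its [D k]
    whenever the cocycle is at least 1, since t has then not decreased. *)
Let V_recurrence C i : measurable C ->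
  (m \x PZ)%E [set y | C y /\ forall n, (i <= n)%N -> ~ C (iter n V' y)] = 0%E.
Proof.
move=> mC.
pose E (k : nat) := [set t : posreal R | k.+1%:R^-1 <= t%:num].
pose D (k : nat) : set ((X * posreal R) * Z) := (setT `*` E k) `*` setT.
have mE k : measurable (E k) by exact: measurable_ge.
have mTE k : measurable (setT `*` E k : set (X * posreal R)) by exact: measurableX.
have pV : measure_preserving (m \x PZ)%E V :=
  @product_preserving _ _ _ _ R (product_sf P kap) PZ S Q mS mQ Sm pQ.
apply: (@recurrence _ _ _ (m \x PZ)%E V V' D) => //.
- exact: measurable_prod_map.
- exact: measurable_prod_map.
- by move=> [p z]; rewrite /V /V'/= SK QK.
- by move=> [p z]; rewrite /V /V'/= S'K Q'K.
- by move=> k; exact: measurableX.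
- move=> k; change ((m \x PZ)%E ((setT `*` E k) `*` setT) < +oo)%E.
  rewrite product_measure1E// [X in (_ * X)%E]probability_setT mule1.
  rewrite [X in (X < _)%E]product_measure1E// [X in (X * _)%E]probability_setT mul1e.
  by rewrite kappa0_ge_fin.
- apply/seteqP; split => // -[[x t] z] _; exists (Num.truncn (t%:num^-1)) => //=.
  do !split => //; rewrite /E/= -[leRHS]invrK lef_pV2 ?posrE ?invr_gt0//.
  exact/ltW/truncnS_gt.
move=> k; have [N [mN N0 HN]] := cocycle_ge1_infinitely_often hT consT wT.
exists ((N `*` setT) `*` setT); split.
- by apply: measurableX => //; exact: measurableX.
- change ((m \x PZ)%E ((N `*` setT) `*` setT) = 0%E).
  rewrite product_measure1E//; last exact: measurableX.
  by rewrite [X in (X * _)%E](null_fst mN N0) mul0e.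
move=> [[x t] z] [[_ /= Et] _] Nx i'.
have [n in_ cn] : exists2 n, (i' <= n)%N & 1 <= (cocycle bits_shift w n x)%:num.
  by apply: HN => Nx'; apply: Nx.
exists n => //; rewrite iterV iter_skew /skew/=; do !split => //.
by rewrite /E/= (le_trans Et)// ler_peMl.
Qed.

Let W := (posreal R * Z)%type.
(** Together with [Vf], the inverse of V with t and z grouped as one component, in the form to which
    [invariant_future] applies. As w sees positive coordinates, g sees the nonnegative ones. *)
Let g (x : X) (u : W) : W := (pmul (pinv (w (T' x))) u.1, Q' u.2).
Let Vf (p : X * W) : X * W := (T' p.1, g p.1 p.2).

Let Vf_assoc n y : iter n Vf (prod_assoc y) = prod_assoc (iter n V' y).
Proof. by elim: n => // n IH; rewrite !iterS IH. Qed.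

Let mVf : measurable_fun setT Vf.
Proof.
have mx : measurable_fun setT (fun p : X * W => p.1) by exact: measurable_fst.
have mu2 : measurable_fun setT (fun p : X * W => p.2) by exact: measurable_snd.
apply/measurable_fun_pairP; split; first exact: (measurableT_comp mT' mx).
apply/measurable_fun_pairP; split.
  apply: (@measurable_pmul _ _ _ _ (fun p : X * W => pinv (w (T' p.1))) (fun p => p.2.1)).
    by apply: measurable_pinv; exact: (measurableT_comp mw (measurableT_comp mT' mx)).
  exact: (measurableT_comp measurable_fst mu2).
exact: (measurableT_comp mQ' (measurableT_comp measurable_snd mu2)).
Qed.

Let Vf_recurrence C i : measurable C ->
  (P \x (kap \x PZ))%E [set y | C y /\ forall n, (i <= n)%N -> ~ C (iter n Vf y)] = 0%E.
Proof.
move=> mC; rewrite -product_measureA; last first.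
  have mVn n : measurable_fun setT (iter n Vf) by exact: measurable_iter.
  rewrite (_ : [set y | _] = C `&` \bigcap_n (~` (iter (n + i) Vf @^-1` C))).
    apply: measurableI => //; apply: bigcapT_measurable => n.
    by apply: measurableC; exact: measurable_pre (mVn _) mC.
  apply/seteqP; split => y [Cy H]; split => //.
    by move=> n _; apply: H; rewrite leq_addl.
  by move=> n jn; have := H (n - i)%N I; rewrite /= subnK.
have mC' : measurable (@prod_assoc _ _ _ X (posreal R) Z @^-1` C).
  by apply: measurable_pre mC; exact: measurable_prod_assoc.
rewrite -[RHS](V_recurrence i mC'); congr ((_ \x _)%E _).
by apply/seteqP; split => y [Cy H]; split => // n jn; have := H n jn; rewrite Vf_assoc.
Qed.

(** [invariant_future] makes an invariant A an event of the future. Its section at z is the S^-n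
    preimage of its section at Q^n z, so almost every section is a tail event, hence null or conull.
    The set of z with a null section is Q-invariant, and Q is ergodic. *)
Lemma skew_product_ergodic : ergodic (m \x PZ)%E V.
Proof.
move=> A mA VA.
pose unassoc (p : X * W) : (X * posreal R) * Z := ((p.1, p.2.1), p.2.2).
have munassoc : measurable_fun setT unassoc.
  apply/measurable_fun_pairP; split; last exact: (measurableT_comp measurable_snd measurable_snd).
  apply/measurable_fun_pairP; split; first exact: measurable_fst.
  exact: (measurableT_comp measurable_fst measurable_snd).
pose A1 := unassoc @^-1` A.
have mA1 : measurable A1 by exact: measurable_pre munassoc mA.
have V'A y : A (V' y) <-> A y.
  have VV' : V (V' y) = y by case: y => p z; rewrite /V /V'/= S'K Q'K.
  change (A (V' y) <-> A y); rewrite -{2}VV'.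
  by change (A (V' y) <-> (V @^-1` A) (V' y)); rewrite VA.
have invA1 : Vf @^-1` A1 = A1.
  by apply/seteqP; split => -[x [t z]] /=; apply (V'A ((x, t), z)).
have g_dep u : depends_on (fun i : int => 0 <= i) (fun x => g x u).
  move=> x x' xx'; rewrite /g; congr (pmul (pinv _) _, _).
  by apply: dw => i i0; rewrite /T' /shift; apply: xx'; lia.
have past_st (N : nat) i b : i <= 0 -> wt nu (i - N%:Z) b = wt nu i b.
  by move=> i0; rewrite two_sided_past ?[RHS]two_sided_past//; lia.
have [B1 [mB1 fB1 AB1]] := @invariant_future R nu _ _ (product_sf kap PZ) past_st
  Vf g mVf (fun x u => erefl) g_dep Vf_recurrence A1 mA1 invA1.
pose B := @prod_assoc _ _ _ X (posreal R) Z @^-1` B1.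
have mB : measurable B by apply: measurable_pre mB1; exact: measurable_prod_assoc.
have mAB : measurable (A `+` B) by exact: measurableY.
have AB : (m \x PZ)%E (A `+` B) = 0%E.
  have mAB1 : measurable (A1 `+` B1) by exact: measurableY.
  have := product_measureA P kap PZ mAB1.
  rewrite AB1 => <-; congr ((_ \x _)%E _).
  by apply/seteqP; split => -[[x t] z].
pose bad := [set z | m (ysection (A `+` B) z) <> 0%E].
have bad0 : PZ bad = 0%E.
  exact: (@product_ysection_null _ _ _ _ R (product_sf P kap) PZ _ mAB).1 AB.
have mbad : measurable bad.
  exact: measurableC (@measurable_ysection_null _ _ _ _ R (product_sf P kap) _ mAB).
(* Off this null set the section at Q^n z is an event of the future, up to a null set, for every n
   at once. *)
pose N := \bigcup_n (iter n Q @^-1` bad).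
have mQbad n : measurable (iter n Q @^-1` bad) by exact: measurable_pre (measurable_iter mQ n) mbad.
have mN : measurable N by exact: bigcupT_measurable.
have N0 : PZ N = 0%E.
  by apply: null_bigcup => // n; rewrite [LHS](measure_preserving_iter mQ pQ).
have iterA n p z : A (p, z) <-> A (iter n S p, iter n Q z).
  elim: n => // n IH; rewrite IH !iterS.
  change (A (iter n S p, iter n Q z) <-> (V @^-1` A) (iter n S p, iter n Q z)).
  by rewrite VA.
have tail z : ~ N z -> m (ysection A z) = 0%E \/ m (~` ysection A z) = 0%E.
  move=> Nz; apply: (tail_trivial hmu hT consT sum_inf wT); first exact: measurable_ysection.
  move=> n; exists (ysection B (iter n Q z)); split.
  - exact: measurable_ysection.
  - move=> t x x' xx'; rewrite /ysection/= !inE.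
    apply: (fB1 (t, iter n Q z)) => i; rewrite /= /past => ni; apply: xx'.
    by move: ni; rewrite -ltNge; lia.
  have -> : ysection A z = iter n S @^-1` ysection A (iter n Q z).
    by apply/seteqP; split => p; rewrite /preimage/= /ysection/= !inE (iterA n p z).
  have ysY z' : ysection A z' `+` ysection B z' = ysection (A `+` B) z'.
    by apply/seteqP; split => p; rewrite /ysection /setY /=; rewrite !inE.
  have -> : iter n S @^-1` ysection A (iter n Q z) `+` iter n S @^-1` ysection B (iter n Q z) =
      iter n S @^-1` ysection (A `+` B) (iter n Q z) by rewrite -ysY.
  have mAB' : measurable (ysection (A `+` B) (iter n Q z)) by exact: measurable_ysection.
  rewrite [LHS](measure_preserving_iter mS Sm n mAB').
  by apply: contrapT => H; apply: Nz; exists n.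
pose Z0 := [set z | m (ysection A z) = 0%E].
have mZ0 : measurable Z0 by exact: (@measurable_ysection_null _ _ _ _ R (product_sf P kap) _ mA).
have QZ0 : Q @^-1` Z0 = Z0.
  have e z : ysection A z = S @^-1` ysection A (Q z).
    by apply/seteqP; split => p; rewrite /preimage/= /ysection/= !inE (iterA 1%N p z).
  have mAz z : m (ysection A z) = m (ysection A (Q z)).
    rewrite [in LHS]e; apply: Sm; exact: measurable_ysection.
  by apply/funext => z; rewrite /Z0 /preimage/= -mAz.
have [Z00|Z01] := eQ mZ0 QZ0; [right|left].
  apply/(@product_ysection_null _ _ _ _ R (product_sf P kap) PZ); first exact: measurableC.
  apply: (@null_sub _ _ _ _ _ (Z0 `|` N)).
  - exact: measurableC (@measurable_ysection_null _ _ _ _ R (product_sf P kap) _ (measurableC mA)).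
  - exact: measurableU.
  - exact: null_setU.
  move=> z H; have [Nz|Nz] := pselect (N z); [by right|left].
  have [//|H'] := tail z Nz; case: H; rewrite -[RHS]H'; congr ((_ \x _)%E _).
  by apply/seteqP; split => p; rewrite /ysection/= !inE.
by apply/(@product_ysection_null _ _ _ _ R (product_sf P kap) PZ).
Qed.

End weak_mixing_of_skew_product.

(** * Measure-preserving maps: weak mixing implies ergodicity, and the derivative is 1 *)

Section preserving_maps.
Context d (Y : measurableType d) (R : realType).
Implicit Types (S : Y -> Y).

(** The second factor is taken to be the identity of a one-point space. *)
Lemma weakly_mixing_ergodic (m : {measure set Y -> \bar R}) S :
  weakly_mixing m S -> ergodic m S.
Proof.
move=> wm A mA SA.
have std : standard_borel unit R.
  exists (fun=> 0); split => //; first by move=> [] [].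
  move=> B _; rewrite (_ : [set _ | _ in _] = if `[< B tt >] then [set 0] else set0).
    by case: ifP => _; [exact: measurable_set1|exact: measurable0].
  apply/seteqP; split => x /=.
    by move=> [[] Btt <-]; rewrite asboolT.
  by case: asboolP => // Btt ->; exists tt.
have inv : invertible_borel (@id unit) by split => //; exists id.
have erg : ergodic (\d_tt : probability unit R) id.
  move=> B _ _; rewrite /= !diracE; case: (pselect (B tt)) => Btt; [right|left].
    by rewrite memNset//=.
  by rewrite memNset.
have mAT : measurable (A `*` [set: unit]) by exact: measurableX.
have [|H|H] := wm _ _ (\d_tt : probability unit R) id std inv (fun _ _ => erefl) erg
    (A `*` setT) mAT.
- by rewrite -[in RHS]SA; apply/seteqP; split.
- left; have := product_measure1E m (\d_tt : probability unit R) mA measurableT.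
  by rewrite H [X in (_ * X)%E]probability_setT mule1.
- right; have := product_measure1E m (\d_tt : probability unit R) (measurableC mA) measurableT.
  rewrite [X in (_ * X)%E]probability_setT mule1 => <-.
  rewrite -[RHS]H; congr ((_ \x _)%E _); apply/seteqP; split => -[y z] /=; tauto.
Qed.

Lemma preserving_nonsingular (m : {measure set Y -> \bar R}) S :
  invertible_borel S -> measure_preserving m S -> nonsingular m S.
Proof.
move=> iS mS; split => //; split => A A0 B mB BA.
  by rewrite /pushforward mS//; exact: A0.
by rewrite -(mS _ mB); exact: A0.
Qed.

(** On each set of finite measure of an exhaustion, the chosen derivative and the constant 1 have
    the same integrals. *)
Lemma preserving_rn_derivative (m : {sigma_finite_measure set Y -> \bar R}) S :
  invertible_borel S -> measure_preserving m S ->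
  {ae m, forall y, rn_derivative m S y = 1%:pos}.
Proof.
move=> iS mS; have [mr rE] := rn_derivative_preserving iS mS.
have /sigma_finiteP[E [ET ndE Efin]] := sigma_finiteT m.
have mrE : measurable_fun setT (fun y => (rn_derivative m S y)%:num%:E).
  by apply/measurable_EFinP; exact: measurable_num_comp.
have eqE n : ae_eq m (E n) (cst 1%E) (fun y => (rn_derivative m S y)%:num%:E).
  have [mE Ey] := Efin n; apply: integral_ae_eq => //.
  - apply/integrableP; split => //.
    by rewrite (eq_integral (cst 1%E)) ?integral_cst ?mul1e// => y _; rewrite gee0_abs.
  - exact: measurable_funTS.
  - move=> B _ mB; rewrite -rE// integral_cst// mul1e.
    by have := mS _ (invertible_borel_image iS mB); rewrite preimage_image_inv.
have /choice[N HN] n : exists N, [/\ measurable N, m N = 0%E &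
    forall y, E n y -> ~ N y -> rn_derivative m S y = 1%:pos].
  have [N [mN N0 sN]] := eqE n; exists N; split => // y Ey Ny.
  apply: contrapT => H; apply: Ny; apply: sN => /(_ Ey) [e]; apply: H.
  exact/val_inj.
exists (\bigcup_n N n); split.
- by apply: bigcupT_measurable => n; case: (HN n).
- by apply: null_bigcup => n; case: (HN n).
move=> y /= H; have [n _ Ey] : (\bigcup_n E n) y by rewrite -ET.
exists n => //; apply: contrapT => Ny; apply: H.
by case: (HN n) => _ _; exact.
Qed.

End preserving_maps.

(** * The measures kappa of the Maharam extension *)

Section maharam_measures.
Context (R : realType) (kappa : {sigma_finite_measure set (posreal R) -> \bar R}).

Lemma maharam_kappa_scaling : maharam_kappa kappa -> scaling_measure kappa.
Proof.
move=> [_ H] a B mB; have := H (pinv a) B mB.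
rewrite (_ : [set _ | _ in B] = pmul a @^-1` B).
  by rewrite /= invrK.
apply/seteqP; split => t /=.
  by move=> [s Bs <-]; rewrite -[pinv _]/(pinv a) -/(pmul (pinv a) s) pmulVK.
by move=> Bt; exists (pmul a t) => //; rewrite -/(pmul (pinv a) _) pmulK.
Qed.

Lemma maharam_kappa_neq0 : maharam_kappa kappa -> kappa setT != 0%E.
Proof.
move=> [[_ dom] _]; apply/negP => /eqP k0.
have : lebesgue_measure ((fun t : posreal R => t%:num) @` setT) = 0%E.
  apply: (dom setT) => // B mB _; apply/eqP.
  by rewrite eq_le measure_ge0 andbT -k0; apply: le_measure; rewrite ?inE.
rewrite (_ : _ @` setT = `]0, +oo[%classic).
  by rewrite lebesgue_measure_itv/= ltry addye.
apply/seteqP; split => s /=; rewrite in_itv/= andbT; first by move=> [t _ <-].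
by move=> s0; exists (PosNum s0).
Qed.

End maharam_measures.

(** * The Maharam extension of the shift, compared with the skew product by w *)

Section maharam_of_shift.
Context (R : realType) (mu : nat -> probability bool R).
Hypothesis hmu : forall n, (1 <= n)%N -> 0 < fine (mu n [set false]) < 1.
Local Notation nu := (two_sided mu).
Local Notation X := (bits int).
Local Notation P := (infinite_product nu).
Local Notation kap := (@kappa0 R).
Local Notation m := (P \x kap)%E.
Hypothesis hT : nonsingular P bits_shift.
Hypothesis consT : conservative P bits_shift.
Hypothesis sum_inf : (\sum_(1 <= n <oo) ((fine (mu n [set false]) -
  fine (mu 1%N [set false])) ^+ 2)%:E = +oo)%E.

Variables (w : X -> posreal R) (M : set X).
Hypothesis wT : is_rn_derivative P bits_shift w.
Hypothesis dw : depends_on (fun i : int => 0 < i) w.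
Hypothesis mM : measurable M.
Hypothesis M0 : P M = 0%E.
Hypothesis shiftM : forall x, M (bits_shift x) <-> M x.
Hypothesis wE : forall x, ~ M x -> rn_derivative P bits_shift x = w x.

Variable kappa : {sigma_finite_measure set (posreal R) -> \bar R}.
Hypothesis scal : scaling_measure kappa.
Hypothesis kappa_neq0 : kappa setT != 0%E.
Local Notation mk := (P \x kappa)%E.
Local Notation S := (maharam P bits_shift).
Local Notation S0 := (skew bits_shift w).

Let iT : invertible_borel bits_shift. Proof. by case: hT. Qed.
Let rT : is_rn_derivative P bits_shift (rn_derivative P bits_shift).
Proof. exact: rn_derivative_finite. Qed.
Let iS : invertible_borel S.
Proof. by apply: (@invertible_skew _ _ _ bits_shift) => //; case: rT. Qed.
Let mS : measurable_fun setT S. Proof. by case: iS. Qed.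
Let mS0 : measurable_fun setT S0.
Proof. by apply: measurable_skew; [case: iT|case: wT]. Qed.
Let S_kappa : measure_preserving mk S.
Proof. exact: (@skew_preserving _ _ _ P bits_shift). Qed.
Let S_m : measure_preserving m S.
Proof. by apply: (@skew_preserving _ _ _ P bits_shift) => //; exact: kappa0_scaling. Qed.
Let S0_m : measure_preserving m S0.
Proof. by apply: skew_preserving => //; exact: kappa0_scaling. Qed.

(** This transfers every statement about null sets from [kappa0] to a general kappa. *)
Let kappa_null B : measurable B -> kap B = 0%E <-> kappa B = 0%E.
Proof.
by move=> mB; split; apply: scaling_measure_dominates => //;
   [exact: kappa0_scaling|exact: kappa0_neq0|exact: kappa0_scaling].
Qed.

Let mk_null A : measurable A -> m A = 0%E <-> mk A = 0%E.
Proof. by move=> mA; apply: product_null_eq => // B; exact: kappa_null. Qed.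

Let iterM n x : M (iter n bits_shift x) <-> M x.
Proof. by elim: n => // n IH; rewrite iterS shiftM. Qed.

Let S_S0 x t : ~ M x -> S (x, t) = S0 (x, t).
Proof. by move=> Mx; rewrite /maharam /skew/= wE. Qed.

Let iterS0 n x t : ~ M x -> iter n S (x, t) = iter n S0 (x, t).
Proof.
elim: n x t => // n IH x t Mx; rewrite !iterSr.
by rewrite S_S0//; apply: IH; rewrite shiftM.
Qed.

Let mMT : measurable (M `*` setT : set (X * posreal R)).
Proof. exact: measurableX. Qed.
Let MT0 : m (M `*` setT) = 0%E := null_fst mM M0.

(** Off the shift-invariant null set M the extension coincides with the skew product by w, so
    removing M from an invariant set gives one to which [skew_product_ergodic] applies. *)
Lemma maharam_weakly_mixing : weakly_mixing mk S.
Proof.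
move=> dZ Z PZ Q _ [mQ [Q' mQ' [QK Q'K]]] pQ eQ A mA SA.
have null_kappa C : measurable C -> (m \x PZ)%E C = 0%E -> (mk \x PZ)%E C = 0%E.
  move=> mC /(@product_ysection_null _ _ _ _ R (product_sf P kap) PZ _ mC) C0.
  apply/(@product_ysection_null _ _ _ _ R (product_sf P kappa) PZ _ mC).
  rewrite -[RHS]C0; congr (PZ _); apply/funext => z /=; apply/propext.
  by split; apply: contra_not => H; apply/(mk_null _) => //; exact: measurable_ysection.
pose MTT : set ((X * posreal R) * Z) := (M `*` setT) `*` setT.
have mMTT : measurable MTT by exact: measurableX.
have MTT0 : (m \x PZ)%E MTT = 0%E.
  by rewrite product_measure1E// [X in (X * _)%E]MT0 mul0e.
pose A' := A `\` MTT.
have mA' : measurable A' by exact: measurableD.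
have VA' : (fun p => (S0 p.1, Q p.2)) @^-1` A' = A'.
  have SAE x t z : ~ M x -> A (S0 (x, t), Q z) <-> A ((x, t), z).
    move=> Mx; rewrite -(S_S0 t Mx).
    change (((fun p => (S p.1, Q p.2)) @^-1` A) ((x, t), z) <-> A ((x, t), z)).
    by rewrite SA.
  apply/seteqP; split => -[[x t] z] [/= H1 H2].
    have Mx : ~ M x by move=> Mx; apply: H2; do !split => //=; exact/shiftM.
    by split; [exact/SAE|move=> [[]]].
  have Mx : ~ M x by move=> Mx; apply: H2.
  by split; [exact/SAE|move=> [[/= /shiftM]]].
have [H|H] := skew_product_ergodic hmu hT consT sum_inf wT dw mQ mQ' QK Q'K pQ eQ mA' VA'.
  left; apply: null_kappa => //; apply: (@null_sub _ _ _ _ _ (A' `|` MTT)) => //.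
  - exact: measurableU.
  - exact: null_setU.
  by move=> y Ay; have [My|My] := pselect (MTT y); [right|left].
right; apply: null_kappa; first exact: measurableC.
apply: (@null_sub _ _ _ _ _ (~` A')) => //; try exact: measurableC.
by move=> y nA [].
Qed.

(** An invariant set of the shift, times the positive reals, is an invariant set of the
    extension. *)
Lemma shift_ergodic : ergodic P bits_shift.
Proof.
move=> A mA TA.
have mAT : measurable (A `*` setT : set (X * posreal R)) by exact: measurableX.
have SAT : S @^-1` (A `*` setT) = A `*` setT.
  by rewrite -[in RHS]TA; apply/seteqP; split.
have cancel_kappa B : measurable B -> mk (B `*` setT) = 0%E -> P B = 0%E.
  move=> mB; rewrite product_measure1E// => /eqP.
  by rewrite mule_eq0 (negbTE kappa_neq0) orbF => /eqP.
have [H|H] := weakly_mixing_ergodic maharam_weakly_mixing mAT SAT; [left|right].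
  exact: cancel_kappa.
apply: cancel_kappa; first exact: measurableC.
by rewrite -[RHS]H; congr ((_ \x _)%E _); apply/seteqP; split => -[x t] /=; tauto.
Qed.

Let future (A : set (X * posreal R)) :=
  forall t, depends_on (fun i : int => 0 < i) (fun x => A (x, t)).

(* The K-structure: the sets that agree almost everywhere with an event of the
   strictly positive coordinates and of the second component. *)
Let F : set (set (X * posreal R)) := [set A | measurable A /\
  exists A0, [/\ measurable A0, future A0 & m (A `+` A0) = 0%E]].

Let F_future A : measurable A -> future A -> F A.
Proof. by move=> mA fA; split => //; exists A; rewrite setYK measure0. Qed.

Let F_sigma : sigma_algebra setT F.
Proof.
split.
- exact: F_future.
- move=> A [mA [A0 [mA0 fA0 AA0]]]; split; first exact: measurableD.
  exists (~` A0); split; first exact: measurableC.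
    by move=> t x x' xx'; rewrite /setC/= (fA0 t x x' xx').
  rewrite (_ : (_ `+` _) = A `+` A0)//.
  by apply/funext => p; apply/propext; rewrite !symdiffE /setD /setC/=; tauto.
move=> A FA; have /choice[A0 HA0] n : exists A0,
    [/\ measurable A0, future A0 & m (A n `+` A0) = 0%E] by case: (FA n).
have mA n : measurable (A n) by case: (FA n).
have mA0 n : measurable (A0 n) by case: (HA0 n).
have mY n : measurable (A n `+` A0 n) by exact: measurableY.
split; first exact: bigcupT_measurable.
exists (\bigcup_n A0 n); split; first exact: bigcupT_measurable.
  move=> t x x' xx'; apply/propext; split => -[n _ An]; exists n => //;
    by have [_ /(_ t x x' xx') fn _] := HA0 n; move: An; rewrite -?fn ?fn.
apply: (@null_sub _ _ _ _ _ (\bigcup_n (A n `+` A0 n))).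
- by apply: measurableY; exact: bigcupT_measurable.
- exact: bigcupT_measurable.
- by apply: null_bigcup => // n; case: (HA0 n).
move=> p [[[n _ Anp] nA]|[[n _ Anp] nA]]; exists n => //; [left|right]; split => // H;
  by apply: nA; exists n.
Qed.

(** Off M the map is the skew product by w, which moves index i + 1 to i and reads positive
    coordinates only, so it pulls future events back to future events. *)
Let F_preimage A : F A -> F (S @^-1` A).
Proof.
move=> [mA [A0 [mA0 fA0 AA0]]]; have mSA := measurable_pre mS mA.
have mSA0 := measurable_pre mS0 mA0.
have mY : measurable (A `+` A0) by exact: measurableY.
split => //; exists (S0 @^-1` A0); split => //.
  move=> t x x' xx'; rewrite /preimage/= /skew/= (dw xx').
  by apply: fA0 => i i0; rewrite /bits_shift; apply: xx'; lia.
apply: (@null_sub _ _ _ _ _ ((M `*` setT) `|` S0 @^-1` (A `+` A0))).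
- exact: measurableY.
- by apply: measurableU => //; exact: measurable_pre mS0 mY.
- apply: null_setU => //; first exact: measurable_pre mS0 mY.
  by rewrite [LHS]S0_m.
move=> [x t] H; have [Mx|Mx] := pselect (M x); [by left|right].
by move/symdiffE: H => H; apply/symdiffE; move: H; rewrite /preimage/= -(S_S0 t Mx).
Qed.

Let F_exhaustive : exhaustive mk S F.
Proof.
move=> A mA; exists A; last by rewrite setYK measure0.
set G := \bigcup_(n in _) _.
have S_F n C : F (iter n.+1 S @^-1` C) -> G C.
  move=> FC; exists n.+1 => //; exists (iter n.+1 S @^-1` C) => //.
  exact: image_preimage_inv (invertible_borel_iter n.+1 iS).
have gG C : G C -> (<<s G >>) C by move=> GC; exact: sub_sigma_algebra.
pose id' : g_sigma_algebraType G -> X * posreal R := id.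
suff mid : measurable_fun setT id'.
  by have := mid measurableT A mA; rewrite setTI.
apply/measurable_fun_pairP; split.
  (* For n = |i| + 1 the n-th iterate moves the coordinate at the positive index i + n to index i,
     so each coordinate event is the n-th image of a member of F. *)
  apply: measurable_bitsP => // i _ Y mY; rewrite setTI.
  suff FC : F (iter `|i|.+1 S @^-1` [set p : X * posreal R | Y (p.1 i)]).
    exact: (gG _ (S_F _ _ FC)).
  have -> : iter `|i|.+1 S @^-1` [set p : X * posreal R | Y (p.1 i)] =
      [set p : X * posreal R | Y (p.1 (i + `|i|.+1%:Z))].
    apply/funext => p.
    change (Y ((iter `|i|.+1 S p).1 i) = Y (p.1 (i + `|i|.+1%:Z))).
    have -> : (iter `|i|.+1 S p).1 = iter `|i|.+1 bits_shift p.1.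
      by elim: (`|i|.+1) => // n IH; rewrite !iterS -IH.
    by rewrite iter_bits_shift.
  apply: F_future; last by move=> t x x' xx'; rewrite /= xx'//; lia.
  apply: (@measurable_pre _ _ _ _ (fun p : X * posreal R => p.1 (i + `|i|.+1%:Z)) Y) => //.
  exact: (measurableT_comp (measurable_coord _) measurable_fst).
move=> _ Y mY; rewrite setTI.
suff FC : F (iter 1 S @^-1` (snd @^-1` Y)) by exact: (gG _ (S_F _ _ FC)).
by apply/F_preimage/F_future => //; exact: measurable_pre measurable_snd mY.
Qed.

Let F_trivial_tail : trivial_tail mk S F.
Proof.
move=> A FA; have [B1 FB1 AB1] := FA 1%N isT.
have F_A : F A by rewrite AB1; exact: F_preimage.
have mA : measurable A by case: F_A.
suff : m A = 0%E \/ m (~` A) = 0%E.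
  by move=> [/(mk_null mA)|/(mk_null (measurableC mA))]; [left|right].
apply: (tail_trivial hmu hT consT sum_inf wT mA) => -[|n].
  by have [_ [A0 [mA0 fA0 AA0]]] := F_A; exists A0.
have [B [mB [B0 [mB0 fB0 BB0]]] AB] := FA n.+1 isT.
exists B0; split => //.
have mY : measurable (B `+` B0) by exact: measurableY.
have mSn := measurable_iter mS n.+1; have mS0n := measurable_iter mS0 n.+1.
apply: (@null_sub _ _ _ _ _ ((M `*` setT) `|` iter n.+1 S0 @^-1` (B `+` B0))).
- by apply: measurableY => //; exact: measurable_pre mS0n mB0.
- by apply: measurableU => //; exact: measurable_pre mS0n mY.
- apply: null_setU => //; first exact: measurable_pre mS0n mY.
  by rewrite [LHS](measure_preserving_iter mS0 S0_m n.+1).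
move=> [x t] H; have [Mx|Mx] := pselect (M x); [by left|right].
move: H; rewrite AB => /symdiffE H; apply/symdiffE; move: H.
by rewrite /preimage; have := iterS0 n.+1 t Mx; rewrite /= => ->.
Qed.

Lemma maharam_K_automorphism : K_automorphism mk S.
Proof.
have mX_F E : measurable E -> F (setT `*` E).
  by move=> mE; apply: F_future => //; exact: measurableX.
split; first exact: preserving_nonsingular.
exists F; split; split => //.
- by move=> A [].
- have [E ET Efin] := sigma_finiteT kappa.
  exists (fun n => setT `*` E n).
    apply/seteqP; split => // -[x t] _.
    have [n _ Et] : (\bigcup_n E n) t by rewrite -ET.
    by exists n.
  move=> n; have [mE Ey] := Efin n; split; first exact: mX_F.
  rewrite [X in (X < _)%E]product_measure1E//.
  by rewrite [X in (X * _)%E]probability_setT mul1e.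
(* The extension preserves the measure, so the constant 1 is a version of its derivative. *)
exists (fun=> 1%:pos).
  move=> B mB; have [B1|B1] := pselect (B 1%:pos).
    rewrite (_ : _ @^-1` _ = setT `*` setT); first exact: mX_F.
    by apply/seteqP; split.
  rewrite (_ : _ @^-1` _ = setT `*` set0); first exact: mX_F.
  by apply/seteqP; split => // p [].
exact: (@preserving_rn_derivative _ _ _ (product_sf P kappa) S iS S_kappa).
Qed.

End maharam_of_shift.

Theorem theorem3p1 (R : realType) (mu : nat -> probability bool R)
    (hmu : forall n, (1 <= n)%N -> 0 < fine (mu n [set false]) < 1)
    (hT : nonsingular (infinite_product (two_sided mu)) bits_shift) :
  ((\sum_(1 <= n <oo)
      ((fine (mu n [set false]) - fine (mu 1%N [set false])) ^+ 2)%:E < +oo)%E ->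
    equivalent_measure (infinite_product (two_sided mu))
                       (infinite_product (fun _ : int => mu 1%N)) /\
    type_II1 (infinite_product (two_sided mu)) bits_shift) /\
  ((\sum_(1 <= n <oo)
      ((fine (mu n [set false]) - fine (mu 1%N [set false])) ^+ 2)%:E = +oo)%E ->
    conservative (infinite_product (two_sided mu)) bits_shift ->
    ergodic (infinite_product (two_sided mu)) bits_shift /\
    forall kappa : {sigma_finite_measure set (posreal R) -> \bar R},
      maharam_kappa kappa ->
      [/\ type_III1 kappa (infinite_product (two_sided mu)) bits_shift,
          weakly_mixing (infinite_product (two_sided mu) \x kappa)%E
            (maharam (infinite_product (two_sided mu)) bits_shift) &
          K_automorphism (infinite_product (two_sided mu) \x kappa)%E
            (maharam (infinite_product (two_sided mu)) bits_shift)]).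
Proof.
split=> [sum_fin|sum_inf consT].
  by split; [exact: square_summable_equivalent|exact: square_summable_type_II1].
have [w [wT dw [N [mN N0 wE]]]] := future_rn_derivative hmu hT.
have [M [mM M0 NM shiftM]] := invariant_null_cover hT mN N0.
have {NM}wE x : ~ M x -> rn_derivative (infinite_product (two_sided mu)) bits_shift x = w x.
  by move=> Mx; apply: wE => /NM.
have ergT : ergodic (infinite_product (two_sided mu)) bits_shift.
  (* Ergodicity of the shift does not mention kappa, so [kappa0] is used for the extension here. *)
  exact: (shift_ergodic hmu hT consT sum_inf wT dw mM M0 shiftM wE
    (@kappa0_scaling R) (@kappa0_neq0 R)).
split=> // kappa mk.
have scal := maharam_kappa_scaling mk; have kappa_neq0 := maharam_kappa_neq0 mk.
have wm := maharam_weakly_mixing hmu hT consT sum_inf wT dw mM M0 shiftM wE scal kappa_neq0.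
split=> //; last first.
  exact: (maharam_K_automorphism hmu hT consT sum_inf wT dw mM M0 shiftM wE scal kappa_neq0).
split=> //; last exact: weakly_mixing_ergodic wm.
apply: product_nonatomic; first exact: two_sided_past.
by move=> b; exact: two_sided_wt_gt0.
Qed.
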